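(* Assume $A$ is symmetrizable and even, and let $\lambda,\mu\in P^+$. Then there is an isomorphism of crystals $$\mathbb B(\lambda)\otimes\mathbb B(\mu)\ \cong\ \bigsqcup_{\substack{\pi\in\mathbb B(\mu)\\ \tilde\pi\ \tilde\lambda\text{-dominant}}}\mathbb B\bigl(\lambda+\pi(1)\bigr),$$ where $\pi\mapsto\tilde\pi$ is the map $\mathbb B(\mu)\to\tilde{\mathbb B}(\tilde\mu)$, $F_{\mathbf i}\pi_\mu\mapsto F_{(\mathbf i,\mathbf m)}\pi_{\tilde\mu}$, and $\tilde\pi$ is called $\tilde\lambda$-dominant if $\tilde\alpha^\vee_{(i,m)}(\tilde\pi(t)+\tilde\lambda)\ge0$ for all $(i,m)\in\tilde I$ and all $t\in[0,1]$.
   Context: Borcherds–Cartan datum $(A,\{\alpha_i\}_{i\in I},\{\alpha_i^\vee\}_{i\in I},P,P^\vee)$: $I$ countable; $a_{ii}=2$ or $a_{ii}\in\mathbb Z_{\le0}$, $a_{ij}\in\mathbb Z_{\le 0}$ ($i\ne j$), $a_{ij}=0\iff a_{ji}=0$; symmetrizable ($DA$ symmetric for some positive integral diagonal $D$) and even ($a_{ii}\in2\mathbb Z$); $P=\mathrm{Hom}(P^\vee,\mathbb Z)$, $\alpha_i^\vee(\alpha_j)=a_{ij}$, simple roots/coroots linearly independent; $I^{re}=\{i:a_{ii}=2\}$, $I^{im}=I\setminus I^{re}$; $P^+$ dominant integral weights. $r_i(\mu)=\mu-\alpha_i^\vee(\mu)\alpha_i$; $\mathcal W_{re}=\langle r_i:i\in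 I^{re}\rangle$; $\Delta^+_{re}$ positive real roots, $\Delta_{im}=\mathcal W_{re}\{\alpha_i\}_{i\in I^{im}}$, $\beta^\vee=w\alpha_i^\vee$, $r_\beta=wr_iw^{-1}$ for $\beta=w\alpha_i$. Monoid $\mathcal W$: generators $r_i$ ($i\in I$), relations $r_i^2=1$ ($i$ real), $(r_ir_j)^m=(r_jr_i)^m=1$ for real $i\neq j$ with $\mathrm{ord}(r_ir_j)=m\in\{2,3,4,6\}$, $r_ir_j=r_jr_i$ ($i\in I^{im}$, $j\ne i$, $a_{ij}=0$); acts on $\mathfrak h^*$. $\mathcal WP^+=\{w\lambda\}$. Order on $\mathcal W\lambda$, covering arrows $\xleftarrow{\beta}$, and $a$-chains: $\mu\ge\nu$ iff $\mu=\lambda_0,\dots,\lambda_k=\nu$ with $\lambda_{s-1}=r_{\beta_s}\lambda_s$, $\beta_s^\vee(\lambda_s)>0$; $\mu\xleftarrow\beta\nu$ if moreover a covering; an $a$-chain requires $a\beta_s^\vee(\nu_s)\in\mathbb Z_{>0}$ for real $\beta_s$ and $=1$ for imaginary. Paths, root operators and GLS paths: $\mathbb P$ = piecewise-linear $\pi:[0,1]\to\mathfrak h_{\mathbb R}^*$, $\pi(0)=0$, $\pi(1)\in P$; $H_i^\pi=\alpha_i^\vee\circ\pi$, $m_i^\pi=\min\{H_i^\pi(t)\in\mathbb Z\}$. $f_i$: zero if $f_+^i:=\max\{t:H_i^\pi(t)=m_i^\pi\}=1$; else with $f_-^i=\min\{t\ge f_+^i:H_i^\pi(t)=m_i^\pi+1\}$,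 $f_i\pi=\pi$ on $[0,f_+^i]$, $\pi-(H_i^\pi-m_i^\pi)\alpha_i$ on $[f_+^i,f_-^i]$, $\pi-\alpha_i$ after. Real $e_i$: zero if $e_+^i:=\min\{t:H_i^\pi=m_i^\pi\}=0$; else $e_-^i=\max\{t\le e_+^i:H_i^\pi=m_i^\pi+1\}$, $e_i\pi=\pi$ on $[0,e_-^i]$, $\pi-(H_i^\pi-m_i^\pi-1)\alpha_i$ on $[e_-^i,e_+^i]$, $\pi+\alpha_i$ after. Imaginary $e_i$: $e_-^i=f_+^i$; zero if $e_-^i=1$ or $H_i^\pi<m_i^\pi+1-a_{ii}$ on $[e_-^i,1]$; else $e_+^i=\min\{t\ge e_-^i:H_i^\pi=m_i^\pi+1-a_{ii}\}$; zero if $H_i^\pi(s)\le m_i^\pi-a_{ii}$ for some $s\ge e_+^i$; otherwise $\pi$ on $[0,e_-^i]$, $\pi+\frac1{1-a_{ii}}(H_i^\pi-m_i^\pi)\alpha_i$ on $[e_-^i,e_+^i]$, $\pi+\alpha_i$ after. $\mathcal F$ = monoid of the $f_i$; $F_{\mathbf i}=f_{i_k}\cdots f_{i_1}$ for $\mathbf i=(i_k,\ldots,i_1)$; $\pi_\mu(t)=t\mu$. $\mathbb B(\lambda)$ ($\lambda\in P^+$) = GLS paths $(\lambda_1>\dots>\lambda_k;0=a_0<\dots<a_k=1)$ in $\mathcal W\lambda$ with $a_s$-chains for $(\lambda_s,\lambda_{s+1})$ and a 1-chain for $(\lambda_k,\lambda)$, viewed as the path with slope $\lambda_s$ on $[a_{s-1},a_s]$;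 $\mathbb B(\lambda)=\mathcal F\pi_\lambda\setminus\{\mathbf0\}$. Concatenation $(\pi_1\otimes\pi_2)(t)=\pi_1(2t)$ on $[0,\frac12]$, $\pi_1(1)+\pi_2(2t-1)$ on $[\frac12,1]$; $\mathbb B(\lambda)\otimes\mathbb B(\mu)=\{\pi_1\otimes\pi_2\}$. Crystal structure (on $\mathbb B(\lambda)$, on $\mathbb B(\lambda)\otimes\mathbb B(\mu)$): $\mathrm{wt}=\pi(1)$; $\varepsilon_i=-m_i^\pi$, $\varphi_i=H_i^\pi(1)-m_i^\pi$ ($i$ real); $\varepsilon_i=0$, $\varphi_i=\alpha_i^\vee(\pi(1))$ ($i$ imaginary); $f_i$, real $e_i$ = root operators; imaginary $e_i$ = root operator if the result lies in the set, else $\mathbf0$. Associated Kac–Moody datum: $\tilde I=\{(i,1)\}_{i\in I^{re}}\sqcup\{(i,m)\}_{i\in I^{im},m\ge1}$; Cartan matrix $\tilde A$ with diagonal entries $2$ and $\tilde a_{(i,m),(j,n)}=a_{ij}$ off the diagonal; Cartan datum $(\tilde A,\{\tilde\alpha_{(i,m)}\},\{\tilde\alpha^\vee_{(i,m)}\},\tilde P,\tilde P^\vee)$ and Kac–Moody algebra $\tilde{\mathfrak g}$; for $\mu\in\mathcal WP^+$ a fixed $\tilde\mu\in\tilde P$ with $\tilde\alpha^\vee_{(i,m)}(\tilde\mu)=\alpha_i^\vee(\mu)$. $\tilde{\mathbb B}(\tilde\mu)$ = LS paths of shape $\tilde\mu$ for $\tilde{\mathfrak g}$ and $f_{(i,m)}$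 the root operators there (same definitions, all indices real). For $\mathbf i=(i_k,\ldots,i_1)$ let $m_s=1$ if $i_s\in I^{re}$, $m_s=\#\{t\le s:i_t=i_s\}$ if $i_s\in I^{im}$, and $F_{(\mathbf i,\mathbf m)}=f_{(i_k,m_k)}\cdots f_{(i_1,m_1)}$. The map $F_{\mathbf i}\pi_\mu\mapsto F_{(\mathbf i,\mathbf m)}\pi_{\tilde\mu}$ is well defined and injective $\mathbb B(\mu)\to\tilde{\mathbb B}(\tilde\mu)$. *)

(* Defs.v *)
From HB Require Import structures.
From mathcomp Require Import all_boot all_order all_algebra.
From mathcomp Require Import boolp classical_sets reals.

Set Implicit Arguments.
Unset Strict Implicit.
Unset Printing Implicit Defensive.

Import Order.TTheory GRing.Theory Num.Theory.
Local Open Scope classical_set_scope.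
Local Open Scope ring_scope.

Definition is_real_idx (J : Type) (A : J -> J -> int) (i : J) : bool := A i i == 2.

Definition BC_matrix (J : Type) (A : J -> J -> int) : Prop :=
  (forall i, A i i = 2 \/ A i i <= 0) /\
  (forall i j, i <> j -> A i j <= 0) /\
  (forall i j, A i j = 0 <-> A j i = 0).

Definition symmetrizable (J : Type) (A : J -> J -> int) : Prop :=
  exists d : J -> nat, (forall i, (0 < d i)%N) /\
    forall i j, (d i)%:Z * A i j = (d j)%:Z * A j i.

Definition even_matrix (J : Type) (A : J -> J -> int) : Prop :=
  forall i, exists k : int, A i i = 2 * k.

Definition free_zmod (V : zmodType) : Prop :=
  exists (B : eqType) (b : B -> V),
    (forall v : V, exists (s : seq B) (c : B -> int), v = \sum_(x <- s) b x *~ c x) /\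
    (forall (s : seq B) (c : B -> int), uniq s ->
        \sum_(x <- s) b x *~ c x = 0 -> forall x, x \in s -> c x = 0).

(* elements of P = Hom(P^vee, Z) *)
Definition in_P (V : zmodType) (nu : V -> int) : Prop :=
  forall x y, nu (x + y) = nu x + nu y.

(* Realization (A, {alpha_j}, {alpha_j^vee}, P, P^vee) with P^vee = V free,
   P = Hom(V, Z), alpha_j^vee = cv j, alpha_j = rt j, alpha_i^vee(alpha_j) = A i j,
   simple coroots and simple roots linearly independent. *)
Definition realization (J : eqType) (A : J -> J -> int) (V : zmodType)
    (cv : J -> V) (rt : J -> V -> int) : Prop :=
  [/\ free_zmod V,
      (forall j, in_P (rt j)),
      (forall i j, rt j (cv i) = A i j),
      (forall (s : seq J) (c : J -> int), uniq s ->
          \sum_(j <- s) cv j *~ c j = 0 -> forall j, j \in s -> c j = 0) &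
      (forall (s : seq J) (c : J -> int), uniq s ->
          (forall v, \sum_(j <- s) c j * rt j v = 0) -> forall j, j \in s -> c j = 0)].

Definition tI_pred (I : eqType) (A : I -> I -> int) (p : I * nat) : bool :=
  if A p.1 p.1 == 2 then p.2 == 1%N else (0 < p.2)%N.

Definition tI (I : eqType) (A : I -> I -> int) := {p : I * nat | tI_pred A p}.

Definition tA (I : eqType) (A : I -> I -> int) (p q : tI A) : int :=
  if val p == val q then 2 else A (val p).1 (val q).1.

Lemma tidx_proof (I : eqType) (A : I -> I -> int) (i : I) (n : nat) :
  tI_pred A (i, if A i i == 2 then 1%N else n.+1).
Proof. by rewrite /tI_pred /=; case: (A i i == 2). Qed.

Definition tidx_of (I : eqType) (A : I -> I -> int) (i : I) (n : nat) : tI A :=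
  @exist _ (fun p => tI_pred A p) _ (tidx_proof A i n).

(* For a word (i_k, ..., i_1) (head = last operator applied) compute
   ((i_k,m_k), ..., (i_1,m_1)), m_s = 1 for real i_s and
   m_s = #{t <= s | i_t = i_s} for imaginary i_s. *)
Fixpoint lift_word (I : eqType) (A : I -> I -> int) (w : seq I) : seq (tI A) :=
  match w with
  | [::] => [::]
  | i :: w' => tidx_of A i (count_mem i w') :: lift_word A w'
  end.

Section Paths.
Variables (R : realType) (J : Type) (V : Type).
Variables (A : J -> J -> int) (cv : J -> V) (rt : J -> V -> int).

(* h_R^* is modelled inside functions V -> R (V = P^vee); a path is a map
   t |-> pi(t); only t in [0,1] is relevant. *)
Definition cpath := R -> V -> R.

Definition in01 (t : R) : bool := (0 <= t) && (t <= 1).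

Definition Hf (i : J) (p : cpath) (t : R) : R := p t (cv i).

Definition aR (i : J) : V -> R := fun v => (rt i v)%:~R.

Definition mval (i : J) (p : cpath) : R :=
  inf [set r : R | exists t, in01 t /\ Hf i p t = r /\ exists z : int, r = z%:~R].

Definition fplus (i : J) (p : cpath) : R :=
  sup [set t : R | in01 t /\ Hf i p t = mval i p].

Definition fminus (i : J) (p : cpath) : R :=
  inf [set t : R | fplus i p <= t <= 1 /\ Hf i p t = mval i p + 1].

(* root operator f_i (None = 0) *)
Definition root_f (i : J) (p : cpath) : option cpath :=
  if fplus i p == 1 then None else
  Some (fun t v =>
    if t <= fplus i p then p t v
    else if t <= fminus i p then p t v - (Hf i p t - mval i p) * aR i v
    else p t v - aR i v).

Definition eplus_re (i : J) (p : cpath) : R :=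
  inf [set t : R | in01 t /\ Hf i p t = mval i p].

Definition eminus_re (i : J) (p : cpath) : R :=
  sup [set t : R | 0 <= t <= eplus_re i p /\ Hf i p t = mval i p + 1].

Definition root_e_re (i : J) (p : cpath) : option cpath :=
  if eplus_re i p == 0 then None else
  Some (fun t v =>
    if t <= eminus_re i p then p t v
    else if t <= eplus_re i p then p t v - (Hf i p t - mval i p - 1) * aR i v
    else p t v + aR i v).

(* imaginary e_i ; e_-^i = f_+^i *)
Definition aii (i : J) : R := (A i i)%:~R.

Definition eplus_im (i : J) (p : cpath) : R :=
  inf [set t : R | fplus i p <= t <= 1 /\ Hf i p t = mval i p + 1 - aii i].

Definition root_e_im (i : J) (p : cpath) : option cpath :=
  if (fplus i p == 1) ||
     `[< forall t, fplus i p <= t <= 1 -> Hf i p t < mval i p + 1 - aii i >]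
  then None
  else if `[< exists s, eplus_im i p <= s <= 1 /\ Hf i p s <= mval i p - aii i >]
  then None
  else Some (fun t v =>
    if t <= fplus i p then p t v
    else if t <= eplus_im i p
         then p t v + (Hf i p t - mval i p) / (1 - aii i) * aR i v
    else p t v + aR i v).

Definition Fw (w : seq J) (p : cpath) : option cpath :=
  foldr (fun i o => obind (root_f i) o) (Some p) w.

Definition pi_of (nu : V -> R) : cpath := fun t v => t * nu v.

Definition Bset (nu : V -> R) : set cpath :=
  [set p | exists w : seq J, Fw w (pi_of nu) = Some p].

Definition concat (p1 p2 : cpath) : cpath :=
  fun t v => if t <= 2^-1 then p1 (2 * t) v else p1 1 v + p2 (2 * t - 1) v.

Definition cwt (p : cpath) : V -> R := p 1.

Definition ceps (i : J) (p : cpath) : R :=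
  if is_real_idx A i then - mval i p else 0.

Definition cphi (i : J) (p : cpath) : R :=
  if is_real_idx A i then Hf i p 1 - mval i p else Hf i p 1.

Definition cf (i : J) (p : cpath) : option cpath := root_f i p.

Definition ce (S : set cpath) (i : J) (p : cpath) : option cpath :=
  if is_real_idx A i then root_e_re i p
  else obind (fun q => if `[< S q >] then Some q else None) (root_e_im i p).

End Paths.

Definition toR (R : realType) (V : Type) (nu : V -> int) : V -> R :=
  fun v => (nu v)%:~R.

Definition tensor_set (R : realType) (J V : Type) (cv : J -> V) (rt : J -> V -> int)
    (nu1 nu2 : V -> R) : set (cpath R V) :=
  [set p | exists p1 p2, Bset cv rt nu1 p1 /\ Bset cv rt nu2 p2 /\ p = concat p1 p2].

Definition tdominant (R : realType) (J V : Type) (cv : J -> V) (lamt : V -> int)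
    (p : cpath R V) : Prop :=
  forall (j : J) (t : R), in01 t -> 0 <= p t (cv j) + (lamt (cv j))%:~R.

Definition good_pi (R : realType) (I : eqType) (A : I -> I -> int)
    (Pv Pvt : Type) (cv : I -> Pv) (rt : I -> Pv -> int)
    (cvt : tI A -> Pvt) (rtt : tI A -> Pvt -> int)
    (mu : Pv -> int) (lamt mut : Pvt -> int) (p : cpath R Pv) : Prop :=
  exists w : seq I, Fw cv rt w (pi_of (toR R mu)) = Some p /\
    exists pt, Fw cvt rtt (lift_word A w) (pi_of (toR R mut)) = Some pt /\
               tdominant cvt lamt pt.

(* the disjoint union  |_|_{pi} B(lambda + pi(1)), as pairs (pi, b) *)
Definition union_set (R : realType) (I : eqType) (A : I -> I -> int)
    (Pv Pvt : Type) (cv : I -> Pv) (rt : I -> Pv -> int)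
    (cvt : tI A -> Pvt) (rtt : tI A -> Pvt -> int)
    (lam mu : Pv -> int) (lamt mut : Pvt -> int) : set (cpath R Pv * cpath R Pv) :=
  [set q | good_pi cv rt cvt rtt mu lamt mut q.1 /\
           Bset cv rt (fun v => toR R lam v + q.1 1 v) q.2].

Definition union_f (R : realType) (J V : Type) (cv : J -> V) (rt : J -> V -> int)
    (i : J) (q : cpath R V * cpath R V) : option (cpath R V * cpath R V) :=
  omap (fun b => (q.1, b)) (cf cv rt i q.2).

Definition union_e (R : realType) (J V : Type) (A : J -> J -> int) (cv : J -> V)
    (rt : J -> V -> int) (lam : V -> int)
    (i : J) (q : cpath R V * cpath R V) : option (cpath R V * cpath R V) :=
  omap (fun b => (q.1, b))
       (ce A cv rt (Bset cv rt (fun v => toR R lam v + q.1 1 v)) i q.2).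

(* Main.v *)
(* A root operator f_i moves a path p to p - th (H_i p) alpha_i, where th is Lipschitz in H_i p.
   For a base path X with regular increments and nonintegral endpoint pairings, every word in
   the e_i and f_i turns X into a path folded along Bruhat chains, for which the minima of the
   H_i are integers.  These minima depend continuously on X, so they are constant along the
   homotopy between two bases with the same endpoint, and a limit argument covers dominant
   bases: words in the f_i see only the endpoint of the base.  In particular
   pi_lambda (x) pi_mu generates the crystal of lambda + mu.  Splitting and redistributing large
   dominant weights then shows that, for an LS path pi, the element pi_lambda (x) pi generates
   the crystal of lambda + pi(1) as soon as pi is lambda-dominant.

   A word over I lifts to a word over the Kac-Moody index set in which every imaginary label
   occurs at most once; then f_i and f_(i,m) act by the same displacement.  The lift depends
   only on the path and not on the word: the displacement of a fresh label is min(1, n t), and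
   a sum of such functions determines the slopes n.  The isomorphism sends
   F_w (pi_lambda (x) pi), with pi dominant, to (pi, F_w pi_(lambda + pi(1))). *)
Require Import Defs.
From HB Require Import structures.
From mathcomp Require Import all_boot all_order all_algebra.
From mathcomp Require Import boolp classical_sets reals.
From mathcomp Require Import zify ring lra.
Import Order.TTheory GRing.Theory Num.Theory.
Local Open Scope classical_set_scope.
Local Open Scope ring_scope.
Set Implicit Arguments.
Unset Strict Implicit.
Unset Printing Implicit Defensive.

(** * Words in simple reflections *)

(** Regular increments make the sign of each H_i along a segment depend on the direction w alone, so
    no stabilisers or cosets enter. Nonintegrality at time 1 stops f_i from folding a path right up
    to its end, which would spoil the final direction 1; since e_i and f_i move endpoints by
    integers, it persists under all words. Words in the e_i are needed even to compare words in the
    f_i: two f-words agree on a base exactly when undoing one after applying the other returns the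
    base, and that is visible from minima alone. For imaginary i the obstacle is that f_i never
    lowers H_i, whereas a real label, once applied, lowers its own pairing; a label therefore models
    f_i only at its first use. Recovering the labels from the path rests on symmetrizability, which
    forces the pairing with a fresh label to be linear in t until it reaches 1. Tensor comparisons
    are made for words of bounded length because redistributing weights requires weights larger than
    twice that length. *)

Section WeylWords.
Variables (R : realType) (J : eqType) (A : J -> J -> int).
Implicit Types (u v : J + J -> R) (w : seq J) (i j : J).

(* Vectors live on [J + J]: [inl j] is the pairing with the j-th coroot, [inr j] the
   coefficient of the j-th simple root, so that the simple roots are independent. *)
Definition rootv i (z : J + J) : int :=
  match z with inl k => A k i | inr k => (k == i)%:Z end.

Definition refl i v : J + J -> R := fun z => v z - v (inl i) * (rootv i z)%:~R.

Definition act w v := foldr refl v w.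

(** The Weyl group is not formed as a type: its elements are words up to equal action, and lengths
    and signs are shown to respect [eqw]. *)
Definition eqw w w' := forall v, act w v = act w' v.

Lemma act_cat w w' v : act (w ++ w') v = act w (act w' v).
Proof. by rewrite /act foldr_cat. Qed.

Lemma act_lin w (c : R) u v :
  act w (fun z => c * u z + v z) = fun z => c * act w u z + act w v z.
Proof.
elim: w => //= i w ->; apply/funext => z; rewrite /refl; ring.
Qed.

Lemma act0 w : act w (fun=> 0) = fun=> 0.
Proof. by elim: w => //= i w ->; apply/funext => z; rewrite /refl mul0r subr0. Qed.

Lemma actZ w (c : R) u : act w (fun z => c * u z) = fun z => c * act w u z.
Proof.
have := act_lin w c u (fun=> 0); rewrite act0.
under eq_fun do rewrite addr0; move=> ->.
by apply/funext => z; rewrite addr0.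
Qed.

Lemma actB w u v : act w (fun z => u z - v z) = fun z => act w u z - act w v z.
Proof.
have := act_lin w (-1) v u.
have -> : (fun z => -1 * v z + u z) = (fun z => u z - v z).
  by apply/funext => z; ring.
by move=> ->; apply/funext => z; ring.
Qed.

Lemma eqw_sym w w' : eqw w w' -> eqw w' w. Proof. by move=> h v; rewrite h. Qed.
Lemma eqw_trans w2 w1 w3 : eqw w1 w2 -> eqw w2 w3 -> eqw w1 w3.
Proof. by move=> h h' v; rewrite h. Qed.
Lemma eqw_cat w1 w1' w2 w2' :
  eqw w1 w1' -> eqw w2 w2' -> eqw (w1 ++ w2) (w1' ++ w2').
Proof. by move=> h h' v; rewrite !act_cat h' h. Qed.

Lemma eqw_catl y w w' : eqw w w' -> eqw (y ++ w) (y ++ w').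
Proof. exact: eqw_cat. Qed.
Lemma eqw_catr y w w' : eqw w w' -> eqw (w ++ y) (w' ++ y).
Proof. by move=> h; apply: eqw_cat. Qed.

Fact len_ex w : exists n, `[< exists w', size w' = n /\ eqw w w' >].
Proof. by exists (size w); apply/asboolP; exists w. Qed.

Definition len w : nat := ex_minn (len_ex w).

Lemma len_red w : exists2 w', eqw w w' & size w' = len w.
Proof.
by rewrite /len; case: ex_minnP => n /asboolP[w' [<- h]] _; exists w'.
Qed.

Lemma len_min w w' : eqw w w' -> (len w <= size w')%N.
Proof.
move=> h; rewrite /len; case: ex_minnP => n _; apply.
by apply/asboolP; exists w'.
Qed.

Lemma len_eqw w w' : eqw w w' -> len w = len w'.
Proof.
move=> h; apply/eqP; rewrite eqn_leq; apply/andP; split.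
  by case: (len_red w') => y h' <-; apply: len_min; apply: eqw_trans h'.
by case: (len_red w) => y h' <-; apply: len_min; apply: eqw_trans h'; apply: eqw_sym.
Qed.

Lemma len_cat w w' : (len (w ++ w') <= size w + len w')%N.
Proof.
case: (len_red w') => y h <-; rewrite -size_cat; apply: len_min.
by apply: eqw_cat.
Qed.

Lemma len_cons i w : (len (i :: w) <= (len w).+1)%N.
Proof. exact: (len_cat [:: i] w). Qed.

Lemma len0 w : len w = 0%N -> eqw w [::].
Proof. by move=> h; case: (len_red w) => w' e; rewrite h => /size0nil e'; rewrite -e'. Qed.

Lemma len_pos w : (0 < len w)%N ->
  exists i w', eqw w (i :: w') /\ (len w = (len w').+1)%N.
Proof.
case: (len_red w) => -[|i w'] e /= ew; first by rewrite -ew.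
move=> _; exists i, w'; split=> //; apply/eqP; rewrite eqn_leq.
rewrite {1}(len_eqw e) len_cons -ew ltnS; exact: len_min.
Qed.

Hypothesis Adiag : forall i, A i i = 2.

Lemma reflK i v : refl i (refl i v) = v.
Proof.
apply/funext => z; rewrite /refl /= Adiag; ring.
Qed.

Lemma eqw_consK i w : eqw (i :: i :: w) w.
Proof. by move=> v /=; rewrite reflK. Qed.

Lemma act_revK w v : act (rev w) (act w v) = v.
Proof.
by elim: w v => //= i w IH v; rewrite rev_cons -cats1 act_cat /= reflK IH.
Qed.

Lemma act_Krev w v : act w (act (rev w) v) = v.
Proof. by rewrite -{1}(revK w) act_revK. Qed.

Lemma len_cons' i w : (len w <= (len (i :: w)).+1)%N.
Proof. by rewrite -{1}(len_eqw (eqw_consK i w)) len_cons. Qed.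

Definition reg v := forall j, 0 < v (inl j).

Fixpoint altw (a b : J) (n : nat) : seq J :=
  if n is n'.+1 then a :: altw b a n' else [::].

Lemma size_altw a b n : size (altw a b n) = n.
Proof. by elim: n a b => //= n IH a b; rewrite IH. Qed.

Lemma altwS a b n : altw a b n.+1 = rcons (altw a b n) (if odd n then b else a).
Proof. by elim: n a b => // n IH a b; rewrite [LHS]/= -/(altw b a n.+1) IH /=; case: odd. Qed.

Lemma altwD a b m n : exists y, altw a b (m + n) = altw a b m ++ y /\ size y = n.
Proof.
elim: m a b => [|m IH] a b; first by exists (altw a b n); rewrite size_altw.
by case: (IH b a) => y [e s]; exists y; rewrite /= e.
Qed.

(* The two coordinates of a vector seen by the rank two subgroup <s_i, s_j>,
   together with one more coordinate. *)
Definition tri p q (a : bool) (ri rj : R) (s : R * R * R) : R * R * R :=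
  let: (vi, vj, vz) := s in
  if a then (- vi, vj + q * vi, vz - vi * ri) else (vi + p * vj, - vj, vz - vj * rj).

Fixpoint altb (a : bool) n := if n is n'.+1 then a :: altb (~~ a) n' else [::].

Lemma act_tri i j (a : bool) n v z :
  (act (altw (if a then i else j) (if a then j else i) n) v (inl i),
   act (altw (if a then i else j) (if a then j else i) n) v (inl j),
   act (altw (if a then i else j) (if a then j else i) n) v z) =
  foldr (fun b s => tri (- (A i j)%:~R) (- (A j i)%:~R) b (rootv i z)%:~R (rootv j z)%:~R s)
    (v (inl i), v (inl j), v z) (altb a n).
Proof.
elim: n a => // n IH a /=.
have -> : altw (if a then j else i) (if a then i else j) n =
          altw (if ~~ a then i else j) (if ~~ a then j else i) n by case: a.
rewrite -IH /tri.
by case: a => /=; rewrite /refl /= Adiag; congr (_, _, _); ring.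
Qed.

(** In the six finite rank two types both alternating words of length m are the longest element;
    [act_tri] reduces this to an explicit computation in three coordinates. *)
Lemma braid i j m :
  (A i j = 0 /\ A j i = 0 /\ m = 2%N) \/
  (A i j = -1 /\ A j i = -1 /\ m = 3%N) \/
  (A i j = -1 /\ A j i = -2 /\ m = 4%N) \/
  (A i j = -2 /\ A j i = -1 /\ m = 4%N) \/
  (A i j = -1 /\ A j i = -3 /\ m = 6%N) \/
  (A i j = -3 /\ A j i = -1 /\ m = 6%N) ->
  eqw (altw j i m) (altw i j m).
Proof.
move=> h v; apply/funext => z.
have /(congr1 snd) /= e1 := act_tri i j false m v z.
have /(congr1 snd) /= e2 := act_tri i j true m v z.
rewrite e1 e2.
by case: h => [|[|[|[|[|]]]]] [-> [-> ->]] /=; ring.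
Qed.

End WeylWords.

(** * Lengths and positivity of real coroots *)

Section WeylPositivity.
Variables (R : realType) (J : eqType) (A : J -> J -> int).
Implicit Types (u v d : J + J -> R) (w : seq J) (i j : J).
Hypothesis Adiag : forall i, A i i = 2.
Hypothesis Aoff : forall i j, i <> j -> A i j <= 0.
Hypothesis Azero : forall i j, A i j = 0 <-> A j i = 0.

Local Notation act := (@act R J A).
Local Notation eqw := (@eqw R J A).
Local Notation len := (@len R J A).
Local Notation reg := (@reg R J).

(** Coordinates, in the i-th and j-th coroots, of the i-th coroot pulled back along an alternating
    word of length n, where p and q are the negated off-diagonal entries (see [altw_coef]). *)
Fixpoint dcoef (p q : int) (n : nat) : int * int :=
  if n is n'.+1 then
    let: (a, b) := dcoef p q n' in
    if odd n' then (q * b - a, b) else (a, p * a - b)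
  else (1, 0).

Definition cpos (c : int * int) := [&& 0 <= c.1, 0 <= c.2 & 0 < c.1 + c.2].

Lemma altw_coef i j n v :
  let c := dcoef (- A i j) (- A j i) n in
  act (altw j i n) v (inl i) = c.1%:~R * v (inl i) + c.2%:~R * v (inl j).
Proof.
elim: n v => [|n IH] v; first by rewrite /= mul1r mul0r addr0.
rewrite altwS -cats1 act_cat IH /=; case: (dcoef _ _ n) => a b.
by case: odd; rewrite /= /refl /= Adiag; ring.
Qed.

Lemma cpos_large p q n : 0 < p -> 0 < q -> 4 <= p * q -> cpos (dcoef p q n).
Proof.
move=> p0 q0 pq.
(* Positivity alone is not inductive. The third inequality bounds the ratio of the two coefficients,
   and [4 <= p * q] makes it reproduce itself with the roles exchanged. *)
have inv : let: (a, b) := dcoef p q n in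
  if odd n then [/\ 0 < b, 0 <= a & p * a <= 2 * b]
  else [/\ 0 < a, 0 <= b & q * b <= 2 * a].
  elim: n => [|n] /=; first by rewrite mulr0.
  case: (dcoef p q n) => a b; case: odd => /= -[h1 h2 h3]; split=> //; nia.
rewrite /cpos; case: (dcoef p q n) inv => a b; case: odd => -[h1 h2 h3] /=; lia.
Qed.

(** The subgroup generated by i and j is infinite when the product of the two entries is at least 4;
    otherwise only the six finite types remain and the finitely many coefficients are computed. *)
Lemma dihedral i j : i <> j ->
  (forall n, cpos (dcoef (- A i j) (- A j i) n)) \/
  exists2 m, eqw (altw j i m) (altw i j m) /\ (0 < m)%N &
    forall n, (n < m)%N -> cpos (dcoef (- A i j) (- A j i) n).
Proof.
move=> nij; have hp := Aoff nij.
have hq : A j i <= 0 by apply: Aoff => e; apply: nij.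
have hz := Azero i j.
have [pq|pq] := leP 4 ((- A i j) * (- A j i)).
  by left=> n; apply: cpos_large => //; nia.
right.
have : (A i j = 0 /\ A j i = 0) \/ (A i j = -1 /\ A j i = -1) \/
   (A i j = -1 /\ A j i = -2) \/ (A i j = -2 /\ A j i = -1) \/
   (A i j = -1 /\ A j i = -3) \/ (A i j = -3 /\ A j i = -1).
  have [e|ne] := eqVneq (A i j) 0; first by left; rewrite e (hz.1 e).
  have ne' : A j i <> 0 by move/hz.2/eqP; apply/negP.
  by move/eqP: ne => ne; nia.
have fin m : (forall n, (n < m)%N -> cpos (dcoef (- A i j) (- A j i) n)) <->
    all (fun n => cpos (dcoef (- A i j) (- A j i) n)) (iota 0 m).
  split=> [h|/allP h n nm]; last by apply: h; rewrite mem_iota.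
  by apply/allP => n; rewrite mem_iota => /andP[_]; apply: h.
by move=> [|[|[|[|[|]]]]] [e1 e2];
  [exists 2%N | exists 3%N | exists 4%N | exists 4%N | exists 6%N | exists 6%N];
  rewrite ?fin ?e1 ?e2 //; split=> //; apply: braid => //; tauto.
Qed.

(** Induction on the length: split off from w a longest alternating word in i and j, where j starts
    a reduced form of w. Neither i nor j shortens the rest, so both coroots are positive there by
    induction, and the rank two coefficients carry positivity back to w. *)
Lemma len_ge_pos w i d :
  reg d -> (len w <= len (i :: w))%N -> 0 < act w d (inl i).
Proof.
move=> dreg; move: {2}(len w) (leqnn (len w)) => N.
elim: N w i => [|N IH] w i lwN lwi.
  by move: lwN; rewrite leqn0 => /eqP /len0 ->; apply: dreg.
have [lw0|lw0] := posnP (len w); first by rewrite (len0 lw0); apply: dreg.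
have [j [w1 [ew lw1]]] := len_pos lw0.
have nij : i <> j.
  move=> eij; subst j; move: lwi.
  by rewrite (@len_eqw _ _ _ (i :: w) w1) ?lw1 ?ltnn // => v /=; rewrite ew /= reflK.
pose fact n := `[< exists v1 : seq J, eqw w (altw j i n ++ v1) /\ (len w = n + len v1)%N >].
have f1 : exists n, fact n by exists 1%N; apply/asboolP; exists w1.
have fb n : fact n -> (n <= len w)%N.
  by move=> /asboolP[v1 [_ ->]]; apply: leq_addr.
case: (ex_maxnP f1 fb) => n /asboolP[v1 [ev lv]] nmax.
have n0 : (0 < n)%N by apply: (nmax 1%N); apply/asboolP; exists w1.
(* If k shortened v1, it would either prolong the alternating prefix, against maximality, or cancel
   its last letter, against the length of w. *)
have key k : k = i \/ k = j -> (len v1 <= len (k :: v1))%N.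
  move=> hk; rewrite leqNgt; apply/negP => lkv.
  have lv1 : len v1 = (len (k :: v1)).+1.
    by apply/eqP; rewrite eqn_leq lkv andbT; apply: len_cons'.
  case: (eqVneq k (if odd n then i else j)) => [ek|nk].
    have : fact n.+1.
      apply/asboolP; exists (k :: v1); split; last by rewrite lv lv1 addnS.
      apply: (eqw_trans ev); rewrite altwS -ek -cats1 -catA; apply: eqw_cat => //=.
      by apply: eqw_sym; apply: eqw_consK.
    by move/nmax; rewrite ltnn.
  case: n n0 ev lv nk {nmax} => // n _ ev lv nk.
  have ek : k = (if odd n then i else j).
    by move: nk; rewrite /=; case: hk => ->; case: odd => //=; rewrite eqxx.
  have : (len w <= n + len (k :: v1))%N.
    rewrite -{1}(size_altw j i n); apply: leq_trans (len_cat _ _ _ _).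
    apply: eq_leq; apply: len_eqw; apply: (eqw_trans ev).
    by rewrite altwS -ek -cats1 -catA; apply: eqw_cat.
  by rewrite lv lv1; lia.
have lvN : (len v1 <= N)%N by move: lv lwN n0; lia.
have vi : 0 < act v1 d (inl i) by apply: IH => //; apply: key; left.
have vj : 0 < act v1 d (inl j) by apply: IH => //; apply: key; right.
rewrite ev act_cat altw_coef.
have fin : cpos (dcoef (- A i j) (- A j i) n) ->
    0 < ((dcoef (- A i j) (- A j i) n).1%:~R * act v1 d (inl i) +
         (dcoef (- A i j) (- A j i) n).2%:~R * act v1 d (inl j)).
  case: dcoef => a b /= /and3P[/= a0 b0 ab].
  have [ha|ha] : 0 < a \/ 0 < b by lia.
  - by rewrite ltr_pwDl ?mulr_gt0 ?ltr0z ?mulr_ge0 ?ler0z // ltW.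
  - by rewrite ltr_wpDl ?mulr_gt0 ?ltr0z ?mulr_ge0 ?ler0z // ltW.
apply: fin.
case: (dihedral nij) => [//|[m [em m0] hm]].
(* A prefix of length at least m could be rewritten by the braid relation to start with i, and then
   [i :: w] would be shorter than w. *)
have [nm|mn] := ltnP n m; first exact: hm.
have [y [ey sy]] := altwD j i m (n - m).
case: m m0 em {hm} mn ey sy => // m _ em mn ey sy.
have : (len (i :: w) <= size (altw j i m ++ y) + len v1)%N.
  apply: leq_trans (len_cat _ _ _ _); apply: eq_leq; apply: len_eqw => z.
  have := em (act y (act v1 z)).
  rewrite /= ev -(subnKC mn) ey !act_cat /= => ->.
  by rewrite reflK.
rewrite size_cat size_altw sy; move: lwi lv mn; lia.
Qed.

Lemma sgn_act w i :
  (forall d, reg d -> 0 < act w d (inl i)) \/ (forall d, reg d -> act w d (inl i) < 0).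
Proof.
have [h|h] := leqP (len w) (len (i :: w)).
  by left=> d dr; apply: len_ge_pos.
right=> d dr; have := @len_ge_pos (i :: w) i d dr.
rewrite (len_eqw (eqw_consK Adiag i w)) => /(_ (ltnW h)).
by rewrite /= /refl /= Adiag; lra.
Qed.

Definition rho : J + J -> R := fun=> 1.
Lemma reg_rho : reg rho. Proof. by move=> j; rewrite /rho ltr01. Qed.

(** Says that the i-th coroot pulled back along w is positive, equivalently that [i :: w] is longer
    than w. By [posP] any regular vector could replace [rho]. *)
Definition pos w i := 0 < act w rho (inl i).

Lemma posP w i d : reg d -> pos w i = (0 < act w d (inl i)).
Proof.
move=> dr; rewrite /pos; case: (sgn_act w i) => h.
  by rewrite (h _ dr) (h _ reg_rho).
by have := h _ dr; have := h _ reg_rho; rewrite !ltNge => h1 h2; apply/idP/idP; lra.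
Qed.

Lemma pos_negE w i d : reg d -> ~~ pos w i = (act w d (inl i) < 0).
Proof.
move=> dr; rewrite (posP _ _ dr); case: (sgn_act w i) => h.
  by rewrite (h _ dr) /=; have := h _ dr; lra.
by rewrite (h _ dr); have := h _ dr; lra.
Qed.

Lemma pos_cons w i : pos (i :: w) i = ~~ pos w i.
Proof.
rewrite (pos_negE _ _ reg_rho) /pos /= /refl /= Adiag.
by apply/idP/idP; lra.
Qed.

Lemma len_pos_cons w i : pos w i -> len (i :: w) = (len w).+1.
Proof.
move=> h; apply/eqP; rewrite eqn_leq len_cons /= ltnNge; apply/negP => hl.
have : pos (i :: w) i.
  rewrite (posP _ _ reg_rho); apply: len_ge_pos; first exact: reg_rho.
  by rewrite (len_eqw (eqw_consK Adiag i w)); apply: leq_trans hl _.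
by rewrite pos_cons h.
Qed.

Lemma len_neg_cons w i : ~~ pos w i -> len w = (len (i :: w)).+1.
Proof.
rewrite -pos_cons => /len_pos_cons <-.
by rewrite (len_eqw (eqw_consK Adiag i w)).
Qed.

Lemma pos_eqw w w' i : eqw w w' -> pos w i = pos w' i.
Proof. by move=> e; rewrite /pos e. Qed.

Lemma reg_act_id w d : reg d -> reg (act w d) -> len w = 0%N.
Proof.
move=> dr wdr; apply/eqP; rewrite -leqn0 leqNgt; apply/negP => /len_pos[i [w' [e l]]].
have hp : pos w i by rewrite (posP _ _ dr).
have := len_pos_cons hp.
rewrite (@len_eqw _ _ _ (i :: w) w') ?l; first lia.
by move=> v /=; rewrite e /= reflK.
Qed.

(** A negative value would survive the addition of a small multiple of [rho], which makes v
    regular. *)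
Lemma act_nonneg y i v :
  pos y i -> (forall j, 0 <= v (inl j)) -> 0 <= act y v (inl i).
Proof.
move=> hp v0; rewrite leNgt; apply/negP => hlt.
have [e e0 he] : exists2 e : R, 0 < e & act y v (inl i) + e * act y rho (inl i) < 0.
  exists (- act y v (inl i) / (2 * act y rho (inl i))).
    by rewrite divr_gt0 ?oppr_gt0 ?mulr_gt0.
  have rn : act y rho (inl i) != 0 by rewrite gt_eqF.
  have -> : - act y v (inl i) / (2 * act y rho (inl i)) * act y rho (inl i) =
            - act y v (inl i) / 2 by field.
  lra.
have : 0 < act y (fun z => e * rho z + v z) (inl i).
  by rewrite -posP // => j; rewrite ltr_pwDl // mulr_gt0 // /rho ltr01.
by rewrite act_lin; lra.
Qed.

End WeylPositivity.

(** * Bruhat chains *)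

Section WeylChains.
Variables (R : realType) (J : eqType) (A : J -> J -> int).
Implicit Types (u v d x : J + J -> R) (w y : seq J) (i j : J).
Hypothesis Adiag : forall i, A i i = 2.
Hypothesis Aoff : forall i j, i <> j -> A i j <= 0.
Hypothesis Azero : forall i j, A i j = 0 <-> A j i = 0.

Local Notation act := (@act R J A).
Local Notation eqw := (@eqw R J A).
Local Notation len := (@len R J A).
Local Notation reg := (@reg R J).
Local Notation pos := (@pos R J A).
Local Notation rho := (@rho R J).

Definition rootR i : J + J -> R := fun z => (rootv A i z)%:~R.

Definition isint (x : J + J -> R) := forall z, x z \is a Num.int.

Lemma act_int w v : isint v -> isint (act w v).
Proof.
move=> hv; elim: w => //= i w IH z.
by rewrite /refl rpredB ?IH // rpredM ?IH // intr_int.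
Qed.

Lemma rootR_int i : isint (rootR i). Proof. by move=> z; apply: intr_int. Qed.

Lemma act_nonpos y i v :
  ~~ pos y i -> (forall j, 0 <= v (inl j)) -> act y v (inl i) <= 0.
Proof.
move=> hp v0; have := @act_nonneg R J A Adiag Aoff Azero (i :: y) i v.
rewrite pos_cons // hp => /(_ isT v0).
by rewrite /= /refl /= Adiag; lra.
Qed.

(* The reflection in the real root whose coroot is the functional
   v |-> act y v (inl i). *)
Definition refw y i := rev y ++ i :: y.

Lemma act_refw y i v :
  act (refw y i) v = fun z => v z - act y v (inl i) * act (rev y) (rootR i) z.
Proof.
rewrite /refw act_cat /= /refl.
have -> : (fun z => act y v z - act y v (inl i) * (rootv A i z)%:~R) =
  (fun z => - act y v (inl i) * rootR i z + act y v z).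
  by apply/funext => z; rewrite /rootR; ring.
rewrite act_lin act_revK //; apply/funext => z; ring.
Qed.

Lemma refw_rcons y i j : refw (rcons y j) i = j :: refw y i ++ [:: j].
Proof. by rewrite /refw rev_rcons -cats1 /= -catA. Qed.

Lemma refw_rconsE y i j w : eqw (refw (rcons y j) i ++ j :: w) (j :: refw y i ++ w).
Proof. by move=> v; rewrite refw_rcons /= !act_cat /= reflK. Qed.

(** The only positive coroot that s_j makes negative is the j-th one. As a functional it is
    nonnegative on dominant vectors and nonpositive on those fixed by s_j, so it vanishes on the
    j-th wall and is a multiple c of the j-th coordinate. *)
Lemma simple_coroot y i j : pos y i -> ~~ pos (rcons y j) i ->
  forall v, act y v (inl i) = v (inl j).
Proof.
move=> hp hn.
have z0 v : v (inl j) = 0 -> (forall k, 0 <= v (inl k)) -> act y v (inl i) = 0.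
  move=> vj v0; apply/eqP; rewrite eq_le act_nonneg // andbT.
  have := act_nonpos hn v0; rewrite -cats1 act_cat /=.
  suff -> : refl A j v = v by [].
  by apply/funext => z; rewrite /refl vj mul0r subr0.
have z1 v : v (inl j) = 0 -> act y v (inl i) = 0.
  move=> vj.
  (* Positive and negative parts are dominant and lie on the same wall. *)
  have -> : v = (fun z => Num.max (v z) 0 - Num.max (- v z) 0).
    by apply/funext => z; rewrite /Num.max; case: ifP; case: ifP; lra.
  rewrite actB !z0 ?subr0 ?vj ?oppr0 ?maxxx // => k; by rewrite le_max lexx orbT.
pose e : J + J -> R := fun z => (z == inl j)%:R.
pose c := act y e (inl i).
have Lv v : act y v (inl i) = v (inl j) * c.
  rewrite {1}(_ : v = fun z => v (inl j) * e z + (v z - v (inl j) * e z)); last first.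
    by apply/funext => z; ring.
  have ej : e (inl j) = 1 by rewrite /e eqxx.
  rewrite act_lin (z1 (fun z => v z - v (inl j) * e z)) ?addr0 //.
  by rewrite ej mulr1 subrr.
have c0 : 0 < c by move: hp; rewrite /pos Lv /rho mul1r.
have /intrP[m em] : c \is a Num.int by apply: act_int => z; rewrite /e; case: eqP => _ /=; [exact: (intr_int _ 1) | exact: (intr_int _ 0)].
pose e' : J + J -> R := fun z => (z == inl i)%:R.
(* A vector on which the coroot takes the value 1 and whose j-th coordinate is an integer: thus c, a
   positive integer, divides 1. *)
have /intrP[n en] : act (rev y) e' (inl j) \is a Num.int.
  by apply: act_int => z; rewrite /e'; case: eqP => _ /=; [exact: (intr_int _ 1) | exact: (intr_int _ 0)].
have := Lv (act (rev y) e'); rewrite act_Krev // {1}/e' eqxx en em -intrM => /eqP.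
rewrite -[1%:R]/(1%:~R) eqr_int => /eqP emn.
have m0 : 0 < m by move: c0; rewrite em ltr0z.
have n0 : 0 < n by rewrite -(pmulr_lgt0 _ m0) -emn.
have m1 : m = 1 by nia.
by move=> v; rewrite Lv em m1 mulr1.
Qed.

(** The coroots agree but the roots are only known to pair to 2 with it, so the product of the two
    reflections is a transvection. Some regular vector has regular image under it, hence it has
    length 0. *)
Lemma simple_refw y i j : pos y i -> ~~ pos (rcons y j) i -> eqw (refw y i) [:: j].
Proof.
move=> hp hn; have L := simple_coroot hp hn.
pose a := act (rev y) (rootR i).
have aj : a (inl j) = 2 by rewrite -L /a act_Krev // /rootR /= Adiag.
have E v : act (j :: refw y i) v = fun z => v z + v (inl j) * (rootR j z - a z).
  rewrite [act _ _]/= act_refw; apply/funext => z.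
  by rewrite /refl L -/a aj -/(rootR j z); ring.
(* Large enough in each coordinate to absorb the transvection, while [d (inl j)] is 1. *)
pose d : J + J -> R := fun z => 1 + `|rootR j z - a z|.
have dj : d (inl j) = 1 by rewrite /d aj /rootR /= Adiag subrr normr0 addr0.
have l0 : len (j :: refw y i) = 0%N.
  apply: (@reg_act_id R J A Adiag Aoff Azero _ d) => k.
    by rewrite /d ltr_wpDr.
  rewrite E dj /d mul1r; case: (ger0P (rootR j (inl k) - a (inl k))); lra.
have e0 := len0 l0.
move=> v; have := congr1 (refl A j) (e0 v).
by rewrite /= reflK.
Qed.

(** Strong exchange: along a reduced word for w the coroot turns negative at some letter; there it
    is simple by [simple_refw], and the reflection deletes that letter. *)
Lemma exchange y i w : pos y i -> ~~ pos (y ++ w) i ->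
  (len (refw y i ++ w) < len w)%N.
Proof.
move=> hp; case: (len_red R A w) => w0 e s.
rewrite (pos_eqw _ (eqw_catl y e)) (len_eqw (eqw_catl (refw y i) e)).
rewrite -{}s {w e}.
elim: w0 y hp => [|k w IH] y hp; first by rewrite cats0 hp.
have [hk|hk] := boolP (pos (rcons y k) i) => hn.
  have := IH (rcons y k) hk; rewrite cat_rcons => /(_ hn) h.
  rewrite /= ltnS; apply: leq_trans h.
  have e : eqw (refw y i ++ k :: w) (k :: refw (rcons y k) i ++ w).
    move=> v; have := refw_rconsE y i k (k :: w) v.
    by rewrite /= !act_cat /= !reflK // => ->; rewrite reflK.
  by rewrite (len_eqw e) len_cons.
have e : eqw (refw y i ++ k :: w) w.
  move=> v; rewrite act_cat (simple_refw hp hk) /= reflK //.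
by rewrite (len_eqw e) /= ltnS len_min.
Qed.

Variable P : pred J.

(** A covering in the Bruhat order by a reflection whose positive coroot is integral at x, the
    position of the path at the turn; [chain] is then the a-chain condition. [P] restricts the
    letters supporting the coroot, so that a letter never applied is known to be absent. *)
Definition step x w w' := exists y i,
  [/\ eqw w' (refw y i ++ w), pos y i && ~~ pos (y ++ w) i,
      act y x (inl i) \is a Num.int, len w = (len w').+1 & all P (i :: y)].

Inductive chain x : seq J -> seq J -> Prop :=
| chain_nil w w' : eqw w w' -> chain x w w'
| chain_step w w1 w' : step x w w1 -> chain x w1 w' -> chain x w w'.

Lemma step_eqw x w1 w2 w1' w2' :
  eqw w1 w1' -> eqw w2 w2' -> step x w1 w2 -> step x w1' w2'.
Proof.
move=> e1 e2 [y [i [h1 h2 h3 h4 h5]]]; exists y, i; split=> //.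
- apply: (eqw_trans (eqw_sym e2)); apply: (eqw_trans h1); exact: eqw_catl.
- by rewrite -(pos_eqw _ (eqw_catl y e1)).
- by rewrite -(len_eqw e1) -(len_eqw e2).
Qed.

Lemma chain_trans x w1 w2 w3 : chain x w1 w2 -> chain x w2 w3 -> chain x w1 w3.
Proof.
elim=> [w w' e|w w' w'' s _ IH h]; last by apply: (chain_step s (IH h)).
move=> h; case: h e => [w4 w5 e' e|w4 w5 w6 s h e].
  by apply: chain_nil; apply: (eqw_trans e e').
by apply: (chain_step _ h); apply: step_eqw s => //; apply: eqw_sym.
Qed.

Lemma chain_refl x w : chain x w w. Proof. exact: chain_nil. Qed.

Lemma chain1 x w w' : step x w w' -> chain x w w'.
Proof. by move=> s; apply: (chain_step s); apply: chain_refl. Qed.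

Lemma chain_len x w w' : chain x w w' -> (len w' <= len w)%N.
Proof.
elim=> [? ? /len_eqw -> //|? ? ? [y [i [_ _ _ -> _]]] _ h].
exact: leq_trans h _.
Qed.

Lemma step_simple x w j : P j -> ~~ pos w j -> x (inl j) \is a Num.int ->
  step x w (j :: w).
Proof.
move=> Pj hn hx; exists [::], j; split=> //=; last by rewrite Pj.
- by rewrite hn andbT; apply: (reg_rho R).
- exact: len_neg_cons.
Qed.

(** The way a root operator moves a turning point inside the segment it reflects: s_j followed by an
    integral multiple of the j-th root. *)
Definition affine j x x' := exists n : int,
  forall z, x' z = refl A j x z + n%:~R * rootR j z.

Lemma affine_int j x x' y i : affine j x x' ->
  act y x (inl i) \is a Num.int -> act (rcons y j) x' (inl i) \is a Num.int.
Proof.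
move=> [n e] h; rewrite -cats1 act_cat /=.
have -> : refl A j x' = fun z => - n%:~R * rootR j z + x z.
  apply/funext => z; rewrite {1}/refl !e /refl /rootR /= Adiag; ring.
rewrite act_lin rpredD // rpredM //; last by apply: act_int; apply: rootR_int.
by rewrite rpredN intr_int.
Qed.

Lemma affine_shift j x x' w w' : affine j x x' -> x (inl j) \is a Num.int ->
  chain x w w' -> chain x' w w'.
Proof.
move=> [n e] /intrP[m em].
have ex : x' = fun z => (n - m)%:~R * rootR j z + x z.
  by apply/funext => z; rewrite e /refl em intrB /rootR; ring.
elim=> [? ? ?|w1 w2 w3 [y [i [h1 h2 h3 h4 h5]]] _ h]; first exact: chain_nil.
apply: (chain_step _ h); exists y, i; split=> //.
rewrite ex act_lin rpredD // rpredM ?intr_int //.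
by apply: act_int; apply: rootR_int.
Qed.

(** Such a step is s_j itself. Otherwise strong exchange for the reflection conjugated by j would
    make [j :: w'] shorter than [j :: w], while the signs give it length [len w], one more than
    [len (j :: w)]. *)
Lemma step_sgn x w w' j : step x w w' -> ~~ pos w j -> pos w' j ->
  x (inl j) \is a Num.int /\ eqw w' (j :: w).
Proof.
move=> [y [i [h1 /andP[h2 h2'] h3 h4 h5]]] hn hp.
have [hc|hc] := boolP (pos (rcons y j) i); last first.
  split; first by rewrite -(simple_coroot h2 hc).
  by apply: (eqw_trans h1); apply: (eqw_catr w (simple_refw h2 hc)).
have : (len (refw (rcons y j) i ++ j :: w) < len (j :: w))%N.
  apply: exchange => //; rewrite (@pos_eqw _ _ _ _ (y ++ w)) // => v.
  by rewrite cat_rcons !act_cat /= reflK.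
rewrite (len_eqw (refw_rconsE y i j w)).
have e : eqw (j :: refw y i ++ w) (j :: w') by move=> v; rewrite /= h1.
rewrite (len_eqw e) (len_pos_cons Adiag Aoff Azero hp) -h4.
rewrite (len_neg_cons Adiag Aoff Azero hn); lia.
Qed.

Lemma chain_sgn x w w' j : chain x w w' -> ~~ pos w j -> pos w' j ->
  x (inl j) \is a Num.int.
Proof.
elim=> [? ? e h1 h2|w1 w2 w3 s _ IH h1 h2]; first by move: h1; rewrite (pos_eqw _ e) h2.
have [h|h] := boolP (pos w2 j); last exact: IH.
by case: (step_sgn s h1 h).
Qed.

Lemma step_same x x' w w' j : P j -> affine j x x' -> step x w w' ->
  pos w j = pos w' j -> step x' (j :: w) (j :: w').
Proof.
move=> Pj af [y [i [h1 /andP[h2 h2'] h3 h4 h5]]] es.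
have hc : pos (rcons y j) i.
  apply/negPn/negP => hc.
  have e : eqw w' (j :: w).
    by apply: (eqw_trans h1); apply: (eqw_catr w (simple_refw h2 hc)).
  by move: es; rewrite (pos_eqw _ e) pos_cons //; case: (pos w j).
exists (rcons y j), i; split.
- by apply: eqw_sym; apply: (eqw_trans (refw_rconsE _ _ _ _)) => v; rewrite /= h1.
- rewrite hc (@pos_eqw _ _ _ _ (y ++ w)) // => v.
  by rewrite cat_rcons !act_cat /= reflK.
- exact: affine_int h3.
- have [hp|hp] := boolP (pos w j).
    by rewrite !len_pos_cons -?es // h4.
  have := len_neg_cons Adiag Aoff Azero hp.
  have hp' : ~~ pos w' j by rewrite -es.
  have := len_neg_cons Adiag Aoff Azero hp'; lia.
- by rewrite /= all_rcons; move: h5 => /= /andP[-> ->]; rewrite Pj.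
Qed.

(** [up] and [dn] choose the longer and the shorter element of the coset of w under s_j. *)
Definition up j w := if pos w j then j :: w else w.
Definition dn j w := if pos w j then w else j :: w.

Lemma affine_self j x : x (inl j) \is a Num.int -> affine j x x.
Proof.
move=> /intrP[m em]; exists m => z; rewrite /refl em /rootR; ring.
Qed.

(* The lifting property of the Bruhat order, for chains at a point [x] on an
   integral [j]-wall. *)
Lemma chain_lift x w w' j : P j -> x (inl j) \is a Num.int -> chain x w w' ->
  chain x (up j w) (up j w') /\ chain x (dn j w) (dn j w').
Proof.
move=> Pj hx; elim=> [w1 w2 e|w1 w2 w3 s _ [IH1 IH2]].
  by rewrite /up /dn (pos_eqw _ e); case: ifP => _; split; apply: chain_nil => // v /=; rewrite e.
suff [h1 h2] : chain x (up j w1) (up j w2) /\ chain x (dn j w1) (dn j w2).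
  by split; [apply: chain_trans IH1 | apply: chain_trans IH2].
have af := affine_self hx.
have back w0 : pos w0 j -> chain x (j :: w0) w0.
  move=> hp; apply: (@chain_trans _ _ (j :: j :: w0)); last by apply: chain_nil; apply: eqw_consK.
  by apply: chain1; apply: step_simple => //; rewrite pos_cons // hp.
rewrite /up /dn; case: (boolP (pos w1 j)) => p1; case: (boolP (pos w2 j)) => p2.
- by split; apply: chain1 => //; apply: step_same s _; rewrite ?p1 ?p2.
- split; first by apply: chain_trans (chain1 s); apply: back.
  by apply: chain_trans (chain1 s) _; apply: chain1; apply: step_simple.
- have [_ e] := step_sgn s p1 p2.
  split; apply: chain_nil; last exact: eqw_sym.
  by move=> v; rewrite /= e /= reflK.
- split; apply: chain1 => //; apply: step_same s _ => //.
  by rewrite (negPf p1) (negPf p2).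
Qed.

(** On an integral j-wall signs may vary in between and the lifting property is needed; off it no
    sign change can occur, by [chain_sgn], and the chain is conjugated step by step. *)
Lemma chain_affine x x' w w' j : P j -> affine j x x' -> pos w j = pos w' j ->
  chain x w w' -> chain x' (j :: w) (j :: w').
Proof.
move=> Pj af es hc.
have [hx|hx] := boolP (x (inl j) \is a Num.int).
  apply: (affine_shift af hx).
  have [] := chain_lift Pj hx hc; rewrite /up /dn es; case: ifP => // _ h _; exact: h.
elim: hc es => [w1 w2 e _|w1 w2 w3 s h IH es].
  by apply: chain_nil => v /=; rewrite e.
have e12 : pos w1 j = pos w2 j.
  case: (boolP (pos w1 j)) => p1; case: (boolP (pos w2 j)) => p2 //.
    by move: hx; rewrite (chain_sgn h p2) // -es.
  by move: hx; rewrite (step_sgn s p1 p2).1.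
by apply: (chain_step _ (IH _)); [apply: step_same s _ | rewrite -e12].
Qed.

Lemma chain_turn x w w' j : P j -> x (inl j) \is a Num.int ->
  ~~ pos w j -> pos w' j -> chain x w w' ->
  chain x w (j :: w') /\ chain x (j :: w) w'.
Proof.
by move=> Pj hx /negPf p1 p2 /(chain_lift Pj hx); rewrite /up /dn p1 p2.
Qed.

Lemma chain_up x w w' j : P j -> x (inl j) \is a Num.int -> pos w j ->
  chain x w w' -> chain x (j :: w) w'.
Proof.
move=> Pj hx hp; apply: chain_trans.
apply: (@chain_trans _ _ (j :: j :: w)); last by apply: chain_nil; apply: eqw_consK.
by apply: chain1; apply: step_simple => //; rewrite pos_cons // hp.
Qed.

Lemma chain_down x w w' j : P j -> x (inl j) \is a Num.int -> ~~ pos w' j ->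
  chain x w w' -> chain x w (j :: w').
Proof.
move=> Pj hx hp h; apply: (chain_trans h).
by apply: chain1; apply: step_simple.
Qed.

(** Each step changes the direction by a root times a pairing that is congruent to the integral
    pairing with x. *)
Lemma chain_mod x d w w' : isint (fun z => x z - act w d z) -> chain x w w' ->
  isint (fun z => x z - act w' d z).
Proof.
move=> + h; elim: h => [w1 w2 e|w1 w2 w3 [y [i [h1 _ h3 _ _]]] _ IH] hx.
  by move=> z; rewrite -e.
apply: IH => z; rewrite h1 act_cat act_refw opprB addrA addrAC.
apply: rpredD; first exact: hx.
rewrite rpredM //; last by apply: act_int; apply: rootR_int.
have := act_int y hx (inl i); rewrite actB => h.
rewrite (_ : act y (act w1 d) (inl i) = act y x (inl i) -
  (act y x (inl i) - act y (act w1 d) (inl i))); last by ring.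
by rewrite rpredB.
Qed.

Lemma act_root_out y i c v : c \notin i :: y -> 
  act y (fun z => if z == inl c then 0 else v z) (inl i) = act y v (inl i).
Proof.
move=> hc; suff h : forall k, k != c ->
    act y (fun z => if z == inl c then 0 else v z) (inl k) = act y v (inl k).
  by apply: h; move: hc; rewrite inE negb_or eq_sym => /andP[].
have {hc} : c \notin y by move: hc; rewrite inE negb_or => /andP[].
elim: y => [_ k kc|j y IH].
  by rewrite /= (inj_eq (@inl_inj _ _)) (negPf kc).
rewrite inE negb_or eq_sym => /andP[jc /IH h] k kc.
by rewrite /= /refl !h.
Qed.

Variable dm : J -> nat.
Hypothesis dm_gt0 : forall i, (0 < dm i)%N.
Hypothesis dmA : forall i j, (dm i)%:Z * A i j = (dm j)%:Z * A j i.

(** Invariance of the symmetric form with matrix [dm i * A i j], read off on a transported root and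
    a simple root. *)
Lemma act_root_sym w i c :
  (dm c)%:R * act w (rootR i) (inl c) = (dm i)%:R * act (rev w) (rootR c) (inl i).
Proof.
have dR a b : (dm a)%:R * (A a b)%:~R = (dm b)%:R * (A b a)%:~R :> R.
  have := congr1 (fun z : int => z%:~R : R) (dmA a b).
  by rewrite !intrM.
elim: w c => [|j w IH] c; first by rewrite /= /rootR /= dR.
rewrite rev_cons -cats1 act_cat /= {2}/refl.
rewrite (_ : (fun z => _) = (fun z => - (A j c)%:~R * rootR j z + rootR c z)); last first.
  by apply/funext => z; rewrite /rootR /=; ring.
rewrite act_lin /refl mulrBr IH /= -/(rootR j).
rewrite (_ : _ * (_ * (A c j)%:~R) = act w (rootR i) (inl j) * ((dm c)%:R * (A c j)%:~R)); last by ring.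
rewrite dR mulrA [_ * (dm j)%:R]mulrC IH; ring.
Qed.

(* Along a chain avoiding [c] the slope of the coordinate [c] decreases: by
   symmetrizability a positive real root not involving [c] has nonpositive
   pairing with the coroot of [c]. *)
Lemma chain_concave x w w' d c : ~~ P c -> reg d -> chain x w w' ->
  act w' d (inl c) <= act w d (inl c).
Proof.
move=> Pc dr; elim=> [w1 w2 e|w1 w2 w3 [y [i [h1 /andP[h2 h2'] _ _ h5]]] _ IH].
  by rewrite e.
apply: (le_trans IH); rewrite h1 act_cat act_refw.
have hc : c \notin i :: y by apply/negP => /(allP h5); apply/negP.
have l0 : act y (act w1 d) (inl i) < 0.
  by rewrite -act_cat -pos_negE.
suff h : act (rev y) (rootR i) (inl c) <= 0.
  by rewrite lerBlDr lerDl; apply: mulr_le0 => //; apply: ltW.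
have := act_root_sym (rev y) i c; rewrite revK => e.
have h : act y (rootR c) (inl i) <= 0.
  rewrite -(act_root_out _ hc) -oppr_ge0.
  have -> : - act y (fun z => if z == inl c then 0 else rootR c z) (inl i) =
      act y (fun z => -1 * (if z == inl c then 0 else rootR c z)) (inl i).
    by rewrite actZ mulN1r.
  apply: act_nonneg => // k; case: eqP => [_|kc]; first by rewrite mulr0.
  rewrite mulN1r oppr_ge0 /rootR lerz0; apply: Aoff => e'; apply: kc; by rewrite e'.
have : (dm c)%:R * act (rev y) (rootR i) (inl c) <= 0.
  by rewrite e mulr_ge0_le0.
by rewrite pmulr_rle0 // ltr0n.
Qed.

End WeylChains.

(** * Minima of Lipschitz functions and root operators *)

Ltac feed H :=
  let X := fresh "X" in pose proof H as X;
  repeat match type of X with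
  | ?P -> _ => let Y := fresh "Y" in assert (Y : P) by lra; specialize (X Y); clear Y
  end.

Section IntervalMinimum.
Variable R : realType.
Implicit Types (H G : R -> R) (a b c s t v K e : R).

Definition lip H := exists2 K, 0 <= K & forall s t, `|H s - H t| <= K * `|s - t|.

Definition mn H a b := inf [set r | exists2 t, a <= t <= b & r = H t].

Lemma eps_le x y : (forall e, 0 < e -> x <= y + e) -> x <= y :> R.
Proof.
move=> h; rewrite leNgt; apply/negP => yx.
have := h ((x - y) / 2); rewrite divr_gt0 ?subr_gt0 // => /(_ isT); lra.
Qed.

Lemma lip_le H a b t : lip H -> a <= t <= b -> exists C, forall s, a <= s <= b -> C <= H s.
Proof.
move=> [K K0 HK] /andP[at_ tb]; exists (H t - K * (b - a)) => s /andP[as_ sb].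
have := HK t s; rewrite ler_norml => /andP[_ h].
have : K * `|t - s| <= K * (b - a) by apply: ler_wpM2l => //; rewrite ler_norml; lra.
lra.
Qed.

Lemma mn_has H a b : lip H -> a <= b ->
  has_inf [set r | exists2 t, a <= t <= b & r = H t].
Proof.
move=> HL ab; split; first by exists (H a), a => //; rewrite lexx.
have [|C hC] := @lip_le H a b a HL; first by rewrite lexx.
by exists C => r [t ht ->]; apply: hC.
Qed.

Lemma mn_le H a b t : lip H -> a <= t <= b -> mn H a b <= H t.
Proof.
move=> HL ht; apply: ge_inf; last by exists t.
by have [] := @mn_has H a b HL _ => //; case/andP: ht; apply: le_trans.
Qed.

Lemma mn_ge H a b c : a <= b -> (forall t, a <= t <= b -> c <= H t) -> c <= mn H a b.
Proof.
move=> ab h; apply: lb_le_inf; first by exists (H a), a => //; rewrite lexx.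
by move=> r [t ht ->]; apply: h.
Qed.

Lemma mn1 H a : lip H -> mn H a a = H a.
Proof.
move=> HL; apply/eqP; rewrite eq_le mn_le ?lexx //= mn_ge // => t.
by move=> /andP[h1 h2]; have -> : t = a by lra.
Qed.

Lemma mn_split H a c b : lip H -> a <= c <= b ->
  mn H a b = Num.min (mn H a c) (mn H c b).
Proof.
move=> HL /andP[ac cb]; apply/eqP; rewrite eq_le; apply/andP; split.
  rewrite le_min; apply/andP; split; apply: mn_ge => // t ht; apply: mn_le => //; lra.
apply: mn_ge; first lra.
move=> t ht; rewrite ge_min; have [h|h] := leP t c.
  by rewrite mn_le //; lra.
by rewrite [X in _ || X]mn_le ?orbT //; lra.
Qed.

Lemma mn_sub H a b a' b' : lip H -> a <= a' -> a' <= b' -> b' <= b -> mn H a b <= mn H a' b'.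
Proof. by move=> HL h1 h2 h3; apply: mn_ge => // t ht; apply: mn_le => //; lra. Qed.

Lemma mn_close H G a b e : lip H -> lip G -> a <= b ->
  (forall t, a <= t <= b -> `|H t - G t| <= e) -> `|mn H a b - mn G a b| <= e.
Proof.
move=> HL GL ab h.
have h1 : mn G a b - e <= mn H a b.
  apply: mn_ge => // t ht; have := h t ht; rewrite ler_norml; have := mn_le GL ht; lra.
have h2 : mn H a b - e <= mn G a b.
  apply: mn_ge => // t ht; have := h t ht; rewrite ler_norml; have := mn_le HL ht; lra.
by rewrite ler_norml; lra.
Qed.

Lemma mnDr H a b c : lip H -> a <= b -> mn (fun t => H t + c) a b = mn H a b + c.
Proof.
move=> HL ab; have HL' : lip (fun t => H t + c).
  by case: HL => K K0 h; exists K => // s t; rewrite opprD addrACA subrr addr0.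
apply/eqP; rewrite eq_le; apply/andP; split.
  rewrite -lerBlDr; apply: mn_ge => // t ht; have := mn_le HL' ht; lra.
by apply: mn_ge => // t ht; have := mn_le HL ht; lra.
Qed.

(** The intermediate value theorem at the first time: at the infimum of the times where H is at
    least v, the Lipschitz bound yields both inequalities. *)
Lemma first_ge H a b v : lip H -> a <= b -> H a <= v -> v <= H b ->
  exists q, [/\ a <= q <= b, H q = v & forall t, a <= t < q -> H t < v].
Proof.
move=> [K K0 HK] ab Ha Hb.
pose S := [set t | a <= t <= b /\ v <= H t].
have S0 : has_inf S.
  by split; [exists b; rewrite /S /= ab lexx | exists a => t [/andP[]]].
have aq : a <= inf S by apply: lb_le_inf; [case: S0 | move=> t [/andP[]]].
have qb : inf S <= b by apply: ge_inf; [case: S0 | rewrite /S /= ab lexx].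
exists (inf S); split; first by rewrite aq qb.
- have K1 : 0 < K + 1 by lra.
  apply/eqP; rewrite eq_le; apply/andP; split; apply: eps_le => e e0.
    have [h|h] := eqVneq (inf S) a; first by rewrite h; lra.
    have {}h : a < inf S by rewrite lt_neqAle eq_sym h.
    pose t := Num.max a (inf S - e / (K + 1)).
    have d0 : 0 < e / (K + 1) by rewrite divr_gt0.
    have tS : t < inf S by rewrite /t gt_max h /=; lra.
    have Ht : H t < v.
      rewrite ltNge; apply/negP => vt.
      have : inf S <= t.
        apply: ge_inf; first by case: S0.
        by split=> //; rewrite /t le_max lexx /= -/t; lra.
      lra.
    have := HK (inf S) t; rewrite ler_norml => /andP[_].
    rewrite ger0_norm; last lra.
    have : inf S - t <= e / (K + 1) by rewrite lerBlDr -lerBlDl le_max lexx orbT.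
    move=> h1 h2.
    have : K * (inf S - t) <= K * (e / (K + 1)) by apply: ler_wpM2l.
    have : K * (e / (K + 1)) <= e.
      by rewrite mulrA ler_pdivrMr // mulrDr mulr1 [K * e]mulrC lerDl ltW.
    lra.
  have d0 : 0 < e / (K + 1) by rewrite divr_gt0.
  have [t [ht vt] htS] := inf_adherent d0 S0.
  have h0 : inf S <= t by apply: ge_inf; [case: S0 | ].
  have := HK t (inf S); rewrite ler_norml => /andP[_].
  rewrite ger0_norm; last lra.
  move=> h2.
  have : K * (t - inf S) <= K * (e / (K + 1)) by apply: ler_wpM2l => //; lra.
  have : K * (e / (K + 1)) <= e.
    by rewrite mulrA ler_pdivrMr // mulrDr mulr1 [K * e]mulrC lerDl ltW.
  lra.
- move=> t /andP[at_ tq]; rewrite ltNge; apply/negP => vt.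
  have : inf S <= t by apply: ge_inf; [case: S0 | split => //; lra].
  lra.
Qed.

Lemma lip_opp H : lip H -> lip (fun t => - H t).
Proof. by case=> K K0 h; exists K => // s t; rewrite -opprB normrN opprK [X in `|X|]addrC. Qed.

Lemma lip_comp H (f : R -> R) : lip H -> lip f -> lip (H \o f).
Proof.
move=> [K K0 h] [L L0 hf]; exists (K * L); first exact: mulr_ge0.
move=> s t; apply: (le_trans (h _ _)); rewrite -mulrA; exact: ler_wpM2l.
Qed.

Lemma lipD H G : lip H -> lip G -> lip (fun t => H t + G t).
Proof.
move=> [K K0 h] [L L0 hf]; exists (K + L); first exact: addr_ge0.
move=> s t; rewrite opprD addrACA mulrDl; apply: (le_trans (ler_normD _ _)).
exact: lerD.
Qed.

Lemma lipZ c H : lip H -> lip (fun t => c * H t).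
Proof.
move=> [K K0 h]; exists (`|c| * K); first by rewrite mulr_ge0.
by move=> s t; rewrite -mulrBr normrM -mulrA ler_wpM2l.
Qed.

Lemma lip_cst c : lip (fun=> c).
Proof. by exists 0 => // s t; rewrite subrr normr0 mul0r. Qed.

Lemma lip_id : lip id.
Proof. by exists 1 => // s t; rewrite mul1r. Qed.

Lemma lip_min H G : lip H -> lip G -> lip (fun t => Num.min (H t) (G t)).
Proof.
move=> [K K0 h] [L L0 hf]; exists (K + L); first exact: addr_ge0.
move=> s t; rewrite mulrDl; have := h s t; have := hf s t.
have : 0 <= K * `|s - t| by rewrite mulr_ge0.
have : 0 <= L * `|s - t| by rewrite mulr_ge0.
rewrite /Num.min !ler_norml; case: ifP; case: ifP; lra.
Qed.

Lemma last_le H a b v : lip H -> a <= b -> H a <= v -> v <= H b ->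
  exists p, [/\ a <= p <= b, H p = v & forall t, p < t <= b -> v < H t].
Proof.
move=> HL ab Ha Hb.
have HL' : lip (fun t => - H (a + b - t)).
  by apply: lip_opp; apply: lip_comp HL _; apply: lipD (lip_cst _) (lip_opp lip_id).
case: (@first_ge _ a b (- v) HL' ab).
- by rewrite addrAC subrr add0r lerN2.
- by rewrite addrK lerN2.
move=> q [hq e h]; exists (a + b - q); split; first lra.
- by apply: oppr_inj.
- move=> t ht; have := h (a + b - t); rewrite (_ : a + b - (a + b - t) = t); last by ring.
  move=> h'.
  have : - H t < - v by apply: h'; lra.
  lra.
Qed.

Lemma mn_lipl H b s t K : lip H -> 0 <= K ->
  (forall s t, `|H s - H t| <= K * `|s - t|) -> s <= t <= b ->
  mn H t b <= mn H s b + K * (t - s).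
Proof.
move=> HL K0 HK /andP[st tb]; rewrite -lerBlDr; apply: mn_ge; first lra.
move=> r hr; have [h|h] := leP t r.
  have := @mn_le H t b r HL; rewrite h /= => /(_ _) hh.
  have : mn H t b <= H r by apply: hh; lra.
  have : 0 <= K * (t - s) by apply: mulr_ge0 => //; lra.
  lra.
have : mn H t b <= H t by apply: mn_le => //; lra.
have := HK t r; rewrite ler_norml => /andP[_]; rewrite ger0_norm; last lra.
have : K * (t - r) <= K * (t - s) by apply: ler_wpM2l => //; lra.
lra.
Qed.

(** The minimum over [[t, b]] is Lipschitz and nondecreasing in t, so there is a last p where it
    still equals the total minimum; the minimum is attained at p. *)
Lemma mn_att H a b : lip H -> a <= b -> exists2 t, a <= t <= b & H t = mn H a b.
Proof.
move=> HL ab; set m := mn H a b; have [K K0 HK] := HL.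
pose cl t := Num.max a (Num.min b t).
have clP t : a <= cl t <= b by rewrite /cl le_max lexx ge_max ab ge_min lexx.
have cl_id t : a <= t <= b -> cl t = t.
  by move=> /andP[h1 h2]; rewrite /cl (min_idPr h2) (max_idPr h1).
pose G t := - mn H (cl t) b.
have cl_lip s t : s <= t -> 0 <= cl t - cl s <= t - s.
  by rewrite /cl /Num.max /Num.min => st; do 4! case: ifP; lra.
have GL : lip G.
  exists K => // s t; wlog st : s t / s <= t.
    by move=> h; case: (leP s t) => [/h //|/ltW/h]; rewrite distrC [`|t - s|]distrC.
  have /andP[c1 c2] := cl_lip s t st; have := clP s; have := clP t => ht hs.
  have h1 : mn H (cl s) b <= mn H (cl t) b by apply: mn_sub => //; lra.
  have h2 : mn H (cl t) b <= mn H (cl s) b + K * (cl t - cl s).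
    by apply: mn_lipl => //; lra.
  have : K * (cl t - cl s) <= K * (t - s) by apply: ler_wpM2l.
  rewrite /G ler_norml ler0_norm; lra.
have [h|h] := eqVneq (H b) m; first by exists b => //; lra.
have Hbm : m < H b by rewrite lt_neqAle eq_sym h mn_le //; lra.
have GL' := lip_opp GL.
have [||p [hp ep hpt]] := @last_le (fun t => - G t) a b m GL' ab.
- by rewrite /G opprK cl_id ?lexx.
- by rewrite /G opprK cl_id ?lexx ?ab // mn1 // ltW.
exists p => //; apply/eqP; rewrite eq_le mn_le // andbT.
rewrite leNgt; apply/negP => hH.
move: ep; rewrite /G opprK cl_id // => ep.
have pb : p < b by rewrite lt_neqAle; apply/andP; split; [apply/eqP => e; move: ep; rewrite e mn1 //; lra | lra].
(* Short enough that H stays above [(H p + m) / 2] on [[p, p + d]]. Beyond [p + d] the minimum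
   exceeds m by the choice of p, so the minimum over [[p, b]] would exceed m. *)
pose d := Num.min (b - p) ((H p - m) / (2 * (K + 1))).
have d0 : 0 < d by rewrite lt_min subr_gt0 pb divr_gt0 ?subr_gt0 //; lra.
have dpb : p + d <= b by rewrite -lerBrDl ge_min lexx.
have dK : K * d <= (H p - m) / 2.
  apply: (@le_trans _ _ (K * ((H p - m) / (2 * (K + 1))))).
    by apply: ler_wpM2l => //; rewrite ge_min lexx orbT.
  have -> : (H p - m) / (2 * (K + 1)) = (H p - m) / 2 / (K + 1) by field; lra.
  rewrite mulrA ler_pdivrMr; last lra.
  rewrite mulrDr mulr1 [K * _]mulrC lerDl; lra.
have := mn_split (c := p + d) HL (a := p) (b := b); rewrite ep => /(_ _) e.
have : m = Num.min (mn H p (p + d)) (mn H (p + d) b) by apply: e; lra.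
have := hpt (p + d); rewrite /G opprK cl_id; last lra.
move=> h1; have {}h1 : m < mn H (p + d) b by apply: h1; lra.
have : (H p + m) / 2 <= mn H p (p + d).
  apply: mn_ge; first lra.
  move=> t ht; have := HK p t; rewrite ler_norml => /andP[_].
  rewrite ler0_norm; last lra.
  have : K * (- (p - t)) <= K * d by apply: ler_wpM2l => //; lra.
  lra.
rewrite /Num.min; case: ifP; lra.
Qed.

End IntervalMinimum.

(** * Displacement functions of the root operators *)

Section Theta.
Variable R : realType.
Implicit Types (H G : R -> R) (a b c s t v K e p q : R).

(** Integrality of local minima, phrased through minima over subintervals so that it passes to
    uniform limits ([LI_lim]), reversals and concatenations. *)
Definition LI H := forall a b, 0 <= a -> a <= b -> b <= 1 ->
  [\/ mn H a b \is a Num.int, mn H a b = H a | mn H a b = H b].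

Definition nice H := [/\ lip H, LI H & mn H 0 1 \is a Num.int].

Definition clamp t : R := Num.max 0 (Num.min 1 t).

Lemma clampP t : 0 <= clamp t <= 1.
Proof. by rewrite /clamp le_max lexx ge_max ler01 ge_min lexx. Qed.

Lemma clamp_id t : 0 <= t <= 1 -> clamp t = t.
Proof. by move=> /andP[h1 h2]; rewrite /clamp (min_idPr h2) (max_idPr h1). Qed.

Lemma clamp0 t : t <= 0 -> clamp t = 0.
Proof. by move=> h; rewrite /clamp /Num.max /Num.min; do 2! case: ifP; lra. Qed.

Lemma clamp1 t : 1 <= t -> clamp t = 1.
Proof. by move=> h; rewrite /clamp /Num.max /Num.min; do 2! case: ifP; lra. Qed.

Lemma clampV t : clamp (1 - t) = 1 - clamp t.
Proof. by rewrite /clamp /Num.max /Num.min; do 4! case: ifP; lra. Qed.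

Lemma clamp_le s t : s <= t -> clamp s <= clamp t.
Proof. by move=> h; rewrite /clamp /Num.max /Num.min; do 4! case: ifP; lra. Qed.

Lemma clamp_lip s t : `|clamp s - clamp t| <= `|s - t|.
Proof.
wlog st : s t / s <= t.
  by move=> h; case: (leP s t) => [/h //|/ltW/h]; rewrite distrC [`|t - s|]distrC.
rewrite !ler0_norm ?subr_le0 ?clamp_le //.
by rewrite /clamp /Num.max /Num.min; do 4! case: ifP; lra.
Qed.

(* The root operator f_i sends p to p - th (H_i) alpha_i. *)
Definition th H t := Num.min 1 (mn H (clamp t) 1 - mn H 0 1).

Definition rv H t : R := H (1 - t).

(** e_i is f_i conjugated by time reversal, whence this form; e_i sends p to p + kap (H_i)
    alpha_i. *)
Definition kap H t := 1 - th (rv H) (1 - t).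

Lemma rvK H : rv (rv H) = H.
Proof. by apply/funext => t; rewrite /rv; congr H; ring. Qed.

Lemma lip_rv H : lip H -> lip (rv H).
Proof. by move=> h; apply: (lip_comp h); apply: lipD (lip_cst _) (lip_opp (lip_id _)). Qed.

Lemma mn_rv H a b : lip H -> a <= b -> mn (rv H) (1 - b) (1 - a) = mn H a b.
Proof.
move=> HL ab; apply/eqP; rewrite eq_le; apply/andP; split; apply: mn_ge => //; try lra.
  move=> t ht; have -> : H t = rv H (1 - t) by rewrite -{1}(rvK H).
  by apply: mn_le; [apply: lip_rv | lra].
by move=> t ht; rewrite /rv; apply: mn_le => //; lra.
Qed.

Lemma LI_rv H : lip H -> LI H -> LI (rv H).
Proof.
move=> HL h a b a0 ab b1.
have ba : 1 - b <= 1 - a by lra.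
have := mn_rv HL ba; rewrite !opprB ![1 + (_ - 1)]addrC !subrK => ->.
have [|||hi|hi|hi] := h (1 - b) (1 - a) => //; try lra.
- by constructor 1.
- by constructor 3.
- by constructor 2.
Qed.

Lemma nice_rv H : nice H -> nice (rv H).
Proof.
move=> [h1 h2 h3]; split; [exact: lip_rv | exact: LI_rv | ].
by have := mn_rv h1 ler01; rewrite subrr subr0 => ->.
Qed.

Lemma th_ge0 H t : lip H -> 0 <= th H t.
Proof.
move=> HL; rewrite /th le_min ler01 /= subr_ge0 mn_sub //; have := clampP t; lra.
Qed.

Lemma th_mono H s t : lip H -> s <= t -> th H s <= th H t.
Proof.
move=> HL st; rewrite /th.
have : mn H (clamp s) 1 <= mn H (clamp t) 1.
  by apply: mn_sub => //; [apply: clamp_le | have := clampP t; lra].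
rewrite /Num.min; do 2! case: ifP; lra.
Qed.

Lemma th_le0 H t : lip H -> t <= 0 -> th H t = 0.
Proof. by move=> HL t0; rewrite /th clamp0 // subrr; apply/min_idPr; exact: ler01. Qed.

Lemma th_clamp H t : th H (clamp t) = th H t.
Proof. by rewrite /th clamp_id ?clampP. Qed.

Lemma th_ge1 H t : lip H -> mn H 0 1 + 1 <= H 1 -> 1 <= t -> th H t = 1.
Proof. by move=> HL h t1; rewrite /th clamp1 // mn1 //; apply/min_idPl; lra. Qed.

Lemma th_lip H : lip H -> lip (th H).
Proof.
move=> HL; have [K K0 HK] := HL.
apply: lip_min (lip_cst _) _; apply: lipD _ (lip_cst _).
exists K => // s t; wlog st : s t / s <= t.
  by move=> h; case: (leP s t) => [/h //|/ltW/h]; rewrite distrC [`|t - s|]distrC.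
have := clamp_le st; have := clampP s; have := clampP t => h1 h2 h3.
have a1 : mn H (clamp s) 1 <= mn H (clamp t) 1 by apply: mn_sub => //; lra.
have a2 : mn H (clamp t) 1 <= mn H (clamp s) 1 + K * (clamp t - clamp s).
  by apply: mn_lipl => //; lra.
have := clamp_lip s t => h4.
have : K * `|clamp s - clamp t| <= K * `|s - t| by apply: ler_wpM2l.
rewrite (ler0_norm (x := clamp s - _)); last lra.
rewrite opprB ler_norml; lra.
Qed.

Lemma th_close H G e t : lip H -> lip G ->
  (forall t, 0 <= t <= 1 -> `|H t - G t| <= e) -> `|th H t - th G t| <= 2 * e.
Proof.
move=> HL GL h; have := clampP t => ht.
have h1 : `|mn H (clamp t) 1 - mn G (clamp t) 1| <= e.
  by apply: mn_close => //; [lra | move=> s hs; apply: h; lra].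
have h2 : `|mn H 0 1 - mn G 0 1| <= e by apply: mn_close.
move: h1 h2; rewrite /th /Num.min !ler_norml; do 2! case: ifP; lra.
Qed.

Lemma int_between (x y : R) : x \is a Num.int -> y \is a Num.int -> x < y -> x + 1 <= y.
Proof.
move=> /intrP[m ->] /intrP[n ->]; rewrite ltr_int -[1]/(1%:~R) -intrD ler_int; lia.
Qed.

Lemma th_shape H : nice H -> mn H 0 1 + 1 <= H 1 ->
  exists p q, [/\ [/\ 0 <= p, p < q & q <= 1],
    [/\ H p = mn H 0 1, H q = mn H 0 1 + 1,
        (forall t, p < t <= 1 -> mn H 0 1 < H t),
        (forall t, p <= t < q -> H t < mn H 0 1 + 1) &
        (forall t, q <= t <= 1 -> mn H 0 1 + 1 <= H t)],
    (forall s t, p <= s -> s <= t -> t <= q -> H s <= H t) &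
    [/\ (forall t, t <= p -> th H t = 0),
        (forall t, p <= t <= q -> th H t = H t - mn H 0 1) &
        (forall t, q <= t -> th H t = 1)]].
Proof.
move=> [HL HI mint] phi; set m := mn H 0 1 in mint phi *.
have [t0 ht0 et0] : exists2 t, 0 <= t <= 1 & H t = m by apply: mn_att.
have [|||p [hp ep pmax]] := @last_le _ H t0 1 m HL; try lra.
have p1 : p <= 1 by lra.
have [||q [hq eq_ qmin]] := @first_ge _ H p 1 (m + 1) HL p1; try lra.
have pq : p < q.
  by rewrite lt_neqAle; apply/andP; split; [apply/eqP => e; move: eq_; rewrite -e; lra | lra].
have low r : 0 <= r <= 1 -> m <= H r by move=> hr; apply: mn_le.
have mint1 : m + 1 \is a Num.int by rewrite rpredD // int_num1.
have above t : q <= t <= 1 -> m + 1 <= H t.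
  move=> ht; rewrite leNgt; apply/negP => hlt.
  have h1 : mn H q 1 <= H t by apply: mn_le.
  have [r hr er] : exists2 r, q <= r <= 1 & H r = mn H q 1 by apply: mn_att => //; lra.
  have h2 : m < H r by apply: pmax; lra.
  have [||| hi | hi | hi] := HI q 1; try lra.
  have := int_between mint hi; lra.
have mono s t : p <= s -> s <= t -> t <= q -> H s <= H t.
  move=> ps st tq; rewrite leNgt; apply/negP => hlt.
  have h1 : mn H s q <= H t by apply: mn_le => //; lra.
  have sq : s <= q by lra.
  have Hs : H s <= m + 1.
    have [h|h] := ltP s q; first by apply/ltW/qmin; lra.
    rewrite (_ : s = q); lra.
  have [r hr er] : exists2 r, s <= r <= q & H r = mn H s q by apply: mn_att.
  have h2 : m < H r.
    have [h|h] := ltP p r; first by apply: pmax; lra.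
    have e1 : s = p by lra.
    have e2 : r = p by lra.
    have := low t; move: er hlt h1; rewrite e2 e1 => er hlt h1 h3.
    have : m <= H t by apply: h3; lra.
    lra.
  have [||| hi | hi | hi] := HI s q; try lra.
  have := int_between mint hi; lra.
exists p, q; split=> //; first by split; lra.
split=> t ht.
- rewrite /th -/m.
  have hc : clamp t <= p by rewrite -(clamp_id (t := p)) ?clamp_le //; lra.
  have hc0 := clampP t.
  have -> : mn H (clamp t) 1 = m.
    apply/eqP; rewrite eq_le -{1}ep mn_le //=; last lra.
    by apply: mn_sub => //; lra.
  by rewrite subrr; apply/min_idPr; exact: ler01.
- have tt : 0 <= t <= 1 by lra.
  rewrite /th -/m clamp_id //.
  have -> : mn H t 1 = H t.
    apply/eqP; rewrite eq_le mn_le //=; last lra.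
    apply: mn_ge; first lra.
    move=> r hr; have [h|h] := leP r q; first by apply: mono; lra.
    have := mono t q; have := above r; lra.
  have := mono t q; move=> h; apply/min_idPr; have := h _ _ _; lra.
- rewrite /th -/m; apply/min_idPl.
  have hc : q <= clamp t by rewrite -(clamp_id (t := q)) ?clamp_le //; lra.
  rewrite lerBrDl; have := clampP t => hc0; apply: mn_ge; first lra.
  by move=> r hr; apply: above; lra.
Qed.

Lemma mn_theta H : nice H -> mn H 0 1 + 1 <= H 1 ->
  lip (fun t => H t - 2 * th H t) /\ mn (fun t => H t - 2 * th H t) 0 1 = mn H 0 1 - 1.
Proof.
move=> hn phi; have [HL _ _] := hn.
have HL' : lip (fun t => H t - 2 * th H t).
  by apply: lipD => //; apply: lip_opp; apply: lipZ; apply: th_lip.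
split=> //; have [p [q [[p0 pq q1] [ep eq_ h1 h2 h3] mono [t1 t2 t3]]]] := th_shape hn phi.
apply/eqP; rewrite eq_le; apply/andP; split.
  have -> : mn H 0 1 - 1 = H q - 2 * th H q by rewrite t3 // eq_; lra.
  by apply: mn_le => //; lra.
apply: mn_ge => // t ht.
have low : mn H 0 1 <= H t by apply: mn_le.
have [h|h] := leP t p; first by rewrite t1 //; lra.
have [h'|h'] := leP t q; last by rewrite t3; [feed (h3 t); lra | lra].
rewrite t2; last lra.
have [h4|h4] := ltP t q; first by feed (h2 t); lra.
rewrite (_ : t = q); lra.
Qed.

Lemma kapE H t : lip H -> kap H t = 1 - Num.min 1 (mn H 0 (clamp t) - mn H 0 1).
Proof.
move=> HL; rewrite /kap /th clampV; congr (1 - Num.min 1 (_ - _)).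
  have := @mn_rv H 0 (clamp t) HL; rewrite subr0 => ->//.
  by case/andP: (clampP t).
by have := @mn_rv H 0 1 HL ler01; rewrite subrr subr0.
Qed.

(* With [th], [kap] the displacements of f and e, this says e f = 1. *)
Lemma kap_theta H t : nice H -> mn H 0 1 + 1 <= H 1 ->
  kap (fun t => H t - 2 * th H t) t = th H t.
Proof.
move=> hn phi; have [HL' em] := mn_theta hn phi; have [HL _ _] := hn.
rewrite kapE // em -th_clamp; move: (clamp t) (clampP t) => {}t ht.
have [p [q [[p0 pq q1] [ep eq_ h1 h2 h3] mono [t1 t2 t3]]]] := th_shape hn phi.
have low r : 0 <= r <= 1 -> mn H 0 1 <= H r by move=> hr; apply: mn_le.
have [h|h] := leP t p.
  rewrite t1 //; have : mn H 0 1 <= mn (fun t => H t - 2 * th H t) 0 t.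
    apply: mn_ge; first lra.
    by move=> r hr; rewrite t1; [feed (low r); lra | lra].
  rewrite /Num.min; case: ifP; lra.
have [h'|h'] := leP t q; last first.
  rewrite t3; last lra.
  have : mn (fun t => H t - 2 * th H t) 0 t <= mn H 0 1 - 1.
    have -> : mn H 0 1 - 1 = H q - 2 * th H q by rewrite t3 // eq_; lra.
    by apply: mn_le => //; lra.
  have : mn H 0 1 - 1 <= mn (fun t => H t - 2 * th H t) 0 t.
    by rewrite -em; apply: mn_sub => //; lra.
  rewrite /Num.min; case: ifP; lra.
have et : th H t = H t - mn H 0 1 by apply: t2; lra.
have -> : mn (fun t => H t - 2 * th H t) 0 t = 2 * mn H 0 1 - H t.
  apply/eqP; rewrite eq_le; apply/andP; split.
    have -> : 2 * mn H 0 1 - H t = H t - 2 * th H t by rewrite et; lra.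
    by apply: mn_le => //; lra.
  apply: mn_ge; first lra.
  move=> r hr; feed (low r); feed (low t).
  have [hh|hh] := leP r p; first by rewrite t1 //; lra.
  by rewrite t2; [feed (mono r t); lra | lra].
have : H t <= mn H 0 1 + 1.
  have [h4|h4] := ltP t q; first by apply/ltW/h2; lra.
  rewrite (_ : t = q); lra.
feed (low t); rewrite et /Num.min; case: ifP; lra.
Qed.

Lemma thDr H c t : lip H -> th (fun t => H t + c) t = th H t.
Proof.
move=> HL; rewrite /th !mnDr //; first by congr Num.min; ring.
by case/andP: (clampP t).
Qed.

Lemma kap_theta_rv H t : kap (rv H) t = 1 - th H (1 - t).
Proof. by rewrite /kap rvK. Qed.

Lemma rv_kappa H : rv (fun t => H t + 2 * kap H t) = fun t => rv H t - 2 * th (rv H) t + 2.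
Proof.
apply/funext => t; rewrite /rv -/(rv H) /kap.
rewrite (_ : 1 - (1 - t) = t); last by ring.
by rewrite -/(rv H t); ring.
Qed.

Lemma mn_rv01 H : lip H -> mn (rv H) 0 1 = mn H 0 1.
Proof. by move=> HL; have := @mn_rv H 0 1 HL ler01; rewrite subrr subr0. Qed.

Lemma mn_kappa H : nice H -> mn H 0 1 + 1 <= H 0 ->
  lip (fun t => H t + 2 * kap H t) /\ mn (fun t => H t + 2 * kap H t) 0 1 = mn H 0 1 + 1.
Proof.
move=> hn eps; have hr := nice_rv hn; have [HL _ _] := hn.
have phi : mn (rv H) 0 1 + 1 <= rv H 1 by rewrite mn_rv01 // /rv subrr.
have [l e] := mn_theta hr phi.
have HL' : lip (fun t => H t + 2 * kap H t).
  rewrite -[X in lip X]rvK rv_kappa; apply: lip_rv; exact: lipD (lip_cst _).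
split=> //; rewrite -mn_rv01 // rv_kappa mnDr // e mn_rv01 //; lra.
Qed.

Lemma theta_kap H t : nice H -> mn H 0 1 + 1 <= H 0 ->
  th (fun t => H t + 2 * kap H t) t = kap H t.
Proof.
move=> hn eps; have hr := nice_rv hn; have [HL _ _] := hn.
have phi : mn (rv H) 0 1 + 1 <= rv H 1 by rewrite mn_rv01 // /rv subrr.
have [l e] := mn_theta hr phi.
have -> : th (fun t => H t + 2 * kap H t) t = 1 - kap (rv (fun t => H t + 2 * kap H t)) (1 - t).
  rewrite kap_theta_rv (_ : 1 - (1 - t) = t); ring.
rewrite rv_kappa /kap; congr (1 - _).
have := kap_theta (1 - t) hr phi => <-; rewrite /kap; congr (1 - _).
have -> : rv (fun t0 => rv H t0 - 2 * th (rv H) t0 + 2) =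
          fun t0 => rv (fun t1 => rv H t1 - 2 * th (rv H) t1) t0 + 2 by [].
by rewrite thDr //; apply: lip_rv.
Qed.

Lemma kap_shape H : nice H -> mn H 0 1 + 1 <= H 0 ->
  exists p q, [/\ [/\ 0 <= p, p < q & q <= 1],
    [/\ H p = mn H 0 1 + 1, H q = mn H 0 1,
        (forall t, 0 <= t < q -> mn H 0 1 < H t),
        (forall t, p < t <= q -> H t < mn H 0 1 + 1) &
        (forall t, 0 <= t <= p -> mn H 0 1 + 1 <= H t)],
    (forall s t, p <= s -> s <= t -> t <= q -> H t <= H s) &
    [/\ (forall t, t <= p -> kap H t = 0),
        (forall t, p <= t <= q -> kap H t = 1 - (H t - mn H 0 1)) &
        (forall t, q <= t -> kap H t = 1)]].
Proof.
move=> hn eps; have hr := nice_rv hn; have [HL _ _] := hn.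
have phi : mn (rv H) 0 1 + 1 <= rv H 1 by rewrite mn_rv01 // /rv subrr.
have [p [q [[p0 pq q1] [ep eq_ h1 h2 h3] mono [t1 t2 t3]]]] := th_shape hr phi.
rewrite mn_rv01 // in ep eq_ h1 h2 h3 t2.
have rvE t : H t = rv H (1 - t) by rewrite -{1}(rvK H).
exists (1 - q), (1 - p); split; first by split; lra.
- split=> // t ht; rewrite rvE; [apply: h1 | apply: h2 | apply: h3]; lra.
- by move=> s t hs st ht; rewrite !rvE; apply: mono; lra.
- split=> t ht; rewrite /kap; [rewrite t3 | rewrite t2 ?rvE | rewrite t1]; lra.
Qed.

(** A minimum that is neither integral nor an endpoint value has positive distance from all of
    these; an approximant closer than a third of the smallest distance would violate [LI] as
    well. *)
Lemma LI_lim H : lip H ->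
  (forall e, 0 < e -> exists G, [/\ lip G, LI G & forall t, 0 <= t <= 1 -> `|H t - G t| <= e]) ->
  LI H.
Proof.
move=> HL h a b a0 ab b1; set m := mn H a b.
have [hm|hm] := boolP (m \is a Num.int); first by constructor 1.
have [ha|ha] := eqVneq m (H a); first by constructor 2.
have [hb|hb] := eqVneq m (H b); first by constructor 3.
have {}ha : m < H a by rewrite lt_neqAle ha mn_le ?lexx.
have {}hb : m < H b by rewrite lt_neqAle hb mn_le ?lexx ?ab.
have f1 : (Num.floor m)%:~R < m.
  rewrite lt_neqAle floor_le andbT; apply: contraNneq hm => <-; exact: intr_int.
have f2 : m < (Num.floor m)%:~R + 1 by have := floorD1_gt m; rewrite intrD.
pose e := Num.min (Num.min (H a - m) (H b - m)) (Num.min (m - (Num.floor m)%:~R) ((Num.floor m)%:~R + 1 - m)) / 3.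
have e0 : 0 < e by rewrite divr_gt0 // !lt_min !subr_gt0 ha hb f1 f2.
have [G [GL GI hG]] := h e e0.
have e5 : 3 * e = Num.min (Num.min (H a - m) (H b - m)) (Num.min (m - (Num.floor m)%:~R) ((Num.floor m)%:~R + 1 - m)) by rewrite /e; field.
have e1 : 3 * e <= H a - m by rewrite e5 !ge_min lexx.
have e2 : 3 * e <= H b - m by rewrite e5 !ge_min lexx !orbT.
have e3 : 3 * e <= m - (Num.floor m)%:~R by rewrite e5 !ge_min lexx !orbT.
have e4 : 3 * e <= (Num.floor m)%:~R + 1 - m by rewrite e5 !ge_min lexx !orbT.
have : `|mn H a b - mn G a b| <= e.
  by apply: mn_close => // t ht; apply: hG; lra.
have := hG a; have := hG b; rewrite -/m !ler_norml => hGb hGa hmG.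
have {hGa} : - e <= H a - G a <= e by apply: hGa; lra.
have {hGb} : - e <= H b - G b <= e by apply: hGb; lra.
move=> hGb hGa.
have [||| hi | hi | hi] := GI a b => //; try lra.
have k1 : (Num.floor m)%:~R < mn G a b by lra.
have := int_between (intr_int _ _) hi k1; lra.
Qed.

End Theta.

(** * Folded paths *)

Section FoldedPaths.
Variables (R : realType) (J : eqType) (A : J -> J -> int).
Implicit Types (w y : seq J) (i j : J) (s t r : R) (eta : R -> J + J -> R).
Hypothesis Adiag : forall i, A i i = 2.
Hypothesis Aoff : forall i j, i <> j -> A i j <= 0.
Hypothesis Azero : forall i j, A i j = 0 <-> A j i = 0.

Local Notation act := (@act R J A).
Local Notation eqw := (@eqw R J A).
Local Notation reg := (@reg R J).
Local Notation pos := (@pos R J A).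
Local Notation rootR := (@rootR R J A).
Local Notation Hc i eta := (fun t => eta t (inl i)).

Definition fop i eta : R -> J + J -> R :=
  fun t z => eta t z - th (Hc i eta) t * rootR i z.

Definition eop i eta : R -> J + J -> R :=
  fun t z => eta t z + kap (Hc i eta) t * rootR i z.

Variable P : pred J.
Local Notation chain := (@chain R J A P).

Variable X : R -> J + J -> R.
Hypothesis Xreg : forall s t, 0 <= s -> s < t -> t <= 1 -> reg (fun z => X t z - X s z).

Definition incr eta s w r :=
  forall z, eta r z - eta s z = act w (fun z => X r z - X s z) z.

(* [ls eta s w]: on [s, 1] the path [eta] is a folding of the base path [X],
   starting in direction [w] and ending in direction 1. *)
Inductive ls eta : R -> seq J -> Prop :=
| ls_end s w : 0 <= s -> s < 1 -> all P w -> eqw w [::] ->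
    (forall r, s <= r <= 1 -> incr eta s w r) -> ls eta s w
| ls_cons s t w w' : 0 <= s -> s < t -> t < 1 -> all P w ->
    (forall r, s <= r <= t -> incr eta s w r) ->
    chain (eta t) w w' -> ls eta t w' -> ls eta s w.

Lemma ls_letters eta s w : ls eta s w -> all P w.
Proof. by case. Qed.

Lemma incr_from eta s w r r' : incr eta s w r -> incr eta s w r' -> incr eta r w r'.
Proof.
move=> h1 h2 z.
have -> : eta r' z - eta r z = (eta r' z - eta s z) - (eta r z - eta s z) by ring.
rewrite h1 h2.
have -> : (fun z => X r' z - X r z) = (fun z => (X r' z - X s z) - (X r z - X s z)).
  by apply/funext => z'; ring.
by rewrite (@actB R J A w (fun z => X r' z - X s z) (fun z => X r z - X s z)).
Qed.

Lemma incr_pos eta w r r' i : 0 <= r -> r < r' -> r' <= 1 -> incr eta r w r' ->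
  pos w i -> eta r (inl i) < eta r' (inl i).
Proof.
move=> r0 rr r1 h; rewrite (posP Adiag Aoff Azero _ _ (Xreg r0 rr r1)) -h; lra.
Qed.

Lemma incr_neg eta w r r' i : 0 <= r -> r < r' -> r' <= 1 -> incr eta r w r' ->
  ~~ pos w i -> eta r' (inl i) < eta r (inl i).
Proof.
move=> r0 rr r1 h; rewrite (pos_negE Adiag Aoff Azero _ _ (Xreg r0 rr r1)) -h; lra.
Qed.

Lemma ls_first eta s w : ls eta s w ->
  exists t, [/\ s < t, t <= 1 & forall r r', s <= r -> r <= r' -> r' <= t -> incr eta r w r'].
Proof.
case=> [{}s {}w s0 s1 _ _ h|{}s t {}w w' s0 st t1 _ h _ _].
  by exists 1; split=> // r r' h1 h2 h3; apply: incr_from (h _ _) (h _ _); lra.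
by exists t; split=> //; [lra | move=> r r' h1 h2 h3; apply: incr_from (h _ _) (h _ _); lra].
Qed.

Lemma ls_trim_end eta s w s' : s <= s' -> s' < 1 -> 0 <= s -> all P w -> eqw w [::] ->
  (forall r, s <= r <= 1 -> incr eta s w r) -> ls eta s' w.
Proof.
move=> h1 h2 h3 h4 h5 h; apply: ls_end => //; first lra.
by move=> r hr; apply: incr_from (h _ _) (h _ _); lra.
Qed.

Lemma ls_trim eta s w s' t w' : s <= s' -> s' < t -> 0 <= s -> t < 1 -> all P w ->
    (forall r, s <= r <= t -> incr eta s w r) ->
    chain (eta t) w w' -> ls eta t w' -> ls eta s' w.
Proof.
move=> h1 h2 h3 h4 h5 h c l; apply: (ls_cons (t := t) (w' := w')) => //; first lra.
by move=> r hr; apply: incr_from (h _ _) (h _ _); lra.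
Qed.

(** Each segment is strictly monotone in the i-th pairing, so an interior local minimum sits at a
    turn where the sign at i goes from negative to positive; [chain_sgn] then gives integrality. *)
Lemma ls_locmin eta s w i a b t0 : ls eta s w -> s < t0 -> a < t0 < b -> b <= 1 ->
  (forall r, a <= r <= b -> s <= r -> eta t0 (inl i) <= eta r (inl i)) ->
  eta t0 (inl i) \is a Num.int.
Proof.
move=> l; elim: l a => [{}s {}w s0 s1 _ _ h|{}s t {}w w' s0 st t1 _ h c l IH] a st0 ab b1 hmin.
  pose r1 := Num.max a s; pose r2 := b.
  have r1a : a <= r1 by rewrite le_max lexx.
  have r1s : s <= r1 by rewrite le_max lexx orbT.
  have r1t : r1 < t0 by rewrite gt_max st0 andbT; lra.
  case: (boolP (pos w i)) => hp.
    have := @incr_pos eta w r1 t0 i; rewrite hp => hh.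
    have : eta r1 (inl i) < eta t0 (inl i).
      by apply: hh => //; try lra; apply: incr_from (h _ _) (h _ _); lra.
    by feed (hmin r1); lra.
  have : eta b (inl i) < eta t0 (inl i).
    apply: incr_neg hp => //; try lra; apply: incr_from (h _ _) (h _ _); lra.
  by feed (hmin b); lra.
have inc r r' : s <= r -> r <= r' -> r' <= t -> incr eta r w r'.
  by move=> h1 h2 h3; apply: incr_from (h _ _) (h _ _); lra.
pose r1 := Num.max a s.
have r1a : a <= r1 by rewrite le_max lexx.
have r1s : s <= r1 by rewrite le_max lexx orbT.
have r1t : r1 < t0 by rewrite gt_max st0 andbT; lra.
have [tt|tt] := leP t0 t.
  have hp : ~~ pos w i.
    apply/negP => hp; have : eta r1 (inl i) < eta t0 (inl i).
      by apply: incr_pos hp => //; try lra; apply: inc; lra.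
    by feed (hmin r1); lra.
  have [e|ne] := eqVneq t0 t; last first.
    have {ne}tt : t0 < t by rewrite lt_neqAle ne.
    pose r2 := Num.min b t.
    have r2b : r2 <= b by rewrite ge_min lexx.
    have r2s : r2 <= t by rewrite ge_min lexx orbT.
    have r2t : t0 < r2 by rewrite lt_min tt andbT; lra.
    have : eta r2 (inl i) < eta t0 (inl i).
      by apply: incr_neg hp => //; try lra; apply: inc; lra.
    by feed (hmin r2); lra.
  rewrite e; apply: (chain_sgn Adiag Aoff Azero c hp).
  apply/negPn/negP => hp'; have [t2 [tt2 t21 inc2]] := ls_first l.
  pose r2 := Num.min b t2.
  have r2b : r2 <= b by rewrite ge_min lexx.
  have r2s : r2 <= t2 by rewrite ge_min lexx orbT.
  have r2t : t < r2 by rewrite lt_min tt2 andbT; lra.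
  have : eta r2 (inl i) < eta t (inl i).
    by apply: incr_neg hp' => //; try lra; apply: inc2; lra.
  by feed (hmin r2); rewrite e in X0; lra.
apply: (IH a) => // r hr tr; apply: hmin => //; lra.
Qed.

(** The final direction 1 makes every pairing increase at the end, so no minimum lies at time 1,
    where the pairing need not be integral. *)
Lemma ls_last eta s w i : ls eta s w ->
  exists2 s', s <= s' < 1 & eta s' (inl i) < eta 1 (inl i).
Proof.
elim=> [{}s {}w s0 s1 _ e h|{}s t {}w w' s0 st t1 _ h c l [s' hs h']].
  exists s; first lra.
  apply: (@incr_pos _ w) => //; first by apply: h; lra.
  by rewrite (pos_eqw _ e); apply: (reg_rho R).
by exists s' => //; lra.
Qed.

Hypothesis X0 : forall z, X 0 z = 0.

Definition folded eta :=
  [/\ (forall z, eta 0 z = 0), (forall i, lip (Hc i eta)) & exists w, ls eta 0 w].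

Lemma folded_nice eta i : folded eta -> nice (Hc i eta).
Proof.
move=> [e0 HL [w l]]; split=> //.
- move=> a b a0 ab b1.
  have [t0 ht0 e] := mn_att (HL i) ab.
  have [ea|na] := eqVneq t0 a; first by constructor 2; rewrite -e ea.
  have [eb|nb] := eqVneq t0 b; first by constructor 3; rewrite -e eb.
  have t0a : a < t0 by rewrite lt_neqAle eq_sym na; lra.
  have t0b : t0 < b by rewrite lt_neqAle nb; lra.
  constructor 1; rewrite -e; apply: (@ls_locmin eta 0 w i a b) => //; try lra.
  by move=> r hr _; rewrite e; apply: mn_le.
- have [t0 ht0 e] := mn_att (HL i) ler01.
  have low r : 0 <= r <= 1 -> eta t0 (inl i) <= eta r (inl i).
    by move=> hr; rewrite e; apply: mn_le.
  have [ea|na] := eqVneq t0 0; first by rewrite -e ea e0 int_num0.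
  have [eb|nb] := eqVneq t0 1.
    have [s' hs h'] := ls_last i l.
    by feed (low s'); rewrite eb in X1; lra.
  have t0a : 0 < t0 by rewrite lt_neqAle eq_sym na; lra.
  have t0b : t0 < 1 by rewrite lt_neqAle nb; lra.
  rewrite -e; apply: (@ls_locmin eta 0 w i 0 1) => //; try lra.
  by move=> r hr _; apply: low.
Qed.

Lemma chain_translate x x' w w' :
  (forall y i, act y x (inl i) \is a Num.int -> act y x' (inl i) \is a Num.int) ->
  chain x w w' -> chain x' w w'.
Proof.
move=> hx; elim=> [w1 w2 e|w1 w2 w3 [y [i [h1 h2 h3 h4 h5]]] _ h]; first exact: chain_nil.
by apply: (chain_step _ h); exists y, i; split=> //; apply: hx.
Qed.

Lemma root_translate x x' j (n : int) :
  (forall z, x' z = x z + n%:~R * rootR j z) ->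
  forall y i, act y x (inl i) \is a Num.int -> act y x' (inl i) \is a Num.int.
Proof.
move=> e y i h; rewrite (_ : x' = fun z => n%:~R * rootR j z + x z); last first.
  by apply/funext => z; rewrite e addrC.
by rewrite act_lin rpredD // rpredM ?intr_int //; apply: act_int; apply: rootR_int.
Qed.

Lemma ls_shift eta eta' s w j (n : int) : ls eta s w ->
  (forall r z, s <= r <= 1 -> eta' r z = eta r z + n%:~R * rootR j z) -> ls eta' s w.
Proof.
elim=> [{}s {}w s0 s1 h0 e h|{}s t {}w w' s0 st t1 h0 h c l IH] hs.
  apply: ls_end => // r hr z; rewrite !hs; try lra.
  by rewrite -h // opprD addrACA subrr addr0.
apply: (ls_cons (t := t) (w' := w')) => //.
- move=> r hr z; rewrite !hs; try lra.
  by rewrite -h // opprD addrACA subrr addr0.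
- apply: chain_translate c; apply: (@root_translate _ _ j n) => z; apply: hs; lra.
- by apply: IH => r z hr; apply: hs; lra.
Qed.

Section FClosure.
Variables (eta : R -> J + J -> R) (i : J) (p q : R).
Local Notation H := (Hc i eta).
Local Notation m := (mn H 0 1).
Hypotheses (Pi : P i) (HL : lip H) (mint : m \is a Num.int).
Hypotheses (p0 : 0 <= p) (pq : p < q) (q1 : q < 1) (Hp : eta p (inl i) = m) (Hq : eta q (inl i) = m + 1).
Hypothesis Habove : forall t, p < t <= 1 -> m < eta t (inl i).
Hypothesis Hmono : forall s t, p <= s -> s <= t -> t <= q -> eta s (inl i) <= eta t (inl i).
Hypothesis th0 : forall t, t <= p -> th H t = 0.
Hypothesis th1 : forall t, p <= t <= q -> th H t = eta t (inl i) - m.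
Hypothesis th2 : forall t, q <= t -> th H t = 1.

Local Ltac prep := pose proof p0 as p0'; pose proof pq as pq'; pose proof q1 as q1';
  pose proof Hp as Hp'; pose proof Hq as Hq'.

Local Lemma low t : 0 <= t <= 1 -> m <= eta t (inl i).
Proof. by move=> h; apply: (mn_le HL h). Qed.

Local Lemma f_tail s w : q <= s -> ls eta s w -> ls (fop i eta) s w.
Proof.
prep.
move=> qs l; apply: (@ls_shift eta _ s w i (-1) l) => r z hr.
rewrite /fop th2; [ring | lra].
Qed.

Local Lemma f_turn w w' : pos w i -> chain (eta q) w w' -> chain (fop i eta q) (i :: w) w'.
Proof.
prep.
move=> hp c; apply: chain_up => //.
  rewrite /fop th2 // /rootR /= Adiag.
  rewrite Hq.
  by rewrite !(rpredB, rpredD, rpredM) // ?int_num1.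
apply: chain_translate c; apply: (@root_translate _ _ i (-1)) => z.
by rewrite /fop th2 //; ring.
Qed.

Local Lemma f_incr s r w : p <= s -> s <= q -> p <= r -> r <= q ->
  incr eta s w r -> incr (fop i eta) s (i :: w) r.
Proof.
prep.
move=> ps sq pr rq h z; rewrite /fop !th1; try lra.
rewrite /= /refl -!h /rootR; ring.
Qed.

(** Between p and q all directions are reflected by i. They stay positive at i because the pairing
    is nondecreasing, so their chains may be conjugated by [chain_affine]; at q a turn back from
    [i :: w] is inserted. *)
Local Lemma f_middle s w : ls eta s w -> p <= s -> s < q -> pos w i ->
  ls (fop i eta) s (i :: w).
Proof.
prep.
elim=> [{}s {}w s0 s1 h0 e h|{}s t {}w w' s0 st t1 h0 h c l IH] ps sq hp.
  apply: (@ls_cons _ s q (i :: w) w) => //=; first by rewrite Pi.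
  - by move=> r hr; apply: f_incr; try lra; apply: h; lra.
  - by apply: f_turn => //; apply: chain_refl.
  - by apply: f_tail => //; apply: (ls_trim_end (s := s)) => //; lra.
have [tq|tq|tq] := ltgtP t q.
- have hp' : pos w' i.
    apply/negPn/negP => hp'; have [t2 [tt2 t21 inc2]] := ls_first l.
    pose r2 := Num.min q t2.
    have r2b : r2 <= q by rewrite ge_min lexx.
    have r2s : r2 <= t2 by rewrite ge_min lexx orbT.
    have r2t : t < r2 by rewrite lt_min tt2 andbT.
    have : eta r2 (inl i) < eta t (inl i).
      by apply: incr_neg hp' => //; try lra; apply: inc2; lra.
    by feed (Hmono (s := t) (t := r2)); lra.
  apply: (@ls_cons _ s t (i :: w) (i :: w')) => //=; first by rewrite Pi.
  - by move=> r hr; apply: f_incr; try lra; apply: h; lra.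
  - apply: (chain_affine Adiag Aoff Azero Pi _ _ c); last by rewrite hp hp'.
    have /intrP[n en] := mint; exists n => z.
    by rewrite /fop th1 ?en /refl /rootR /=; [ring | lra].
  - by apply: IH => //; lra.
- apply: (@ls_cons _ s q (i :: w) w) => //=; first by rewrite Pi.
  - by move=> r hr; apply: f_incr; try lra; apply: h; lra.
  - by apply: f_turn => //; apply: chain_refl.
  - by apply: f_tail => //; apply: (ls_trim (s := s) (t := t) (w' := w')) => //; lra.
- subst t; apply: (@ls_cons _ s q (i :: w) w') => //=; first by rewrite Pi.
  - by move=> r hr; apply: f_incr; try lra; apply: h; lra.
  - exact: f_turn.
  - exact: f_tail.
Qed.

Local Lemma f_begin_pos w : ls eta p w -> pos w i.
Proof.
prep.
move=> l; apply/negPn/negP => hp'; have [t2 [tt2 t21 inc2]] := ls_first l.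
have : eta t2 (inl i) < eta p (inl i).
  by apply: incr_neg hp' => //; try lra; apply: inc2; lra.
by feed (low (t := t2)); lra.
Qed.

Local Lemma f_head s w : ls eta s w -> s < p -> ls (fop i eta) s w.
Proof.
prep.
elim=> [{}s {}w s0 s1 h0 e h|{}s t {}w w' s0 st t1 h0 h c l IH] sp.
  have : eta s (inl i) < eta p (inl i).
    apply: (@incr_pos _ w) => //; try lra; first by apply: h; lra.
    by rewrite (pos_eqw _ e); apply: (reg_rho R).
  by feed (low (t := s)); lra.
have keep r : s <= r <= p -> incr eta s w r -> incr (fop i eta) s w r.
  by move=> hr hi z; rewrite /fop !th0 ?mul0r ?subr0 //; lra.
have ex : forall r, r <= p -> fop i eta r = eta r.
  by move=> r hr; apply/funext => z; rewrite /fop th0 // mul0r subr0.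
have [tp|tp|tp] := ltgtP t p.
- apply: (@ls_cons _ s t w w') => //; last by apply: IH.
    by move=> r hr; apply: keep; [lra | apply: h; lra].
  by rewrite ex //; lra.
- have inc r r' : s <= r -> r <= r' -> r' <= t -> incr eta r w r'.
    by move=> h1 h2 h3; apply: incr_from (h _ _) (h _ _); lra.
  case: (boolP (pos w i)) => hp.
    have : eta s (inl i) < eta p (inl i) by apply: incr_pos hp => //; try lra; apply: inc; lra.
    by feed (low (t := s)); lra.
  have : eta t (inl i) < eta p (inl i) by apply: incr_neg hp => //; try lra; apply: inc; lra.
  by feed (low (t := t)); lra.
- subst t; have hp : ~~ pos w i.
    apply/negP => hp.
    have : eta s (inl i) < eta p (inl i) by apply: incr_pos hp => //; try lra; apply: h; lra.
    by feed (low (t := s)); lra.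
  have hp' := f_begin_pos l.
  apply: (@ls_cons _ s p w (i :: w')) => //.
  + by move=> r hr; apply: keep; [lra | apply: h; lra].
  + rewrite ex //; apply: (proj1 (chain_turn Adiag Aoff Azero Pi _ hp hp' c)).
    by rewrite Hp.
  + by apply: f_middle.
Qed.

Local Lemma f_ls w : ls eta 0 w -> exists w', ls (fop i eta) 0 w'.
Proof.
prep.
move=> l; have [e|ne] := eqVneq p 0; last first.
  by exists w; apply: f_head => //; rewrite lt_neqAle eq_sym ne.
exists (i :: w); rewrite -e in l *; apply: f_middle => //; exact: f_begin_pos.
Qed.

End FClosure.

(** The nonintegral endpoint pairing forces q < 1, since the pairing is integral at q; hence an
    unreflected last segment remains. *)
Lemma folded_f eta i : P i -> folded eta -> mn (Hc i eta) 0 1 + 1 <= eta 1 (inl i) ->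
  eta 1 (inl i) \isn't a Num.int -> folded (fop i eta).
Proof.
move=> Pi hf phi hint; have hn := folded_nice i hf; have [e0 HL [w l]] := hf.
have [_ _ mint] := hn.
have [p [q [[p0 pq q1] [ep eq_ h1 h2 h3] mono [t1 t2 t3]]]] := th_shape hn phi.
have q1' : q < 1.
  rewrite lt_neqAle q1 andbT; apply: contraNneq hint => <-.
  by rewrite eq_ rpredD // int_num1.
split.
- by move=> z; rewrite /fop th_le0 // mul0r subr0 e0.
- move=> j; apply: lipD => //; apply: lip_opp.
  have := lipZ (rootR i (inl j)) (th_lip (HL i)).
  by under eq_fun do rewrite mulrC.
- by apply: (@f_ls eta i p q) l.
Qed.

Section EClosure.
Variables (eta : R -> J + J -> R) (i : J) (p q : R).
Local Notation H := (Hc i eta).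
Local Notation m := (mn H 0 1).
Hypotheses (Pi : P i) (HL : lip H) (mint : m \is a Num.int).
Hypotheses (p0 : 0 <= p) (pq : p < q) (q1 : q <= 1) (Hp : eta p (inl i) = m + 1) (Hq : eta q (inl i) = m).
Hypothesis Hbelow : forall t, p < t <= q -> eta t (inl i) < m + 1.
Hypothesis Hmono : forall s t, p <= s -> s <= t -> t <= q -> eta t (inl i) <= eta s (inl i).
Hypothesis k0 : forall t, t <= p -> kap H t = 0.
Hypothesis k1 : forall t, p <= t <= q -> kap H t = 1 - (eta t (inl i) - m).
Hypothesis k2 : forall t, q <= t -> kap H t = 1.

Local Ltac prep := pose proof p0 as p0'; pose proof pq as pq'; pose proof q1 as q1';
  pose proof Hp as Hp'; pose proof Hq as Hq'.

Local Lemma e_low t : 0 <= t <= 1 -> m <= eta t (inl i).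
Proof. by move=> h; apply: (mn_le HL h). Qed.

Local Lemma e_tail s w : q <= s -> ls eta s w -> ls (eop i eta) s w.
Proof.
prep.
move=> qs l; apply: (@ls_shift eta _ s w i 1 l) => r z hr.
rewrite /eop k2; [ring | lra].
Qed.

Local Lemma e_incr s r w : p <= s -> s <= q -> p <= r -> r <= q ->
  incr eta s w r -> incr (eop i eta) s (i :: w) r.
Proof.
prep.
move=> ps sq pr rq h z; rewrite /eop !k1; try lra.
rewrite /= /refl -!h /rootR; ring.
Qed.

(** The last segment has direction 1, positive at i, so it cannot begin before q, where the pairing
    decreases; at q the path must turn. *)
Local Lemma e_middle s w : ls eta s w -> p <= s -> s < q -> ~~ pos w i ->
  ls (eop i eta) s (i :: w).
Proof.
prep.
elim=> [{}s {}w s0 s1 h0 e h|{}s t {}w w' s0 st t1 h0 h c l IH] ps sq hp.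
  by move: hp; rewrite (pos_eqw _ e) /pos ltr01.
have [tq|tq|tq] := ltgtP t q.
- have hp' : ~~ pos w' i.
    apply/negP => hp'; have [t2 [tt2 t21 inc2]] := ls_first l.
    pose r2 := Num.min q t2.
    have r2b : r2 <= q by rewrite ge_min lexx.
    have r2s : r2 <= t2 by rewrite ge_min lexx orbT.
    have r2t : t < r2 by rewrite lt_min tt2 andbT.
    have : eta t (inl i) < eta r2 (inl i).
      by apply: incr_pos hp' => //; try lra; apply: inc2; lra.
    by feed (Hmono (s := t) (t := r2)); lra.
  apply: (@ls_cons _ s t (i :: w) (i :: w')) => //=; first by rewrite Pi.
  - by move=> r hr; apply: e_incr; try lra; apply: h; lra.
  - apply: (chain_affine Adiag Aoff Azero Pi _ _ c); last by rewrite (negPf hp) (negPf hp').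
    have /intrP[n en] := mint; exists (n + 1) => z.
    by rewrite /eop k1 ?en /refl /rootR /=; [rewrite intrD; ring | lra].
  - by apply: IH => //; lra.
- have : eta t (inl i) < eta q (inl i).
    apply: incr_neg hp => //; try lra; apply: incr_from (h _ _) (h _ _); lra.
  by feed (e_low (t := t)); lra.
- subst t; apply: (@ls_cons _ s q (i :: w) w') => //=; first by rewrite Pi.
  + by move=> r hr; apply: e_incr; try lra; apply: h; lra.
  + have hp' : pos w' i.
      apply/negPn/negP => hp'; have [t2 [tt2 t21 inc2]] := ls_first l.
      have : eta t2 (inl i) < eta q (inl i).
        by apply: incr_neg hp' => //; try lra; apply: inc2; lra.
      by feed (e_low (t := t2)); lra.
    have hx : eta q (inl i) \is a Num.int by rewrite Hq.
    have [_ c'] := chain_turn Adiag Aoff Azero Pi hx hp hp' c.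
    apply: chain_translate c'; apply: (@root_translate _ _ i 1) => z.
    by rewrite /eop k2 //; ring.
  + exact: e_tail.
Qed.

Local Lemma e_down w w' : ~~ pos w' i -> chain (eta p) w w' -> chain (eop i eta p) w (i :: w').
Proof.
prep.
move=> hp c; have -> : eop i eta p = eta p.
  by apply/funext => z; rewrite /eop k0 // mul0r addr0.
apply: chain_down => //.
by rewrite Hp rpredD // int_num1.
Qed.

Local Lemma e_begin_neg w : ls eta p w -> ~~ pos w i.
Proof.
prep.
move=> l; apply/negP => hp'; have [t2 [tt2 t21 inc2]] := ls_first l.
pose r2 := Num.min q t2.
have r2b : r2 <= q by rewrite ge_min lexx.
have r2s : r2 <= t2 by rewrite ge_min lexx orbT.
have r2t : p < r2 by rewrite lt_min tt2 andbT.
have : eta p (inl i) < eta r2 (inl i).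
  by apply: incr_pos hp' => //; try lra; apply: inc2; lra.
by feed (Hbelow (t := r2)); lra.
Qed.

Local Lemma e_head s w : ls eta s w -> s < p -> ls (eop i eta) s w.
Proof.
prep.
elim=> [{}s {}w s0 s1 h0 e h|{}s t {}w w' s0 st t1 h0 h c l IH] sp.
  have : eta p (inl i) < eta q (inl i).
    apply: (@incr_pos _ w) => //; try lra; last by rewrite (pos_eqw _ e); apply: (reg_rho R).
    by apply: incr_from (h _ _) (h _ _); lra.
  by lra.
have keep r : s <= r <= p -> incr eta s w r -> incr (eop i eta) s w r.
  by move=> hr hi z; rewrite /eop !k0 ?mul0r ?addr0 //; lra.
have ex : forall r, r <= p -> eop i eta r = eta r.
  by move=> r hr; apply/funext => z; rewrite /eop k0 // mul0r addr0.
have [tp|tp|tp] := ltgtP t p.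
- apply: (@ls_cons _ s t w w') => //; last by apply: IH.
    by move=> r hr; apply: keep; [lra | apply: h; lra].
  by rewrite ex //; lra.
- have lp : ls eta p w by apply: (ls_trim (s := s) (t := t) (w' := w')) => //; lra.
  have hp := e_begin_neg lp.
  apply: (@ls_cons _ s p w (i :: w)) => //; try lra.
  + by move=> r hr; apply: keep; [lra | apply: h; lra].
  + by apply: e_down => //; apply: chain_refl.
  + by apply: e_middle.
- subst t; have hp' := e_begin_neg l.
  apply: (@ls_cons _ s p w (i :: w')) => //.
  + by move=> r hr; apply: keep; [lra | apply: h; lra].
  + exact: e_down.
  + by apply: e_middle.
Qed.

Local Lemma e_ls w : ls eta 0 w -> exists w', ls (eop i eta) 0 w'.
Proof.
prep.
move=> l; have [e|ne] := eqVneq p 0; last first.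
  by exists w; apply: e_head => //; rewrite lt_neqAle eq_sym ne.
exists (i :: w); rewrite -e in l *; apply: e_middle => //; exact: e_begin_neg.
Qed.

End EClosure.

Lemma kap_lip G : lip G -> lip (@kap R G).
Proof.
move=> GL; apply: lipD (lip_cst _) _; apply: lip_opp.
apply: (lip_comp (th_lip (lip_rv GL))).
exact: lipD (lip_cst _) (lip_opp (lip_id _)).
Qed.

Lemma folded_e eta i : P i -> folded eta -> mn (Hc i eta) 0 1 + 1 <= 0 ->
  folded (eop i eta).
Proof.
move=> Pi hf eps; have hn := folded_nice i hf; have [e0 HL [w l]] := hf.
have [_ _ mint] := hn.
have {}eps : mn (Hc i eta) 0 1 + 1 <= eta 0 (inl i) by rewrite e0.
have [p [q [[p0 pq q1] [ep eq_ h1 h2 h3] mono [t1 t2 t3]]]] := kap_shape hn eps.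
split.
- by move=> z; rewrite /eop t1 // mul0r addr0 e0.
- move=> j; apply: lipD => //.
  have := lipZ (rootR i (inl j)) (kap_lip (HL i)).
  by under eq_fun do rewrite mulrC.
- by apply: (@e_ls eta i p q) l.
Qed.

(** A nontrivial initial direction is negative at some i and would make that pairing negative at
    once. So the path starts in direction 1, and chains never increase length. *)
Lemma folded_highest eta : folded eta -> (forall i, 0 <= mn (Hc i eta) 0 1) ->
  forall t, 0 <= t <= 1 -> eta t = X t.
Proof.
move=> [e0 HL [w l]] hm.
have w0 : len R A w = 0%N.
  apply/eqP; rewrite -leqn0 leqNgt; apply/negP => /len_pos[i [w' [e lw]]].
  have hn : ~~ pos w i.
    apply/negP => hp; have := len_pos_cons Adiag Aoff Azero hp.
    have -> : len R A (i :: w) = len R A w'.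
      by apply: len_eqw => v; rewrite /= e /= reflK.
    by rewrite lw => /eqP; rewrite eq_sym; apply/negP; lia.
  have [t [t0 t1 inc]] := ls_first l.
  have : eta t (inl i) < eta 0 (inl i) by apply: incr_neg hn => //; apply: inc => //; lra.
  have : 0 <= eta t (inl i) by apply: (le_trans (hm i)); apply: mn_le => //; lra.
  rewrite e0; lra.
have key : forall s w, ls eta s w -> len R A w = 0%N ->
    forall t, s <= t <= 1 -> forall z, eta t z - eta s z = X t z - X s z.
  move=> s w2; elim=> [{}s {}w2 s0 s1 h0 e h|{}s t {}w2 w' s0 st t1 h0 h c l' IH] lw r hr z.
    by rewrite h // e.
  have lw' : len R A w' = 0%N by apply/eqP; rewrite -leqn0 -lw; apply: chain_len c.
  have [rt|tr] := leP r t; first by rewrite h ?(len0 lw) //; lra.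
  have -> : eta r z - eta s z = (eta r z - eta t z) + (eta t z - eta s z) by ring.
  by rewrite IH // ?h ?(len0 lw) /=; [ring | lra | lra].
move=> t ht; apply/funext => z; have := key _ _ l w0 t ht z.
by rewrite e0 X0 !subr0.
Qed.

Lemma act_le_out w d k : reg d -> act w d (inr k) <= d (inr k).
Proof.
move=> dr; move: {2}(len R A w) (erefl (len R A w)) => n.
elim: n w => [|n IH] w lw; first by rewrite (len0 lw).
have [|i [w' [e lw']]] := @len_pos R J A w; first by rewrite lw.
have hp : pos w' i.
  apply/negPn/negP => /(len_neg_cons Adiag Aoff Azero).
  by rewrite -(len_eqw e) lw'; lia.
rewrite e /= /refl /=; have := IH w'; rewrite lw' in lw; case: lw => -> /(_ erefl).
have : 0 < act w' d (inl i) by rewrite -posP.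
by case: eqP => _ /=; rewrite ?mulr1 ?mulr0; lra.
Qed.

(** The endpoint is the endpoint of the base minus nonnegative multiples of simple roots. This
    bounds how often e-operators can act and makes the descent to a highest element terminate. *)
Lemma folded_below eta k : folded eta -> eta 1 (inr k) <= X 1 (inr k).
Proof.
move=> [e0 HL [w l]].
have key : forall s w, ls eta s w -> eta 1 (inr k) - eta s (inr k) <= X 1 (inr k) - X s (inr k).
  move=> s w2; elim=> [{}s {}w2 s0 s1 h0 e h|{}s t {}w2 w' s0 st t1 h0 h c l' IH].
    by rewrite h ?e //; lra.
  have := @act_le_out w2 (fun z => X t z - X s z) k (Xreg s0 st (ltW t1)).
  by rewrite -h; [move: IH; lra | lra].
by have := key _ _ l; rewrite e0 X0 !subr0.
Qed.

End FoldedPaths.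

(** * Independence of the base path *)

Section MixedWords.
Variables (R : realType) (J : eqType) (A : J -> J -> int).
Implicit Types (w v : seq J) (i j : J) (s t r d e : R) (p X Y eta : R -> J + J -> R).
Hypothesis Adiag : forall i, A i i = 2.
Hypothesis Aoff : forall i j, i <> j -> A i j <= 0.
Hypothesis Azero : forall i j, A i j = 0 <-> A j i = 0.

Local Notation rootR := (@rootR R J A).
Local Notation fop := (@fop R J A).
Local Notation eop := (@eop R J A).
Local Notation Hc i eta := (fun t => eta t (inl i)).
Local Notation folded := (@folded R J A).
Local Notation mni i eta := (mn (fun t => eta t (inl i)) 0 1).

Definition op (o : bool * J) : (R -> J + J -> R) -> R -> J + J -> R :=
  if o.1 then fop o.2 else eop o.2.

Definition ev (W : seq (bool * J)) p := foldr op p W.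

Definition adm1 (o : bool * J) p : Prop :=
  if o.1 then mni o.2 p + 1 <= p 1 (inl o.2) else mni o.2 p + 1 <= 0.

Fixpoint adm (W : seq (bool * J)) p : Prop :=
  if W is o :: W' then adm W' p /\ adm1 o (ev W' p) else True.

Lemma ev_cat W1 W2 p : ev (W1 ++ W2) p = ev W1 (ev W2 p).
Proof. by rewrite /ev foldr_cat. Qed.

Lemma adm_cat W1 W2 p : adm (W1 ++ W2) p <-> adm W2 p /\ adm W1 (ev W2 p).
Proof.
elim: W1 => [|o W1 IH] /=; first by split=> [|[]].
by rewrite IH ev_cat; tauto.
Qed.

Definition lips p := forall z, lip (fun t => p t z).

Lemma op_lips o p : lips p -> lips (op o p).
Proof.
move=> h z; case: o => [[|] i]; rewrite /op /=.
  apply: lipD => //; apply: lip_opp.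
  by have := lipZ (rootR i z) (th_lip (h (inl i))); under eq_fun do rewrite mulrC.
apply: lipD => //.
by have := lipZ (rootR i z) (kap_lip (h (inl i))); under eq_fun do rewrite mulrC.
Qed.

Lemma ev_lips W p : lips p -> lips (ev W p).
Proof. by move=> h; elim: W => //= o W; apply: op_lips. Qed.

Fixpoint wsh (W : seq (bool * J)) (z : J + J) : int :=
  if W is o :: W' then wsh W' z + (if o.1 then - rootv A o.2 z else rootv A o.2 z) else 0.

Lemma kap_ge1 G t : lip G -> 1 <= t -> kap G t = 1.
Proof. by move=> h t1; rewrite /kap th_le0 ?subr0 //; [exact: lip_rv | lra]. Qed.

Lemma kap_le0 G t : lip G -> mn G 0 1 + 1 <= G 0 -> t <= 0 -> kap G t = 0.
Proof.
move=> h hm t0; rewrite /kap th_ge1 ?subrr //; [exact: lip_rv | | lra].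
by rewrite mn_rv01 // /rv subrr.
Qed.

Lemma ev_out W p : lips p -> (forall z, p 0 z = 0) -> adm W p ->
  (forall t, t <= 0 -> ev W p t = p t) /\
  (forall t z, 1 <= t -> ev W p t z = p t z + (wsh W z)%:~R).
Proof.
move=> hl p0; elim: W => [|o W IH] /=.
  by split=> // t z _; rewrite addr0.
move=> [/IH [h0 h1] ha]; have := ev_lips W hl => hl'.
case: o ha => [[|] i]; rewrite /adm1 /op /= => ha; split=> t => [t0|z t1].
- by apply/funext => z; rewrite /fop th_le0 // mul0r subr0 h0.
- by rewrite /fop th_ge1 // h1 // mul1r intrD intrN addrA.
- apply/funext => z; rewrite /eop kap_le0 ?mul0r ?addr0 ?h0 //.
  by rewrite p0.
- by rewrite /eop kap_ge1 // h1 // mul1r intrD addrA.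
Qed.

Definition regb X := [/\ lips X, (forall z, X 0 z = 0),
  (forall s t, 0 <= s -> s < t -> t <= 1 -> reg (fun z => X t z - X s z)) &
  forall i, X 1 (inl i) \isn't a Num.int].

Lemma folded_base P X : regb X -> folded P X X.
Proof.
move=> [h1 h2 h3 h4]; split=> //; exists [::]; by apply: ls_end.
Qed.

Lemma ev_folded P X W : regb X -> all (fun o => P o.2) W -> adm W X -> folded P X (ev W X).
Proof.
move=> hX; have [h1 h2 h3 h4] := hX; elim: W => [_ _|o W IH] /=.
  exact: folded_base.
move=> /andP[Po PW] [aW ao]; have hf := IH PW aW.
have [_ /(_ 1)out] := ev_out h1 h2 aW.
case: o Po ao => [[|] i]; rewrite /adm1 /op /= => Po ao.
  apply: folded_f => //; rewrite out //.
  apply: contraNN (h4 i) => hi.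
  by rewrite -[X 1 _](addrK (wsh W (inl i))%:~R) rpredB // intr_int.
exact: folded_e.
Qed.

Lemma ev_nice X W i : regb X -> adm W X -> nice (Hc i (ev W X)).
Proof.
move=> hX ha; have [h1 h2 h3 h4] := hX.
by apply: (@folded_nice R J A Adiag Aoff Azero predT X) => //; apply: ev_folded => //; apply/allP.
Qed.

Definition near e X Y (C : J + J -> R) :=
  forall t z, 0 <= t <= 1 -> `|X t z - Y t z| <= C z * e.

Lemma kap_close G G' e t : lip G -> lip G' ->
  (forall t, 0 <= t <= 1 -> `|G t - G' t| <= e) -> `|kap G t - kap G' t| <= 2 * e.
Proof.
move=> h h' hc; rewrite /kap -normrN.
rewrite [X in `|X|](_ : _ = th (rv G) (1 - t) - th (rv G') (1 - t)); last by ring.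
apply: th_close; try exact: lip_rv.
by move=> s hs; apply: hc; lra.
Qed.

(** Every operator is Lipschitz in the uniform distance of paths; what matters is that the constants
    depend on the word only. *)
Lemma ev_near W C : exists C', forall X Y e, 0 <= e -> lips X -> lips Y ->
  near e X Y C -> near e (ev W X) (ev W Y) C'.
Proof.
elim: W => [|o W [C' IH]]; first by exists C.
exists (fun z => C' z + 2 * C' (inl o.2) * `|rootR o.2 z|) => X Y e e0 lX lY h.
have := IH _ _ _ e0 lX lY h => {}h t z ht /=.
have lX' := ev_lips W lX; have lY' := ev_lips W lY.
have hz := h t z ht.
have hi s : 0 <= s <= 1 -> `|ev W X s (inl o.2) - ev W Y s (inl o.2)| <= C' (inl o.2) * e.
  by move=> hs; apply: h.
have main (a b x y c : R) : `|a - b| <= C' z * e -> `|x - y| <= 2 * (C' (inl o.2) * e) ->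
    `|(a - x * c) - (b - y * c)| <= (C' z + 2 * C' (inl o.2) * `|c|) * e.
  move=> k1 k2; have -> : (a - x * c) - (b - y * c) = (a - b) - (x - y) * c by ring.
  apply: (le_trans (ler_normB _ _)); rewrite normrM.
  have : `|x - y| * `|c| <= 2 * (C' (inl o.2) * e) * `|c| by apply: ler_wpM2r.
  lra.
rewrite /op; case: (o.1).
  by apply: main => //; apply: (th_close (H := Hc o.2 (ev W X)) (G := Hc o.2 (ev W Y))).
have := main (ev W X t z) (ev W Y t z) (- kap (Hc o.2 (ev W X)) t) (- kap (Hc o.2 (ev W Y)) t) (rootR o.2 z) hz.
rewrite /eop !mulNr !opprK => h'; apply: h'.
rewrite -normrN opprD !opprK.
by apply: (kap_close (G := Hc o.2 (ev W X)) (G' := Hc o.2 (ev W Y))).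
Qed.

Lemma mni_near X Y i e C : lips X -> lips Y -> near e X Y C ->
  `|mni i X - mni i Y| <= C (inl i) * e.
Proof. by move=> lX lY h; apply: mn_close => // t ht; apply: h. Qed.

Lemma int_const (g : R -> R) a b C : a <= b -> 0 <= C ->
  (forall s, a <= s <= b -> g s \is a Num.int) ->
  (forall s t, a <= s <= b -> a <= t <= b -> `|g s - g t| <= C * `|s - t|) -> g a = g b.
Proof.
move=> ab C0 gi gl.
(* With more than [C * (b - a)] equal steps the values change by less than 1 at each step, so
   integers stay constant. *)
pose N := (Num.truncn (C * (b - a))).+1.
have N0 : 0 < N%:R :> R by rewrite ltr0n.
have hN : C * (b - a) < N%:R by apply: truncnS_gt.
pose x (k : nat) := a + k%:R / N%:R * (b - a).
have xP k : (k <= N)%N -> a <= x k <= b.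
  move=> kN; rewrite /x lerDl mulr_ge0 ?divr_ge0 ?subr_ge0 //=.
  rewrite -lerBrDl ler_piMl ?subr_ge0 // ler_pdivrMr // mul1r ler_nat //.
have key k : (k <= N)%N -> g (x k) = g a.
  elim: k => [_|k IH kN]; first by rewrite /x mul0r mul0r addr0.
  rewrite -(IH (ltnW kN)).
  have h1 : g (x k.+1) \is a Num.int by apply/gi/xP.
  have h2 : g (x k) \is a Num.int by apply/gi/xP/ltnW.
  have : `|g (x k.+1) - g (x k)| < 1.
    apply: (le_lt_trans (gl _ _ _ _)); rewrite ?xP // 1?ltnW //.
    have -> : x k.+1 - x k = (b - a) / N%:R.
      by rewrite /x -natr1; field; apply/negP => /eqP h; move: N0; rewrite h ltxx.
    rewrite ger0_norm ?divr_ge0 ?subr_ge0 // mulrA ltr_pdivrMr // mul1r //.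
  rewrite ltr_norml => /andP[k1 k2].
  apply/eqP; rewrite eq_le !leNgt; apply/andP; split; apply/negP => hlt.
    have := int_between h2 h1 hlt; lra.
  have := int_between h1 h2 hlt; lra.
have := key N (leqnn _); rewrite /x divff ?mul1r; last by rewrite gt_eqF.
by rewrite addrC subrK.
Qed.

Lemma near_bound X Y : lips X -> lips Y -> exists2 C : J + J -> R, (forall z, 0 <= C z) &
  near 1 X Y C.
Proof.
move=> lX lY.
have : forall z, exists C, 0 <= C /\ forall t, 0 <= t <= 1 -> `|X t z - Y t z| <= C.
  move=> z; have [K K0 hK] := lipD (lX z) (lip_opp (lY z)).
  exists (K + `|X 0 z - Y 0 z|); split; first by rewrite addr_ge0.
  move=> t ht; have := hK t 0; rewrite subr0.
  have : K * `|t| <= K by rewrite ler_piMr // ger0_norm; lra.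
  have : `|X t z - Y t z| <= `|X t z - Y t z - (X 0 z - Y 0 z)| + `|X 0 z - Y 0 z|.
    by rewrite -{1}(subrK (X 0 z - Y 0 z) (X t z - Y t z)); apply: ler_normD.
  lra.
move=> /choice[C hC]; exists C => [z|t z ht]; first by have [] := hC z.
by rewrite mulr1; have [_] := hC z; apply.
Qed.

Section Homotopy.
Variables X Y : R -> J + J -> R.
Hypotheses (hX : regb X) (hY : regb Y) (XY1 : forall i, X 1 (inl i) = Y 1 (inl i)).

(** Convexity keeps the increments regular, and the common endpoint pairings keep their
    nonintegrality along the whole homotopy. *)
Local Definition Z s : R -> J + J -> R := fun t z => (1 - s) * X t z + s * Y t z.

Local Lemma Zregb s : 0 <= s <= 1 -> regb (Z s).
Proof.
move=> hs; have [x1 x2 x3 x4] := hX; have [y1 y2 y3 y4] := hY; split.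
- by move=> z; apply: lipD; apply: lipZ.
- by move=> z; rewrite /Z x2 y2 !mulr0 addr0.
- move=> a b a0 ab b1 i; have := x3 a b a0 ab b1 i; have := y3 a b a0 ab b1 i.
  have -> : Z s b (inl i) - Z s a (inl i) =
    (1 - s) * (X b (inl i) - X a (inl i)) + s * (Y b (inl i) - Y a (inl i)) by rewrite /Z; ring.
  move=> h1 h2; have [s0|s0] := eqVneq s 0; first by rewrite s0; lra.
  have s0' : 0 < s by rewrite lt_neqAle eq_sym s0; lra.
  have : 0 < s * (Y b (inl i) - Y a (inl i)) by apply: mulr_gt0.
  have : 0 <= (1 - s) * (X b (inl i) - X a (inl i)) by apply: mulr_ge0; [lra | apply: ltW].
  lra.
- by move=> i; rewrite /Z XY1 -mulrDl subrK mul1r.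
Qed.

Local Lemma Z_const W i s : 0 <= s <= 1 -> (forall s, 0 <= s <= 1 -> adm W (Z s)) ->
  mni i (ev W (Z 0)) = mni i (ev W (Z s)).
Proof.
move=> hs ha; have [x1 _ _ _] := hX; have [y1 _ _ _] := hY.
have [C C0 hC] := near_bound y1 x1.
have [C' hC'] := ev_near W C.
have lZ a : lips (Z a) by move=> z; apply: lipD; apply: lipZ.
have nZ a b : near `|a - b| (Z a) (Z b) C.
  move=> t z ht; have := hC t z ht; rewrite mulr1.
  have -> : Z a t z - Z b t z = (a - b) * (Y t z - X t z) by rewrite /Z; ring.
  by move=> h; rewrite normrM mulrC ler_wpM2r.
have nE a b : `|mni i (ev W (Z a)) - mni i (ev W (Z b))| <= C' (inl i) * `|a - b|.
  by apply: mni_near; [exact: ev_lips | exact: ev_lips | apply: hC'].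
apply: (@int_const (fun s => mni i (ev W (Z s))) 0 s `|C' (inl i)|) => //; first by lra.
  move=> a a1; have ha1 : 0 <= a <= 1 by lra.
  by have [] := @ev_nice (Z a) W i (Zregb ha1) (ha a ha1).
move=> a b _ _; apply: (le_trans (nE a b)).
by apply: ler_wpM2r => //; apply: ler_norm.
Qed.

Local Lemma Z0 : Z 0 = X.
Proof. by apply/funext => t; apply/funext => z; rewrite /Z subr0 mul1r mul0r addr0. Qed.

Local Lemma Z1 : Z 1 = Y.
Proof. by apply/funext => t; apply/funext => z; rewrite /Z subrr mul0r mul1r add0r. Qed.

(** Whether one more letter is admissible depends on a minimum and an endpoint pairing only. Both
    are constant in s, so admissibility spreads along the homotopy letter by letter. *)
Lemma homotopy W : adm W X ->
  adm W Y /\ forall i, mni i (ev W X) = mni i (ev W Y).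
Proof.
have [x1 x2 _ _] := hX.
suff h : adm W X -> forall s, 0 <= s <= 1 -> adm W (Z s).
  move=> /h ha; rewrite -Z0 -Z1; split; first by apply: ha; lra.
  by move=> i; apply: Z_const => //; lra.
elim: W => // o W IH /= [aW ao] s hs; split; first exact: IH.
have [z1 z2 _ _] := Zregb hs.
have [_ oX] := ev_out x1 x2 aW; have [_ oZ] := ev_out z1 z2 (IH aW s hs).
have em i : mni i (ev W X) = mni i (ev W (Z s)).
  by rewrite -Z0; apply: Z_const => //; apply: IH.
move: ao; rewrite /adm1 oX // oZ // em; case: (o.1) => //.
by rewrite {3}/Z XY1 -mulrDl subrK mul1r.
Qed.

End Homotopy.

End MixedWords.

(** * Dominant integral bases as limits of regular ones *)

Section DominantBase.
Variables (R : realType) (J : eqType) (A : J -> J -> int).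
Implicit Types (w v u : seq J) (i j c : J) (s t r d e : R) (p X Y eta : R -> J + J -> R)
  (W : seq (bool * J)).
Hypothesis Adiag : forall i, A i i = 2.
Hypothesis Aoff : forall i j, i <> j -> A i j <= 0.
Hypothesis Azero : forall i j, A i j = 0 <-> A j i = 0.

Local Notation rootR := (@rootR R J A).
Local Notation fop := (@fop R J A).
Local Notation eop := (@eop R J A).
Local Notation Hc i eta := (fun t => eta t (inl i)).
Local Notation folded := (@folded R J A).
Local Notation mni i eta := (mn (fun t => eta t (inl i)) 0 1).
Local Notation ev := (@ev R J A).
Local Notation adm := (@adm R J A).
Local Notation wsh := (@wsh J A).

Definition domb X := [/\ lips X, (forall z, X 0 z = 0),
  (forall i s t, 0 <= s -> s <= t -> t <= 1 -> X s (inl i) <= X t (inl i)) &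
  forall i, X 1 (inl i) \is a Num.int].

(** Tilting a dominant integral base by d, for 0 < d < 1, makes its increments regular and its
    endpoint pairings nonintegral. *)
Definition dlt d X : R -> J + J -> R := fun t z => X t z + d * t.

Lemma dlt_lips d X : lips X -> lips (dlt d X).
Proof. by move=> h z; apply: lipD => //; apply: lipZ; apply: lip_id. Qed.

Lemma dlt_reg d X : 0 < d < 1 -> domb X -> regb (dlt d X).
Proof.
move=> hd [h1 h2 h3 h4]; split; first exact: dlt_lips.
- by move=> z; rewrite /dlt h2 mulr0 addr0.
- move=> s t s0 st t1 i; have := h3 i s t s0 (ltW st) t1; rewrite /dlt.
  have : 0 < d * (t - s) by rewrite mulr_gt0 ?subr_gt0 //; lra.
  lra.
- move=> i; rewrite /dlt mulr1; apply/negP => hi.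
  have {hi} hdi : d \is a Num.int by rewrite -[d](addKr (X 1 (inl i))) rpredD // rpredN.
  by have := int_between (int_num0 R) hdi; lra.
Qed.

Lemma dlt_near d d' X : near `|d - d'| (dlt d X) (dlt d' X) (fun=> 1).
Proof.
move=> t z ht; rewrite /dlt mul1r (_ : _ - _ = (d - d') * t); last by ring.
by rewrite normrM ler_piMr // ger0_norm; lra.
Qed.

Lemma dlt0 X : dlt 0 X = X.
Proof. by apply/funext => t; apply/funext => z; rewrite /dlt mul0r addr0. Qed.

Lemma dlt_mni_near X W : lips X -> exists C : J + J -> R, (forall z, 0 <= C z) /\ forall d d',
  near `|d - d'| (ev W (dlt d X)) (ev W (dlt d' X)) C.
Proof.
move=> lX; have [C hC] := ev_near A W (fun=> 1 : R).
exists (fun z => `|C z|); split=> // d d' t z ht.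
have := hC _ _ _ (normr_ge0 (d - d')) (dlt_lips d lX) (dlt_lips d' lX) (@dlt_near d d' X) t z ht.
by move=> h; apply: (le_trans h); apply: ler_wpM2r => //; apply: ler_norm.
Qed.

Lemma eps_eq (x y C : R) : 0 <= C -> (forall e, 0 < e < 1 -> `|x - y| <= C * e) -> x = y.
Proof.
move=> C0 h; apply/eqP; rewrite -subr_eq0 -normr_eq0 eq_le normr_ge0 andbT.
apply: eps_le => e e0; rewrite add0r.
pose e' := Num.min 2^-1 (e / (C + 1)).
have C1 : 0 < C + 1 by lra.
have he' : 0 < e' < 1.
  rewrite /e' lt_min gt_min divr_gt0 // andbT; apply/andP; split; last by apply/orP; left; lra.
  lra.
apply: (le_trans (h e' he')).
have : e' <= e / (C + 1) by rewrite /e' ge_min lexx orbT.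
rewrite ler_pdivlMr //; nra.
Qed.

(** The minimum is integral, hence constant, for 0 < d < 1, and it is Lipschitz up to d = 0, so its
    value at 0 is the same. *)
Lemma dlt_mni X W i d : domb X -> (forall d, 0 < d < 1 -> adm W (dlt d X)) -> 0 < d < 1 ->
  mni i (ev W (dlt d X)) = mni i (ev W X).
Proof.
move=> hX ha hd; have [lX _ _ _] := hX.
have [C [C0 hC]] := dlt_mni_near W lX.
have nE a b : `|mni i (ev W (dlt a X)) - mni i (ev W (dlt b X))| <= C (inl i) * `|a - b|.
  by apply: mni_near; [exact/ev_lips/dlt_lips | exact/ev_lips/dlt_lips | apply: hC].
apply: (@eps_eq _ _ (C (inl i))) => // e he.
wlog ed : d hd / e <= d => [hw|].
  have [ed|ed] := lerP e d; first exact: hw.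
  rewrite -{2}(dlt0 X); apply: (le_trans (nE _ _)); rewrite subr0 ger0_norm ?ler_wpM2l //; lra.
have -> : mni i (ev W (dlt d X)) = mni i (ev W (dlt e X)).
  apply/esym; apply: (@int_const R (fun d => mni i (ev W (dlt d X))) e d (C (inl i))) => //.
  move=> s hs; have hs' : 0 < s < 1 by lra.
  by have [] := ev_nice Adiag Aoff Azero i (dlt_reg hs' hX) (ha s hs').
rewrite -{2}(dlt0 X); apply: (le_trans (nE _ _)); rewrite subr0 ger0_norm //; lra.
Qed.

(** For f the tilt adds d to the right side of an inequality between integers, which changes nothing
    because d < 1. *)
Lemma dlt_adm X W : domb X -> forall d, 0 < d < 1 -> (adm W X <-> adm W (dlt d X)).
Proof.
move=> hX; have [lX X0 _ X1] := hX; elim: W => // o W IH d hd /=.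
suff h : adm W X -> (adm1 o (ev W X) <-> adm1 o (ev W (dlt d X))).
  by move: (IH d hd); tauto.
move=> aW; have ha d' : 0 < d' < 1 -> adm W (dlt d' X) by move=> /IH <-.
have [_ oX] := ev_out lX X0 aW.
have hr := dlt_reg hd hX; have [r1 r2 _ _] := hr.
have [_ oZ] := ev_out r1 r2 (ha d hd).
have mi := @dlt_mni X W o.2 d hX ha hd.
have [_ _ mint] := ev_nice Adiag Aoff Azero o.2 hr (ha d hd).
rewrite /adm1 -{}mi oX // oZ // /dlt mulr1; case: (o.1) => //.
have := X1 o.2; move: (X 1 (inl o.2)) => x xi; split=> h; first lra.
set m := mn _ _ _ in mint h *.
rewrite leNgt; apply/negP => hlt.
have hi : x + (wsh W (inl o.2))%:~R \is a Num.int by rewrite rpredD // intr_int.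
have hm : m + 1 \is a Num.int by rewrite rpredD ?rpred1 //; exact: mint.
by have := int_between hi hm hlt; lra.
Qed.

Lemma dlt_min X W i d : domb X -> adm W X -> 0 < d < 1 ->
  mni i (ev W (dlt d X)) = mni i (ev W X).
Proof. by move=> hX ha; apply: dlt_mni => // d' hd'; exact: (dlt_adm W hX hd').1. Qed.

Lemma half01 : 0 < (2^-1 : R) < 1. Proof. by apply/andP; split; lra. Qed.

Lemma dom_nice X W i : domb X -> adm W X -> nice (Hc i (ev W X)).
Proof.
move=> hX ha; have [lX _ _ _] := hX.
have hd := half01.
have hn d (hd : 0 < d < 1) := ev_nice Adiag Aoff Azero i (dlt_reg hd hX) ((dlt_adm W hX hd).1 ha).
have le : lip (Hc i (ev W X)) by apply: ev_lips.
split=> //; last by have [_ _] := hn _ hd; rewrite dlt_min.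
have [C [C0 hC]] := dlt_mni_near W lX.
apply: LI_lim => // e e0.
have C1 : 0 < C (inl i) + 1 by have := C0 (inl i); lra.
pose d := Num.min 2^-1 (e / (C (inl i) + 1)).
have hd' : 0 < d < 1.
  rewrite /d lt_min gt_min divr_gt0 // andbT; apply/andP; split; last by apply/orP; left; lra.
  lra.
exists (Hc i (ev W (dlt d X))); have [n1 n2 _] := hn d hd'; split=> // t ht.
have := hC 0 d t (inl i) ht; rewrite dlt0 => h; apply: (le_trans h).
rewrite sub0r normrN ger0_norm; last by lra.
have : d <= e / (C (inl i) + 1) by rewrite /d ge_min lexx orbT.
by rewrite ler_pdivlMr //; have := C0 (inl i); nra.
Qed.

Lemma dom_iso X Y W : domb X -> domb Y -> (forall i, X 1 (inl i) = Y 1 (inl i)) ->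
  adm W X -> adm W Y /\ forall i, mni i (ev W X) = mni i (ev W Y).
Proof.
move=> hX hY XY aX; have ha := (dlt_adm W hX half01).1 aX.
have XY' i : dlt 2^-1 X 1 (inl i) = dlt 2^-1 Y 1 (inl i) by rewrite /dlt XY.
have [aY h] := homotopy Adiag Aoff Azero (dlt_reg half01 hX) (dlt_reg half01 hY) XY' ha.
have {}aY := (dlt_adm W hY half01).2 aY; split=> // i.
by have := h i; rewrite (dlt_min i hX aX half01) (dlt_min i hY aY half01).
Qed.

Lemma dom_out X W : domb X -> adm W X ->
  (forall t, t <= 0 -> ev W X t = X t) /\
  (forall t z, 1 <= t -> ev W X t z = X t z + (wsh W z)%:~R).
Proof. by move=> [h1 h2 _ _]; apply: ev_out. Qed.

Lemma dom_mni0 X i : domb X -> mni i X = 0.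
Proof.
move=> [h1 h2 h3 h4]; apply/eqP; rewrite eq_le; apply/andP; split.
  have h01 : 0 <= (0 : R) <= 1 by rewrite lexx ler01.
  by have := mn_le (H := Hc i X) (h1 (inl i)) h01; rewrite h2.
by apply: mn_ge => // t /andP[t0 t1]; have := h3 i 0 t (lexx 0) t0 t1; rewrite h2.
Qed.

(** Each tilted path is highest with the same minima, hence equals its tilted base; the tilt then
    tends to 0. *)
Lemma dom_highest X W : domb X -> adm W X -> (forall i, 0 <= mni i (ev W X)) -> ev W X = X.
Proof.
move=> hX ha hm; have [lX X0 _ _] := hX.
have key t z : 0 <= t <= 1 -> ev W X t z = X t z.
  move=> ht; have [C [C0 hC]] := dlt_mni_near W lX.
  apply: (@eps_eq _ _ (C z + 1)) => [|e he]; first by have := C0 z; lra.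
  have [r1 r2 r3 r4] := dlt_reg he hX.
  have hf : folded predT (dlt e X) (ev W (dlt e X)).
    by apply: ev_folded => //; [exact: all_predT | exact: (dlt_adm W hX he).1].
  have h0 i : 0 <= mni i (ev W (dlt e X)) by rewrite (dlt_min i hX ha he).
  have he' := @folded_highest R J A Adiag Aoff Azero predT _ r3 r2 _ hf h0 t ht.
  have := hC 0 e t z ht; rewrite dlt0 he' sub0r normrN (ger0_norm (x := e)); last lra.
  rewrite /dlt opprD addrA => h.
  have h2 : `|e * t| <= e by rewrite ger0_norm ?mulr_ge0 ?ler_piMr //; lra.
  have -> : ev W X t z - X t z = (ev W X t z - X t z - e * t) + e * t by ring.
  apply: (le_trans (ler_normD _ _)); rewrite mulrDl; lra.
have [o0 o1] := dom_out hX ha.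
apply/funext => t; have [t0|t0] := lerP t 0; first exact: o0.
apply/funext => z; have [t1|t1] := lerP t 1; first by apply: key; lra.
have := key 1 z; rewrite o1 // => /(_ _) h1; rewrite o1 //; last lra.
by have := h1 _; lra.
Qed.

Definition fw v : seq (bool * J) := [seq (true, i) | i <- v].
Definition ew v : seq (bool * J) := [seq (false, i) | i <- v].

Lemma fopH p i : Hc i (fop i p) = fun t => Hc i p t - 2 * th (Hc i p) t.
Proof. by apply/funext => t; rewrite /fop /rootR /= Adiag mulrC. Qed.

Lemma eopH p i : Hc i (eop i p) = fun t => Hc i p t + 2 * kap (Hc i p) t.
Proof. by apply/funext => t; rewrite /eop /rootR /= Adiag mulrC. Qed.

Lemma ef_id p i : nice (Hc i p) -> p 0 (inl i) = 0 -> mni i p + 1 <= p 1 (inl i) ->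
  eop i (fop i p) = p /\ mni i (fop i p) + 1 <= 0.
Proof.
move=> hn p0 hm; split; last first.
  rewrite fopH (mn_theta hn hm).2 subrK; have [hl _ _] := hn.
  by rewrite -{2}p0; apply: (mn_le (H := Hc i p)) => //; rewrite lexx ler01.
apply/funext => t; apply/funext => z.
by rewrite /eop fopH (kap_theta t hn hm) /fop subrK.
Qed.

Lemma fe_id p i : nice (Hc i p) -> p 0 (inl i) = 0 -> mni i p + 1 <= 0 ->
  fop i (eop i p) = p /\ mni i (eop i p) + 1 <= eop i p 1 (inl i).
Proof.
move=> hn p0 hm0; have hm : mni i p + 1 <= p 0 (inl i) by rewrite p0.
have [hl _ _] := hn; split; last first.
  rewrite eopH (mn_kappa hn hm).2 /eop kap_ge1 // /rootR /= Adiag.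
  have := mn_le (H := Hc i p) (a := 0) (b := 1) (t := 1) hl.
  by rewrite lexx ler01 => /(_ isT); lra.
apply/funext => t; apply/funext => z.
by rewrite /fop eopH (theta_kap t hn hm) /eop addrK.
Qed.

Lemma ev0 W X z : domb X -> adm W X -> ev W X 0 z = 0.
Proof. by move=> hX ha; have [o0 _] := dom_out hX ha; rewrite o0 //; case: hX. Qed.

Lemma ev_ew_fw X W v : domb X -> adm W X -> adm (fw v) (ev W X) ->
  adm (ew (rev v)) (ev (fw v) (ev W X)) /\ ev (ew (rev v)) (ev (fw v) (ev W X)) = ev W X.
Proof.
move=> hX aW; elim: v => // i v IH /= [av ai].
have aV : adm (fw v ++ W) X by apply/adm_cat.
have hn := dom_nice i hX aV; have h0 := ev0 (inl i) hX aV.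
rewrite ev_cat in hn h0; have [e1 e2] := ef_id hn h0 ai.
have [IH1 IH2] := IH av.
rewrite rev_cons -cats1 /ew map_cat; split.
  by apply/adm_cat; split=> //=; rewrite /op /= e1.
by rewrite ev_cat /= [X in ev _ X]e1.
Qed.

Lemma ev_fw_ew X W v : domb X -> adm W X -> adm (ew v) (ev W X) ->
  adm (fw (rev v)) (ev (ew v) (ev W X)) /\ ev (fw (rev v)) (ev (ew v) (ev W X)) = ev W X.
Proof.
move=> hX aW; elim: v => // i v IH /= [av ai].
have aV : adm (ew v ++ W) X by apply/adm_cat.
have hn := dom_nice i hX aV; have h0 := ev0 (inl i) hX aV.
rewrite ev_cat in hn h0; have [e1 e2] := fe_id hn h0 ai.
have [IH1 IH2] := IH av.
rewrite rev_cons -cats1 /fw map_cat; split.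
  by apply/adm_cat; split=> //=; rewrite /op /= e1.
by rewrite ev_cat /= [X in ev _ X]e1.
Qed.

(** Undoing v by e-operators after applying v' returns X. Over Y the same mixed word has the same
    minima, all 0, so it returns Y by [dom_highest]; applying v again gives the equality. *)
Lemma dom_coincide X Y v v' : domb X -> domb Y -> (forall i, X 1 (inl i) = Y 1 (inl i)) ->
  adm (fw v) X -> adm (fw v') X -> ev (fw v) X = ev (fw v') X -> ev (fw v) Y = ev (fw v') Y.
Proof.
move=> hX hY XY av av' e.
have [a1 e1] := @ev_ew_fw X [::] v hX I av.
rewrite [adm _ _]/= e in a1 e1.
have aW : adm (ew (rev v) ++ fw v') X by apply/adm_cat.
have eW : ev (ew (rev v) ++ fw v') X = X by rewrite ev_cat.
have [aY mY] := dom_iso hX hY XY aW.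
have eY : ev (ew (rev v) ++ fw v') Y = Y.
  by apply: dom_highest => // i; rewrite -mY eW dom_mni0.
have [aY1 _] := dom_iso hX hY XY av'.
have /adm_cat[_ aY2] := aY.
have [_ e2] := @ev_fw_ew Y (fw v') (rev v) hY aY1 aY2.
by rewrite ev_cat in eY; rewrite revK eY in e2.
Qed.

Lemma wsh_fw v k : wsh (fw v) (inr k) = - (count_mem k v)%:Z.
Proof.
elim: v => //= i v ->; rewrite /rootv /= PoszD opprD addrC eq_sym.
by case: (i == k).
Qed.

Lemma wsh_ew v k : wsh (ew v) (inr k) = (count_mem k v)%:Z.
Proof. by elim: v => //= i v ->; rewrite /rootv /= PoszD addrC eq_sym; case: (i == k). Qed.

Lemma wsh_cat W1 W2 z : wsh (W1 ++ W2) z = wsh W1 z + wsh W2 z.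
Proof. by elim: W1 => [|o W IH] /=; rewrite ?add0r // IH addrAC. Qed.

Lemma dom_wsh_le X W k : domb X -> adm W X -> wsh W (inr k) <= 0.
Proof.
move=> hX aW; have hr := dlt_reg half01 hX; have [r1 r2 r3 r4] := hr.
have aD := (dlt_adm W hX half01).1 aW.
have hf := ev_folded Adiag Aoff Azero (P := predT) hr (all_predT _) aD.
have := folded_below Adiag Aoff Azero r3 r2 k hf.
by have [_ ->] := ev_out r1 r2 aD; rewrite // gerDl -[0]/((0:int)%:~R) ler_int.
Qed.

(** Keep applying e-operators until all minima vanish; the path is then X, and running the
    e-operators backwards writes the original element with f-operators alone. *)
Lemma dom_to_fw X v u : domb X -> adm (ew u ++ fw v) X ->
  exists2 v', adm (fw v') X & ev (fw v') X = ev (ew u ++ fw v) X.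
Proof.
move=> hX; have [n] := ubnP (size v - size u)%N; elim: n u => // n IH u hn aW.
have [hm|] := pselect (forall i, 0 <= mni i (ev (ew u ++ fw v) X)).
  have := @ev_fw_ew X (fw v) u hX; move/adm_cat: (aW) => [av au] /(_ av au) [a1 e1].
  have e2 := dom_highest hX aW hm; rewrite ev_cat in e2; rewrite e2 in a1 e1.
  by exists [::] => //=; rewrite ev_cat e2.
move=> /existsNP[i /negP]; rewrite -ltNge => hi.
have hn' := dom_nice i hX aW; have [_ _ mint] := hn'.
have hi1 := int_between mint (int_num0 R) hi.
have aW' : adm (ew (i :: u) ++ fw v) X by [].
have [|v' a1 e1] := IH (i :: u) _ aW'.
  (* The measure is a truncated difference, so it decreases only because the e-letters form a
     submultiset of the f-letters, by [dom_wsh_le]. *)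
  suff : (size (i :: u) <= size v)%N by rewrite /= => h; lia.
  have /count_subseqP[s s1 /perm_size ->] : forall x, (count_mem x (i :: u) <= count_mem x v)%N.
    move=> x; have := dom_wsh_le x hX aW'; rewrite wsh_cat wsh_ew wsh_fw.
    by rewrite subr_le0 lez_nat.
  exact: size_subseq.
have [e2 e3] := fe_id hn' (ev0 _ hX aW) hi1.
exists (i :: v'); last by rewrite /= {1}/op /= e1.
by split=> //=; rewrite e1.
Qed.

(** The letters of the two words agree as multisets because the coordinates [inr k] at the endpoint
    count them. *)
Lemma dom_last X v i : domb X -> adm (fw v) X -> mni i (ev (fw v) X) + 1 <= 0 ->
  exists v', [/\ adm (fw (i :: v')) X, ev (fw (i :: v')) X = ev (fw v) X & perm_eq (i :: v') v].
Proof.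
move=> hX av hi.
have [v' a1 e1] := @dom_to_fw X v [:: i] hX (conj av hi).
have [e2 e3] := fe_id (dom_nice i hX av) (ev0 _ hX av) hi.
have a2 : adm (fw (i :: v')) X by split=> //; rewrite e1.
have e4 : ev (fw (i :: v')) X = ev (fw v) X by rewrite /= {1}/op /= e1.
exists v'; split=> //.
have h k : count_mem k (i :: v') = count_mem k v.
  have [_ o1] := dom_out hX a2; have [_ o2] := dom_out hX av.
  have := o1 1 (inr k) (lexx 1); rewrite e4 o2 // => /addrI /eqP.
  by rewrite eqr_int !wsh_fw eqr_opp => /eqP[].
by rewrite /perm_eq; apply/allP => k _; apply/eqP; exact: h.
Qed.

End DominantBase.

(** * Words with a fresh letter *)

Lemma slope_close (R : realType) (x y k n s t : R) : 0 <= s -> 0 <= t ->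
  - k <= x - s * n <= k -> - k <= y - t * n <= k -> `|x * t - y * s| <= k * t + k * s.
Proof.
move=> s0 t0 /andP[x1 x2] /andP[y1 y2].
have -> : x * t - y * s = (x - s * n) * t - (y - t * n) * s by ring.
apply: (le_trans (ler_normB _ _)); rewrite !normrM (ger0_norm t0) (ger0_norm s0).
by apply: lerD; apply: ler_wpM2r => //; rewrite ler_norml; apply/andP.
Qed.

Section FreshLetter.
Variables (R : realType) (J : eqType) (A : J -> J -> int).
Implicit Types (w v u : seq J) (i j c : J) (s t r d e : R) (X Y eta : R -> J + J -> R).
Hypothesis Adiag : forall i, A i i = 2.
Hypothesis Aoff : forall i j, i <> j -> A i j <= 0.
Hypothesis Azero : forall i j, A i j = 0 <-> A j i = 0.

Local Notation act := (@act R J A).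
Local Notation pos := (@pos R J A).
Local Notation ev := (@ev R J A).
Local Notation adm := (@adm R J A).

(** The fundamental weight of c is fixed by w and pairs to 1 with the c-th coroot. *)
Lemma pos_out w c : c \notin w -> pos w c.
Proof.
move=> hc; apply/negPn/negP => hn.
pose v : J + J -> R := fun z => if z is inl k then (k == c)%:R else 0.
have h : act w v = v.
  elim: w hc {hn} => //= i w IH; rewrite inE negb_or => /andP[ic /IH ->].
  by apply/funext => z; rewrite /refl /v eq_sym (negPf ic) mul0r subr0.
have := act_nonpos Adiag Aoff Azero hn (v := v); rewrite h /v eqxx => hh.
by have := hh (fun j => ler0n _ _); rewrite ler10.
Qed.

Section Straight.
Variables (P : pred J) (X eta : R -> J + J -> R) (c : J).
Hypothesis Xreg : forall s t, 0 <= s -> s < t -> t <= 1 -> reg (fun z => X t z - X s z).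
Hypothesis Pc : ~~ P c.

Lemma out_pos w : all P w -> pos w c.
Proof. by move=> h; apply: pos_out; apply/negP => /(allP h); apply/negP. Qed.

Lemma incr_mono w s t r r' : 0 <= s -> t <= 1 -> all P w ->
  (forall r, s <= r <= t -> incr A X eta s w r) -> s <= r -> r <= r' -> r' <= t ->
  eta r (inl c) <= eta r' (inl c).
Proof.
move=> s0 t1 hw hi sr rr' r't; have [->|ne] := eqVneq r r'; first by rewrite lexx.
have lt : r < r' by rewrite lt_neqAle ne.
apply: ltW; apply: (incr_pos Adiag Aoff Azero Xreg _ lt _ _ (out_pos hw)); try lra.
by apply: (@incr_from _ _ _ _ _ s); apply: hi; lra.
Qed.

Lemma ls_mono s w r r' : ls A P X eta s w -> s <= r -> r <= r' -> r' <= 1 ->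
  eta r (inl c) <= eta r' (inl c).
Proof.
move=> h; elim: h r r' => {s w} [s w s0 s1 hw _ hi|s t w w' s0 st t1 hw hi _ _ IH] r r' sr rr' r1.
  exact: (@incr_mono w s 1).
have [h1|h1] := lerP r' t; first by apply: (@incr_mono w s t) => //; lra.
have [h2|h2] := lerP t r; first exact: IH.
apply: (@le_trans _ _ (eta t (inl c))); first by apply: (@incr_mono w s t) => //; lra.
by apply: IH; lra.
Qed.

Variable dm : J -> nat.
Hypothesis dm_gt0 : forall i, (0 < dm i)%N.
Hypothesis dmA : forall i j, (dm i)%:Z * A i j = (dm j)%:Z * A j i.
Variable D : J + J -> R.
Hypothesis XD : forall t z, X t z = t * D z.
Hypothesis Dreg : reg D.

(* On a segment in direction [w] one has [eta r = act w (r D)] modulo integral vectors,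
   and the slopes of [eta] along [c] decrease; so the line carrying the segment meets 0 at a
   nonnegative integer, which must be 0 as long as the coordinate stays below 1. *)
Lemma ls_linear s w t r : ls A P X eta s w ->
  isint (fun z => eta s z - act w (fun z => s * D z) z) ->
  eta s (inl c) = s * act w D (inl c) ->
  s <= r -> r <= t -> t <= 1 -> eta t (inl c) < 1 -> eta r (inl c) = r * act w D (inl c).
Proof.
have lin w0 s0 r0 : incr A X eta s0 w0 r0 ->
    forall z, eta r0 z = eta s0 z + (r0 - s0) * act w0 D z.
  move=> h z; have := h z; rewrite (_ : (fun z => _) = fun z => (r0 - s0) * D z); last first.
    by apply/funext => z'; rewrite !XD mulrBl.
  by rewrite actZ; lra.
move=> h; elim: h t r => {s w} [s w s0 s1 hw _ hi|s b w w' s0 sb b1 hw hi hc hls IH] t r int e0 sr rt t1 ht.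
  by rewrite (lin _ _ _ (hi r _)) ?e0; [ring | lra].
have eb : eta b (inl c) = b * act w D (inl c).
  by rewrite (lin _ _ _ (hi b _)) ?e0; [ring | lra].
have [h1|h1] := lerP r b; first by rewrite (lin _ _ _ (hi r _)) ?e0; [ring | lra].
have intb : isint (fun z => eta b z - act w (fun z => b * D z) z).
  move=> z; rewrite (lin _ _ _ (hi b _)) ?actZ; last by lra.
  by have := int z; rewrite actZ mulrBl => h; rewrite (_ : _ - _ = eta s z - s * act w D z) //; ring.
have intb' := chain_mod Adiag intb hc.
have := chain_concave Adiag Aoff Azero dm_gt0 dmA Pc Dreg hc.
have hp : 0 < act w' D (inl c) by rewrite -(posP Adiag Aoff Azero _ _ Dreg) out_pos // (ls_letters hls).
rewrite le_eqVlt => /orP[/eqP e|lt].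
  by rewrite -e; apply: (IH t r) => //; [rewrite eb e | lra].
exfalso; have := intb' (inl c); rewrite actZ eb => ni.
have b0 : 0 < b by lra.
have : 0 < b * act w D (inl c) - b * act w' D (inl c) by rewrite -mulrBr mulr_gt0 ?subr_gt0.
move=> /(int_between (int_num0 R) ni).
have : 0 < b * act w' D (inl c) by apply: mulr_gt0.
have : eta b (inl c) <= eta t (inl c) by apply: (ls_mono hls) => //; lra.
rewrite eb; lra.
Qed.
End Straight.

Lemma dom_mono X v c s t : domb X -> c \notin v -> adm (fw v) X ->
  0 <= s -> s <= t -> t <= 1 -> ev (fw v) X s (inl c) <= ev (fw v) X t (inl c).
Proof.
move=> hX cv av s0 st t1; have [lX _ _ _] := hX.
have [C [C0 hC]] := dlt_mni_near A (fw v) lX.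
apply: eps_le => e e0.
have C1 : 0 < 2 * C (inl c) + 1 by have := C0 (inl c); lra.
pose d := Num.min 2^-1 (e / (2 * C (inl c) + 1)).
have hd : 0 < d < 1.
  rewrite /d lt_min gt_min divr_gt0 // andbT; apply/andP; split; last by apply/orP; left; lra.
  lra.
have hr := dlt_reg hd hX; have [r1 r2 r3 r4] := hr.
have aD := (dlt_adm Adiag Aoff Azero (fw v) hX hd).1 av.
have hP : all (fun o : bool * J => predC1 c o.2) (fw v).
  by apply/allP => o /mapP[i iv ->] /=; apply: contraNneq cv => <-.
have [_ _ [w hw]] := ev_folded Adiag Aoff Azero hr hP aD.
have nc : ~~ predC1 c c by rewrite /= eqxx.
have h := ls_mono r3 nc hw s0 st t1.
have ht0 : 0 <= t <= 1 by lra.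
have hs0 : 0 <= s <= 1 by lra.
have := hC 0 d s (inl c) hs0; have := hC 0 d t (inl c) ht0.
rewrite dlt0 sub0r normrN (ger0_norm (x := d)); last by lra.
have : d <= e / (2 * C (inl c) + 1) by rewrite /d ge_min lexx orbT.
rewrite ler_pdivlMr // => hde; rewrite !ler_norml => /andP[h1 _] /andP[_ h2].
move: h h1 h2 hde; move: (ev _ (dlt _ _) s _) (ev _ (dlt _ _) t _) => x y h h1 h2 hde.
have {}hde : 2 * (C (inl c) * d) + d <= e.
  by rewrite (_ : _ + d = d * (2 * C (inl c) + 1)) //; ring.
have d0 : 0 <= d by lra.
move: h h1 h2 hde d0; move: (C (inl c) * d) => z; clear; lra.
Qed.

Definition line (nu : J + J -> R) : R -> J + J -> R := fun t z => t * nu z.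

Lemma line_dom nu : (forall i, 0 <= nu (inl i)) -> (forall i, nu (inl i) \is a Num.int) ->
  domb (line nu).
Proof.
move=> h0 hi; split.
- by move=> z; have := lipZ (nu z) (lip_id R); under eq_fun do rewrite mulrC.
- by move=> z; rewrite /line mul0r.
- by move=> i s t s0 st t1; rewrite /line ler_wpM2r.
- by move=> i; rewrite /line mul1r.
Qed.

Variable dm : J -> nat.
Hypothesis dm_gt0 : forall i, (0 < dm i)%N.
Hypothesis dmA : forall i j, (dm i)%:Z * A i j = (dm j)%:Z * A j i.

(** Proportionality is stated without a slope because the slope of the tilted path may vary with the
    tilt; only the relation between two values passes to the limit. *)
Lemma line_linear nu v c s t : (forall i, 0 <= nu (inl i)) ->
  (forall i, nu (inl i) \is a Num.int) -> c \notin v -> adm (fw v) (line nu) ->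
  0 <= s -> s <= t -> t <= 1 -> ev (fw v) (line nu) t (inl c) < 1 ->
  ev (fw v) (line nu) s (inl c) * t = ev (fw v) (line nu) t (inl c) * s.
Proof.
move=> h0 hi cv av s0 st t1 lt1; have hX := line_dom h0 hi.
have [lX _ _ _] := hX.
have [C [C0 hC]] := dlt_mni_near A (fw v) lX.
set H := ev (fw v) (line nu) in lt1 hC *.
(* A bound on the tilt that keeps the tilted coordinate below 1 at time t, as [ls_linear]
   requires. *)
pose k := Num.min 2^-1 ((1 - H t (inl c)) / (C (inl c) + 1)).
have C1 : 0 < C (inl c) + 1 by have := C0 (inl c); lra.
have hk : 0 < k < 1.
  rewrite /k lt_min gt_min divr_gt0 // ?subr_gt0 // andbT.
  apply/andP; split; last by apply/orP; left; lra.
  lra.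
have hk' : k * (C (inl c) + 1) <= 1 - H t (inl c).
  by rewrite -ler_pdivlMr // /k ge_min lexx orbT.
apply: (@eps_eq _ _ _ (C (inl c) * k * (t + s))) => [|e he].
  by rewrite !mulr_ge0 ?C0 //; lra.
pose d := k * e.
have d0 : 0 < d by rewrite /d mulr_gt0 //; lra.
have dk : d < k by rewrite /d gtr_pMr; lra.
have hd : 0 < d < 1 by lra.
have hr := dlt_reg hd hX; have [r1 r2 r3 r4] := hr.
have aD := (dlt_adm Adiag Aoff Azero (fw v) hX hd).1 av.
have hP : all (fun o : bool * J => predC1 c o.2) (fw v).
  by apply/allP => o /mapP[i iv ->] /=; apply: contraNneq cv => <-.
have [e0 _ [w hw]] := ev_folded Adiag Aoff Azero hr hP aD.
have nc : ~~ predC1 c c by rewrite /= eqxx.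
have ht0 : 0 <= t <= 1 by lra.
have hs0 : 0 <= s <= 1 by lra.
have := hC 0 d s (inl c) hs0; have := hC 0 d t (inl c) ht0.
rewrite dlt0 -/H sub0r normrN (ger0_norm (x := d)); last by lra.
rewrite !ler_norml => /andP[t1' t2'] /andP[s1' s2'].
set Hd := ev (fw v) _ in e0 hw t1' t2' s1' s2'.
have XD t' z : dlt d (line nu) t' z = t' * (nu z + d) by rewrite /dlt /line; ring.
have Dreg : reg (fun z => nu z + d) by move=> i; have := h0 i; lra.
have L0 := @ls_linear _ _ Hd c r3 nc dm dm_gt0 dmA _ XD Dreg 0 w.
have lt1d : Hd t (inl c) < 1.
  have : d * C (inl c) <= k * C (inl c) by apply: ler_wpM2r => //; lra.
  have k0 : 0 < k by lra.
  move: t1' hk' k0; rewrite mulrDr mulr1 (mulrC _ d).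
  by move: (Hd t _) (H t _) (k * C _) (d * C _) => x y z z'; clear; lra.
have L r : 0 <= r -> r <= t -> Hd r (inl c) = r * act w (fun z => nu z + d) (inl c).
  move=> r0 rt; apply: (L0 t r) => //.
    by move=> z; rewrite e0 actZ mul0r subr0 rpred0.
  by rewrite e0 mul0r.
have Lt := L t _ _; have Ls := L s s0 st; rewrite Lt ?lexx // in t1' t2'; last lra.
rewrite Ls in s1' s2'; move: (act _ _ _) t1' t2' s1' s2' => n t1' t2' s1' s2'.
have -> : C (inl c) * k * (t + s) * e = (C (inl c) * d) * t + (C (inl c) * d) * s by rewrite /d; ring.
by rewrite -ler_norml; apply: (slope_close (n := n)); rewrite ?(le_trans s0 st) //; apply/andP.
Qed.

(* Hence the first descent of a fresh letter from a straight path is governed by one slope. *)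
Lemma line_theta nu v c : (forall i, 0 <= nu (inl i)) ->
  (forall i, nu (inl i) \is a Num.int) -> c \notin v -> adm (fw v) (line nu) ->
  exists2 n : R, 0 <= n & forall t, 0 <= t <= 1 ->
    th (fun t => ev (fw v) (line nu) t (inl c)) t = Num.min 1 (n * t).
Proof.
move=> h0 hi cv av; have hX := line_dom h0 hi; have [lX _ _ _] := hX.
have lH : lip (fun t => ev (fw v) (line nu) t (inl c)) by apply: ev_lips.
have H0 : ev (fw v) (line nu) 0 (inl c) = 0 by apply: ev0.
have Hm := @dom_mono (line nu) v c _ _ hX cv av.
have Hl := @line_linear nu v c _ _ h0 hi cv av.
set H := fun t => ev (fw v) (line nu) t (inl c) in lH *.
change (forall s t, 0 <= s -> s <= t -> t <= 1 -> H s <= H t) in Hm.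
change (forall s t, 0 <= s -> s <= t -> t <= 1 -> H t < 1 -> H s * t = H t * s) in Hl.
change (H 0 = 0) in H0.
have Hthe t : 0 <= t <= 1 -> th H t = Num.min 1 (H t).
  move=> ht; rewrite /th clamp_id //.
  have mnt a : 0 <= a <= 1 -> mn H a 1 = H a.
    move=> ha; apply/eqP; rewrite eq_le; apply/andP; split.
      by apply: mn_le => //; lra.
    by apply: mn_ge => [|b hb]; [lra | apply: Hm; lra].
  by rewrite !mnt ?H0 ?subr0 // lexx ler01.
have [K K0 hK] := lH.
(* A positive time before which the Lipschitz bound keeps H below 1, so that [H b / b] is the
   slope. *)
pose b := (K + 1)^-1.
have K1 : 0 < K + 1 by lra.
have b0 : 0 < b by rewrite invr_gt0.
have b1 : b <= 1 by rewrite /b invf_le1 //; lra.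
have hb : H b < 1.
  have := hK b 0; rewrite H0 !subr0 ger0_norm; last by rewrite -H0; apply: Hm; lra.
  rewrite ger0_norm; last by lra.
  have : (K + 1) * b = 1 by rewrite /b mulfV // gt_eqF.
  lra.
pose n := H b / b.
have Hb0 : 0 <= H b by rewrite -H0; apply: Hm; lra.
have lin t : 0 <= t <= 1 -> H t < 1 -> H t = n * t.
  move=> /andP[t0 t1] ht; rewrite /n mulrAC; apply: (canRL (mulfK _)); first by rewrite gt_eqF.
  have [bt|tb] := lerP b t; first by rewrite (Hl b t) // ltW.
  by rewrite (Hl t b) // ltW.
exists n => [|t ht]; first by rewrite /n divr_ge0 // ltW.
rewrite Hthe //; have [h1|] := boolP (H t < 1); first by rewrite (lin t ht h1).
rewrite -leNgt => h1; rewrite [LHS]min_l //; apply/esym/min_l; rewrite leNgt; apply/negP => nt.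
have n0 : 0 <= n by rewrite /n divr_ge0 // ltW.
have n0t : 0 <= n * t by apply: mulr_ge0 => //; lra.
(* H takes this value, strictly between n t and 1, at some q <= t; linearity below 1 would make it n
   q <= n t. *)
pose v0 := (1 + n * t) / 2.
have v1 : v0 < 1 by rewrite /v0; lra.
have v2 : n * t < v0 by rewrite /v0; lra.
have [||| q [hq Hq _]] := @first_ge _ H 0 t v0 lH; try by rewrite ?H0; lra.
have := lin q _; rewrite Hq => hlin.
have : v0 = n * q by apply: hlin => //; lra.
have : n * q <= n * t by apply: ler_wpM2l => //; lra.
lra.
Qed.
End FreshLetter.

(** * Crystals and tensor products *)

Section Crystals.
Variables (J : eqType) (A : J -> J -> int).
Implicit Types (i j k : J) (w u v : seq J) (n m : nat).
Hypothesis Adiag : forall i, A i i = 2.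
Hypothesis Aoff : forall i j, i <> j -> A i j <= 0.

Definition rsum w k : int := \sum_(j <- w) A k j.

Lemma rsum_cons j w k : rsum (j :: w) k = A k j + rsum w k.
Proof. by rewrite /rsum big_cons. Qed.

Lemma rsum_nseq n i k : rsum (nseq n i) k = n%:Z * A k i.
Proof. by rewrite /rsum big_nseq iter_addr addr0 -mulr_natl natz. Qed.

(** [fc] is total but constrained only where [eps + wt] is positive. The e-operators are left
    implicit as the inverses of the f-operators there. *)
Record crystal := Crystal {
  car :> Type;
  wt : car -> J -> int;
  eps : J -> car -> int;
  fc : J -> car -> car;
  eps_ge0 : forall j x, 0 <= eps j x;
  phi_ge0 : forall j x, 0 <= eps j x + wt x j;
  wt_f : forall j x, 0 < eps j x + wt x j -> forall k, wt (fc j x) k = wt x k - A k j;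
  eps_f : forall j x, 0 < eps j x + wt x j -> eps j (fc j x) = eps j x + 1;
  f_inj : forall j x y, 0 < eps j x + wt x j -> 0 < eps j y + wt y j ->
    fc j x = fc j y -> x = y }.

Section Words.
Variable X : crystal.
Implicit Type x : X.

Definition phi j x := eps j x + wt x j.

Definition F w x : X := foldr (@fc X) x w.

Fixpoint dw w x : Prop := if w is j :: w' then dw w' x /\ 0 < phi j (F w' x) else True.

Lemma F_cat u v x : F (u ++ v) x = F u (F v x). Proof. by rewrite /F foldr_cat. Qed.

Lemma dw_cat u v x : dw (u ++ v) x <-> dw v x /\ dw u (F v x).
Proof. by elim: u => [|j u IH] /=; rewrite ?F_cat; tauto. Qed.

Lemma wt_F w x k : dw w x -> wt (F w x) k = wt x k - rsum w k.
Proof.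
elim: w => [|j w IH] /=; first by rewrite /rsum big_nil subr0.
by move=> [/IH e h]; rewrite wt_f // e rsum_cons; lia.
Qed.

Lemma A_le2 i j : A i j <= 2.
Proof. by have [->|/eqP/Aoff] := eqVneq i j; rewrite ?Adiag //; lia. Qed.

Lemma wt_F_ge w x k : dw w x -> wt x k - 2 * (size w)%:Z <= wt (F w x) k.
Proof.
elim: w => [|j w IH] /=; first by lia.
by move=> [/IH h hp]; rewrite wt_f //; have := A_le2 k j; lia.
Qed.

Lemma eps_nseq x i n : dw (nseq n i) x -> eps i (F (nseq n i) x) = eps i x + n%:Z.
Proof.
elim: n => [|n IH] /=; first by lia.
by move=> [/IH e h]; rewrite eps_f // e; lia.
Qed.

End Words.

Section Similar.
Variables X Y : crystal.
Implicit Types (x : X) (y : Y).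

(** For words of length at most n, x generates what y generates: the same [eps] and the same
    coincidences among words defined at x. The cutoff n allows auxiliary weights chosen in terms of
    n. *)
Definition sim n x y := forall w w', (size w <= n)%N -> (size w' <= n)%N ->
  dw w x -> dw w' x ->
  [/\ dw w y, forall j, eps j (F w x) = eps j (F w y) & F w x = F w' x <-> F w y = F w' y].

Lemma sim_F n u x y : sim (n + size u) x y -> dw u x -> sim n (F u x) (F u y).
Proof.
move=> h du w w' hw hw' dx dx'; rewrite -!F_cat.
have [||||h1 h2 h3] := h (w ++ u) (w' ++ u); rewrite ?size_cat ?leq_add2r //; try exact/dw_cat.
by split=> //; have /dw_cat[] := h1.
Qed.

Lemma sim_dw n x y w : sim n x y -> wt x =1 wt y -> (size w <= n)%N -> dw w y -> dw w x.
Proof.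
move=> h e; elim: w => //= j w IH hw [dy hp].
have dx := IH (ltnW hw) dy; split=> //.
have [_ he _] := h w w (ltnW hw) (ltnW hw) dx dx.
by move: hp; rewrite /phi he !wt_F // e.
Qed.

Lemma sim_embed (g : X -> Y) : injective g -> (forall x, wt (g x) =1 wt x) ->
  (forall j x, eps j (g x) = eps j x) ->
  (forall j x, 0 < phi j x -> fc j (g x) = g (fc j x)) -> forall n x, sim n x (g x).
Proof.
move=> gi gw ge gf n x.
have h w : dw w x -> dw w (g x) /\ F w (g x) = g (F w x).
  elim: w => //= j w IH [/IH[d1 e1] hp]; rewrite e1; split; last exact: gf.
  by split=> //; rewrite /phi ge gw.
move=> w w' _ _ /h[d1 e1] /h[d2 e2]; rewrite e1 e2; split=> //.
by split=> [->|/gi].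
Qed.
End Similar.

Lemma sim_trans (X Y Z : crystal) n (x : X) (y : Y) (z : Z) :
  sim n x y -> sim n y z -> sim n x z.
Proof.
move=> h1 h2 w w' hw hw' d d'.
have [d1 e1 c1] := h1 w w' hw hw' d d'; have [d1' _ _] := h1 w' w' hw' hw' d' d'.
have [d2 e2 c2] := h2 w w' hw hw' d1 d1'; split=> // [j|]; first by rewrite e1.
exact: iff_trans c1 c2.
Qed.

Lemma sim_sym (X Y : crystal) n (x : X) (y : Y) : sim n x y -> wt x =1 wt y -> sim n y x.
Proof.
move=> h e w w' hw hw' d d'.
have dx := sim_dw h e hw d; have dx' := sim_dw h e hw' d'.
have [_ e1 c1] := h w w' hw hw' dx dx'; by split=> //; apply: iff_sym.
Qed.

Section Tensor.
Variables X Y : crystal.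
Implicit Types (b : X * Y).

Definition teps j b : int :=
  if eps j b.2 < phi j b.1 then eps j b.1 else eps j b.2 - wt b.1 j.
Definition twt b j : int := wt b.1 j + wt b.2 j.
(** The rule dictated by concatenation: the left factor moves exactly when the last minimum of the
    j-th pairing lies in the first half. *)
Definition tf j b : X * Y :=
  if eps j b.2 < phi j b.1 then (fc j b.1, b.2) else (b.1, fc j b.2).

Local Notation lr j b := (ltrP (eps j b.2) (phi j b.1)).

Lemma tensor_eps_ge0 j b : 0 <= teps j b.
Proof.
rewrite /teps; have := eps_ge0 j b.1; have := eps_ge0 j b.2.
by case: (lr j b); rewrite /phi; lia.
Qed.

Lemma tensor_phi_ge0 j b : 0 <= teps j b + twt b j.
Proof.
rewrite /teps /twt; have := eps_ge0 j b.2; have := phi_ge0 j b.1; have := phi_ge0 j b.2.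
by case: (lr j b); rewrite /phi; lia.
Qed.

Lemma tensor_wt_f j b : 0 < teps j b + twt b j -> forall k, twt (tf j b) k = twt b k - A k j.
Proof.
move=> + k; rewrite /teps /twt /tf; have := eps_ge0 j b.2.
by case: (lr j b) => /= h h0 hp; rewrite wt_f; move: h; rewrite /phi; lia.
Qed.

Lemma tensor_eps_f j b : 0 < teps j b + twt b j -> teps j (tf j b) = teps j b + 1.
Proof.
rewrite /teps /twt /tf; have := eps_ge0 j b.2.
case: (lr j b); rewrite /phi /= => h h0 hp.
  by rewrite eps_f ?wt_f ?Adiag; try lia; case: ifP; lia.
by rewrite eps_f; try lia; case: ifP; lia.
Qed.

Lemma tensor_f_inj j b b' : 0 < teps j b + twt b j -> 0 < teps j b' + twt b' j ->
  tf j b = tf j b' -> b = b'.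
Proof.
case: b b' => [x y] [x' y']; rewrite /teps /twt /tf.
have e1 := eps_ge0 j y; have e2 := eps_ge0 j y'.
case: (lr j (x, y)) => h; case: (lr j (x', y')) => h'; move: h h'; rewrite /phi /= => h h' p1 p2 [].
- by move=> e ->; rewrite (f_inj _ _ e) //; lia.
- move=> e e'; exfalso.
  have h1 := eps_f (j := j) (x := x); have h2 := eps_f (j := j) (x := y').
  have h3 := wt_f (j := j) (x := x); rewrite e in h1 h3; rewrite -e' in h2.
  have q1 : 0 < eps j x + wt x j by lia.
  have q2 : 0 < eps j y' + wt y' j by lia.
  by have := h1 q1; have := h2 q2; have := h3 q1 j; rewrite Adiag; lia.
- move=> e e'; exfalso.
  have h1 := eps_f (j := j) (x := x'); have h2 := eps_f (j := j) (x := y).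
  have h3 := wt_f (j := j) (x := x'); rewrite -e in h1 h3; rewrite e' in h2.
  have q1 : 0 < eps j x' + wt x' j by lia.
  have q2 : 0 < eps j y + wt y j by lia.
  by have := h1 q1; have := h2 q2; have := h3 q1 j; rewrite Adiag; lia.
- by move=> -> e; rewrite (f_inj _ _ e) //; lia.
Qed.

Definition tensor := @Crystal (X * Y)%type twt teps tf tensor_eps_ge0 tensor_phi_ge0
  tensor_wt_f tensor_eps_f tensor_f_inj.

End Tensor.

(** A letter defined on the left has positive [phi] there, exceeding the vanishing [eps] of z, so it
    never reaches the tail. *)
Lemma tail_F (X Y : crystal) (x : X) (z : Y) w : (forall j, eps j z = 0) -> dw w x ->
  dw w ((x, z) : tensor X Y) /\ F w ((x, z) : tensor X Y) = (F w x, z).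
Proof.
move=> hz; elim: w => //= j w IH [/IH[d e] hp].
have e' : tf j (F w x, z) = (fc j (F w x), z) by rewrite /tf /= hz hp.
rewrite e e'; split=> //; split=> //.
rewrite /phi /= /teps /twt /= hz hp; move: hp; rewrite /phi.
have := phi_ge0 j z; rewrite hz; lia.
Qed.

Lemma sim_tail (X Y : crystal) n (x : X) (z : Y) : (forall j, eps j z = 0) ->
  sim n x ((x, z) : tensor X Y).
Proof.
move=> hz w w' _ _ /[dup] dx /(tail_F hz)[d1 e1] /(tail_F hz)[d2 e2]; rewrite e1 e2; split=> //.
  move=> j; rewrite /= /teps /= hz; case: ltrP => //; rewrite /phi.
  by have := phi_ge0 j (F w x); lia.
by split=> [->|[]].
Qed.

Lemma sim_assoc (X Y Z : crystal) n (x : X) (y : Y) (z : Z) :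
  sim n (((x, y), z) : tensor (tensor X Y) Z) ((x, (y, z)) : tensor X (tensor Y Z)) /\
  sim n ((x, (y, z)) : tensor X (tensor Y Z)) (((x, y), z) : tensor (tensor X Y) Z).
Proof.
pose g (b : tensor (tensor X Y) Z) : tensor X (tensor Y Z) := (b.1.1, (b.1.2, b.2)).
suff h : sim n (((x, y), z) : tensor (tensor X Y) Z) (g ((x, y), z)).
  split=> //; apply: sim_sym h _ => j; rewrite /= /twt /= /twt /=; lia.
apply: sim_embed => {x y z} [[[x y] z] [[x' y'] z'] [] -> -> -> //|[[x y] z] j|j [[x y] z]|j [[x y] z]].
- by rewrite /= /twt /= /twt /=; lia.
- rewrite /= /teps /phi /= /teps /twt /phi /=.
  case: (ltrP (eps j y) (eps j x + wt x j)) => h1;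
    case: (ltrP (eps j z) (eps j y + wt y j)) => h2; do 2 ?[case: ifP => ?]; lia.
- rewrite /phi /= /tf /g /phi /= /teps /tf /twt /phi /= => _.
  case: (ltrP (eps j y) (eps j x + wt x j)) => h1;
    case: (ltrP (eps j z) (eps j y + wt y j)) => h2; do 2 ?[case: ifP => //= ?]; lia.
Qed.

(** A word on a tensor product splits into words on the factors. Equal weights are required because
    the rule reads [phi] of the left factor. *)
Lemma sim_left (X Y Z : crystal) n (x : X) (y : Y) (z : Z) : wt x =1 wt y -> sim n x y ->
  sim n ((x, z) : tensor X Z) ((y, z) : tensor Y Z).
Proof.
move=> ew h.
have key w : (size w <= n)%N -> dw w ((x, z) : tensor X Z) -> exists w1 w2,
    [/\ (size w1 <= size w)%N, dw w1 x, dw w ((y, z) : tensor Y Z),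
      F w ((x, z) : tensor X Z) = (F w1 x, F w2 z) &
      F w ((y, z) : tensor Y Z) = (F w1 y, F w2 z)].
  elim: w => [|j w IH] hw; first by exists [::], [::].
  move=> /= [/(IH (ltnW hw)) [w1 [w2 [s1 d1 dy e1 e2]]]].
  rewrite e1 e2 => hp.
  have s1' : (size w1 <= n)%N by apply: leq_trans s1 (ltnW hw).
  have [dy1 he _] := h w1 w1 s1' s1' d1 d1.
  have eph : phi j (F w1 x) = phi j (F w1 y) by rewrite /phi he !wt_F // ew.
  have hp' : 0 < @phi (tensor Y Z) j (F w1 y, F w2 z).
    move: hp; rewrite /phi /= /teps /twt /= eph he.
    by have -> : wt (F w1 x) j = wt (F w1 y) j by rewrite !wt_F // ew.
  rewrite /= /tf /= eph; case: ifP => hc; last first.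
    by exists w1, (j :: w2); split=> //; apply: leqW.
  exists (j :: w1), w2; split=> //=; split=> //; rewrite eph.
  by apply: le_lt_trans hc; apply: eps_ge0.
move=> w w' hw hw' /(key _ hw)[w1 [w2 [s1 d1 dy e1 e2]]] /(key _ hw')[v1 [v2 [t1 d1' dy' e1' e2']]].
have [dy1 he hc] := h w1 v1 (leq_trans s1 hw) (leq_trans t1 hw') d1 d1'.
rewrite e1 e2 e1' e2'; split=> // [j|].
  rewrite /= /teps /= he /phi he.
  by have -> : wt (F w1 x) j = wt (F w1 y) j by rewrite !wt_F // ew.
by split=> -[] /hc -> ->.
Qed.

Lemma sim_right (X Y Z : crystal) n (c : X) (y : Y) (z : Z) : sim n y z ->
  sim n ((c, y) : tensor X Y) ((c, z) : tensor X Z).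
Proof.
move=> h.
have key w : (size w <= n)%N -> dw w ((c, y) : tensor X Y) -> exists w1 w2,
    [/\ (size w2 <= size w)%N, dw w2 y, dw w ((c, z) : tensor X Z),
      F w ((c, y) : tensor X Y) = (F w1 c, F w2 y) &
      F w ((c, z) : tensor X Z) = (F w1 c, F w2 z)].
  elim: w => [|j w IH] hw; first by exists [::], [::].
  move=> /= [/(IH (ltnW hw)) [w1 [w2 [s1 d1 dy e1 e2]]]].
  rewrite e1 e2 => hp.
  have s1' : (size w2 <= n)%N by apply: leq_trans s1 (ltnW hw).
  have [dy1 he _] := h w2 w2 s1' s1' d1 d1.
  move: hp; rewrite /phi /= /teps /twt /tf /= -he; case: ifP => hc hp.
    exists (j :: w1), w2; split=> //=; first exact: leqW.
    split=> //; rewrite /phi.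
    have := phi_ge0 j (F w2 z); rewrite -he; move: hc; rewrite /phi; lia.
  have dj : dw (j :: w2) y by split=> //; move: hp; rewrite /phi; lia.
  have [[_ hz] _ _] := h (j :: w2) (j :: w2) (leq_ltn_trans s1 hw) (leq_ltn_trans s1 hw) dj dj.
  exists w1, (j :: w2); split=> //=; split=> //.
  rewrite /phi.
  by move: hz; rewrite /phi -he; lia.
move=> w w' hw hw' /(key _ hw)[w1 [w2 [s1 d1 dy e1 e2]]] /(key _ hw')[v1 [v2 [t1 d1' dy' e1' e2']]].
have [dy1 he hc] := h w2 v2 (leq_trans s1 hw) (leq_trans t1 hw') d1 d1'.
rewrite e1 e2 e1' e2'; split=> // [j|]; first by rewrite /= /teps /= he.
by split=> -[] -> /hc ->.
Qed.

End Crystals.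

(** * Highest elements in tensor products *)

Section HighestWeight.
Variables (J : eqType) (A : J -> J -> int).
Implicit Types (i j : J) (w u v : seq J) (k n m : nat) (nu xi tau zeta lam mu : J -> nat).
Hypothesis Adiag : forall i, A i i = 2.
Hypothesis Aoff : forall i j, i <> j -> A i j <= 0.

Local Notation tensor := (tensor Adiag).
Local Notation crystal := (crystal A).

(** An axiomatic family of highest weight crystals. [b_sum] states that the product of two highest
    elements is again highest; [b_last] states that an element with positive [eps j] arises by a
    last letter j. *)
Variables (B : (J -> nat) -> crystal) (b : forall nu, B nu).
Hypothesis wt_b : forall nu j, wt (b nu) j = (nu j)%:Z.
Hypothesis eps_b : forall nu j, eps j (b nu) = 0.
Hypothesis b_sum : forall n nu xi,
  sim n ((b nu, b xi) : tensor (B nu) (B xi)) (b (fun j => nu j + xi j)%N).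
Hypothesis b_last : forall nu w j, dw w (b nu) -> 0 < eps j (F w (b nu)) ->
  exists w', [/\ dw (j :: w') (b nu), F (j :: w') (b nu) = F w (b nu) & perm_eq (j :: w') w].

Arguments b_sum : clear implicits.

Lemma b_sum' n nu xi :
  sim n (b (fun j => nu j + xi j)%N) ((b nu, b xi) : tensor (B nu) (B xi)).
Proof. by apply: (sim_sym (b_sum n nu xi)) => j; rewrite /= /twt !wt_b PoszD. Qed.
Arguments b_sum' : clear implicits.

(** An element of weight nu that behaves like a larger highest element behaves like [b nu]: the
    [eps] agree, and definedness is decided by [eps] together with the true weight. *)
Lemma sim_dominant (X : crystal) n (x : X) nu mu : (forall j, nu j <= mu j)%N ->
  (forall j, wt x j = (nu j)%:Z) -> sim n x (b mu) -> sim n x (b nu).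
Proof.
move=> le wx h.
have e : mu = (fun j => nu j + (mu j - nu j))%N by apply/funext => j; have := le j; lia.
have hn : sim n (b nu) (b mu).
  rewrite e; apply: (sim_trans _ (b_sum n _ _)); apply: sim_tail.
  exact: eps_b.
have key w : (size w <= n)%N -> dw w x -> dw w (b nu).
  elim: w => //= j w IH hw [dx hp]; have db := IH (ltnW hw) dx; split=> //.
  have [_ e1 _] := h w w (ltnW hw) (ltnW hw) dx dx.
  have [_ e2 _] := hn w w (ltnW hw) (ltnW hw) db db.
  by move: hp; rewrite /phi e1 -e2 !wt_F // wx wt_b.
move=> w w' hw hw' dx dx'; have db := key w hw dx; have db' := key w' hw' dx'.
have [_ e1 c1] := h w w' hw hw' dx dx'; have [_ e2 c2] := hn w w' hw hw' db db'.
split=> // [j|]; first by rewrite e1 e2.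
exact: (iff_trans c1 (iff_sym c2)).
Qed.

(** By [b_last] a positive [eps j] would force the letter j to occur in the word. *)
Lemma eps_nseq_other k i nu j : j != i -> dw (nseq k i) (b nu) -> eps j (F (nseq k i) (b nu)) = 0.
Proof.
move=> ji d; have := eps_ge0 j (F (nseq k i) (b nu)); rewrite le_eqVlt => /orP[/eqP //|h].
have [w' [_ _ /perm_mem/(_ j)]] := b_last d h.
by rewrite mem_head mem_nseq (negPf ji) andbF.
Qed.

Lemma dw_nseq k i nu : (k <= nu i)%N -> dw (nseq k i) (b nu).
Proof.
elim: k => //= k IH hk; have d := IH (ltnW hk); split=> //.
rewrite /phi eps_nseq // wt_F // eps_b wt_b rsum_nseq Adiag.
lia.
Qed.

Lemma wt_nseq k i nu : dw (nseq k i) (b nu) ->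
  wt (F (nseq k i) (b nu)) i = (nu i)%:Z - 2 * k%:Z.
Proof. by move=> d; rewrite wt_F // wt_b rsum_nseq Adiag; lia. Qed.

(* When all weights off [i] are large, letters different from [i] act on the left factor; the
   letter [i] only sees [phi_i] of the left factor minus [k], so that [k] may be subtracted
   from both. *)
Lemma shift_right n i k tau zeta tau' zeta' w :
  (forall j, j != i -> (2 * n < tau j)%N /\ zeta j = 0%N) -> (k <= zeta i)%N ->
  (size w <= n)%N ->
  (forall j, tau' j = if j == i then (tau i - k)%N else tau j) ->
  (forall j, zeta' j = if j == i then (zeta i - k)%N else 0%N) ->
  dw w ((b tau, F (nseq k i) (b zeta)) : tensor (B tau) (B zeta)) ->
  exists w1 a, [/\ (size w1 + a)%N = size w, dw w1 (b tau), dw (nseq (a + k) i) (b zeta),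
    F w ((b tau, F (nseq k i) (b zeta)) : tensor (B tau) (B zeta)) =
      (F w1 (b tau), F (nseq (a + k) i) (b zeta)) &
    (k <= tau i)%N -> [/\ dw w1 (b tau'), dw (nseq a i) (b zeta'),
      dw w ((b tau', b zeta') : tensor (B tau') (B zeta')) &
      F w ((b tau', b zeta') : tensor (B tau') (B zeta')) =
      (F w1 (b tau'), F (nseq a i) (b zeta'))]].
Proof.
move=> hj hk hw ht' hz'; elim: w hw => [|j w IH] hw.
  by move=> _; exists [::], 0%N; split=> //; exact: dw_nseq.

move=> /= [/(IH (ltnW hw)) [w1 [a [s1 d1 d2 e h]]]]; rewrite e => hp.
have w1n : (size w1 <= n)%N by move: hw => /=; lia.
have hs : forall c, (k <= tau i)%N -> dw w1 (b tau') ->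
    eps c (F w1 (b tau')) = eps c (F w1 (b tau)) /\
    (forall c, wt (F w1 (b tau')) c = wt (F w1 (b tau)) c - (if c == i then k%:Z else 0)).
  move=> c kt d1'.
  have et : tau = (fun j => tau' j + (if j == i then k else 0))%N.
    by apply/funext => c'; rewrite ht'; case: eqP => [->|_]; lia.
  have hn : sim n (b tau') (b tau).
    by rewrite et; apply: (sim_trans _ (b_sum n _ _)); apply: sim_tail; exact: eps_b.
  have [_ -> _] := hn w1 w1 w1n w1n d1' d1'; split=> // c'.
  by rewrite !wt_F // !wt_b ht'; case: eqP => [->|_]; lia.
have [ji|ji] := eqVneq j i; last first.
  have [tj _] := hj j ji.
  have hl : eps j (F (nseq (a + k) i) (b zeta)) < phi j (F w1 (b tau)).
    rewrite eps_nseq_other // /phi; have := eps_ge0 j (F w1 (b tau)).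
    have := wt_F_ge Adiag Aoff j d1; rewrite wt_b; lia.
  have dj : dw (j :: w1) (b tau).
    by split=> //; apply: le_lt_trans hl; apply: eps_ge0.
  exists (j :: w1), a; rewrite /= /tf /= hl addSn s1; split=> //.
  move=> kt; have [d1' d2' dt' e'] := h kt; have [he hwt] := hs j kt d1'.
  have hl' : eps j (F (nseq a i) (b zeta')) < phi j (F w1 (b tau')).
    by rewrite eps_nseq_other // /phi he hwt (negPf ji) subr0; move: dj => [_].
  have p' : 0 < phi j (F w1 (b tau')) by apply: le_lt_trans hl'; apply: eps_ge0.
  rewrite e' /= hl'; split=> //; split=> //.
  rewrite /phi /= /teps /twt /= hl'; move: p'; rewrite /phi.
  have := phi_ge0 j (F (nseq a i) (b zeta')); rewrite eps_nseq_other //; lia.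
subst j; have ee := eps_nseq d2; have ew := wt_nseq d2; rewrite eps_b in ee.
have [hl|hl] := ltrP (eps i (F (nseq (a + k) i) (b zeta))) (phi i (F w1 (b tau))).
  have dj : dw (i :: w1) (b tau).
    by split=> //; apply: le_lt_trans hl; apply: eps_ge0.
  exists (i :: w1), a; rewrite /= /tf /= hl addSn s1; split=> //.
  move=> kt; have [d1' d2' dt' e'] := h kt; have [he hwt] := hs i kt d1'.
  have ee' := eps_nseq d2'; have ew' := wt_nseq d2'; rewrite eps_b in ee'.
  have hl' : eps i (F (nseq a i) (b zeta')) < phi i (F w1 (b tau')).
    move: hl; rewrite ee ee' /phi he hwt eqxx; lia.
  have p' : 0 < phi i (F w1 (b tau')) by apply: le_lt_trans hl'; apply: eps_ge0.
  rewrite e' /= hl'; split=> //; split=> //.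
  rewrite /phi /= /teps /twt /= hl'; move: hl'; rewrite /phi.
  have := phi_ge0 i (F (nseq a i) (b zeta')); rewrite ee' ew'; lia.
have hp2 : 0 < phi i (F (nseq (a + k) i) (b zeta)).
  move: hp; rewrite /phi /= /teps /twt /= (le_gtF hl) /=; lia.
exists w1, a.+1; rewrite /= /tf /= (le_gtF hl) /= addnS s1; split=> //.
move=> kt; have [d1' d2' dt' e'] := h kt; have [he hwt] := hs i kt d1'.
have ee' := eps_nseq d2'; have ew' := wt_nseq d2'; rewrite eps_b in ee'.
have hl' : phi i (F w1 (b tau')) <= eps i (F (nseq a i) (b zeta')).
  move: hl; rewrite ee ee' /phi he hwt eqxx; lia.
have hp' : 0 < phi i (F (nseq a i) (b zeta')).
  move: hp2; rewrite /phi ee' ew' ee ew hz' eqxx; lia.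
rewrite e' /= (le_gtF hl') /=; split=> //; split=> //.
rewrite /phi /= /teps /twt /= (le_gtF hl') /=; move: hp'; rewrite /phi; lia.
Qed.

Lemma shift_sim n i k tau zeta tau' zeta' :
  (forall j, j != i -> (2 * n < tau j)%N /\ zeta j = 0%N) -> (k <= zeta i)%N ->
  (forall j, tau' j = if j == i then (tau i - k)%N else tau j) ->
  (forall j, zeta' j = if j == i then (zeta i - k)%N else 0%N) -> (k <= tau i)%N ->
  sim n ((b tau, F (nseq k i) (b zeta)) : tensor (B tau) (B zeta))
    ((b tau', b zeta') : tensor (B tau') (B zeta')).
Proof.
move=> hj hk ht' hz' kt.
have hn : sim n (b tau') (b tau).
  have et : tau = (fun j => tau' j + (if j == i then k else 0))%N.
    by apply/funext => c'; rewrite ht'; case: eqP => [->|_]; lia.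
  by rewrite et; apply: (sim_trans _ (b_sum n _ _)); apply: sim_tail; exact: eps_b.
move=> w w' hw hw' /(shift_right hj hk hw ht' hz') [w1 [a [s1 d1 d2 e /(_ kt)[d3 d4 d5 e']]]].
move=> /(shift_right hj hk hw' ht' hz') [v1 [c [t1 g1 g2 o /(_ kt)[g3 g4 g5 o']]]].
have w1n : (size w1 <= n)%N by apply: leq_trans hw; rewrite -s1 leq_addr.
have v1n : (size v1 <= n)%N by apply: leq_trans hw'; rewrite -t1 leq_addr.
have [_ he hc] := hn w1 v1 w1n v1n d3 g3.
have E1 := eps_nseq d2; have E2 := eps_nseq g2; have E3 := eps_nseq d4; have E4 := eps_nseq g4.
rewrite !eps_b in E1 E2 E3 E4.
rewrite e e' o o'; split=> // [j|].
  have hwt : wt (F w1 (b tau')) j = wt (F w1 (b tau)) j - (if j == i then k%:Z else 0).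
    by rewrite !wt_F // !wt_b ht'; case: eqP => [->|_]; lia.
  rewrite /= /teps /= /phi he hwt; have [->|ji] := eqVneq j i.
    by rewrite E1 E3; do 2 case: ifP => ?; lia.
  by rewrite !eps_nseq_other // subr0.
split=> -[h1 h2].
  have ac : (a + k)%:Z = (c + k)%:Z by have := congr1 (eps i) h2; rewrite E1 E2 !add0r.
  have -> : a = c by lia.
  by rewrite (hc.2 h1).
have ac : a%:Z = c%:Z by have := congr1 (eps i) h2; rewrite E3 E4 !add0r.
have -> : a = c by lia.
by rewrite (hc.1 h1).
Qed.

Lemma teps_ge (X Y : crystal) j (x : X) (y : Y) : eps j x <= eps j ((x, y) : tensor X Y).
Proof. by rewrite /= /teps /phi /=; case: ltrP; lia. Qed.

(* The element [b lam (x) F u (b mu)] is highest.  Adding a large tail [xi] and redistributing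
   [mu + xi] so that the first letter [i] of [u] acts on the right factor turns it into a shorter
   highest element tensored with a power of [fc i]. *)
Lemma tensor_highest n u lam mu nu : dw u (b mu) ->
  (forall j, eps j (F u (b mu)) <= (lam j)%:Z) ->
  (forall j, wt ((b lam, F u (b mu)) : tensor (B lam) (B mu)) j = (nu j)%:Z) ->
  sim n ((b lam, F u (b mu)) : tensor (B lam) (B mu)) (b nu).
Proof.
have [N] := ubnP (size u); elim: N u n lam mu nu => // N IH; case/lastP => [|u0 i] n lam mu nu hN du he hwt.
  apply: (sim_dominant _ hwt (b_sum n _ _)) => j.
  by have := hwt j; rewrite /= /twt /= !wt_b; lia.
set x0 : tensor _ _ := (b lam, _).
set u := rcons u0 i in du he hwt x0 *; pose m := size u0.
have su : size u = m.+1 by rewrite size_rcons.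
(* The first summands keep weights off i above twice the relevant word length, even after the m
   letters of u0. The last one compensates for the at most m + 1 letters i on the right when the
   final weights are compared. *)
pose xi j := (2 * (n + m) + 1 + m.+1 * `|A j i|)%N.
(* The left factor has no weight at i, so the first letter i must act on the right, where all the
   weight at i is placed. *)
pose mu' j := if j == i then 0%N else (mu j + xi j)%N.
pose mu'' j := if j == i then (mu i + xi i)%N else 0%N.
pose y : tensor (B mu) (B xi) := (b mu, b xi).
pose y' : tensor (B mu') (B mu'') := (b mu', b mu'').
have [dy ey] := tail_F Adiag (z := b xi) (eps_b xi) du.
have hy M : sim M y y'.
  apply: (sim_trans (b_sum M mu xi)); have := b_sum' M mu' mu''.
  suff -> : (fun j => mu j + xi j)%N = (fun j => mu' j + mu'' j)%N by [].
  by apply/funext => j; rewrite /mu' /mu''; case: eqP => [->|_]; lia.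
have [dy' he' _] := hy (size u) u u (leqnn _) (leqnn _) dy dy.
have he2 j : eps j (F u y') <= (lam j)%:Z.
  rewrite -he'; have [_ E _] := sim_tail Adiag (eps_b xi) (leqnn _) (leqnn _) du du.
  by rewrite -(E j).
have hF : sim n (F u y) (F u y') by apply: sim_F dy; apply: hy.
have [di0 di1] : 0 < phi i y' /\ dw u0 (fc i y').
  by move: dy'; rewrite /u -cats1 => /dw_cat[/= [_ ?] ?].
have i1 : (1 <= mu'' i)%N.
  by move: di0; rewrite /phi /= /teps /twt /= /phi !eps_b !wt_b /mu' eqxx /=; lia.
have ef : fc i y' = (b mu', F (nseq 1 i) (b mu'')).
  by rewrite /= /tf /= /phi !eps_b !wt_b /mu' eqxx.
rewrite ef in di1.
have hj j : j != i -> (2 * m < mu' j)%N /\ mu'' j = 0%N.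
  by move=> /negPf ji; rewrite /mu' /mu'' ji; split=> //; rewrite /xi; lia.
have [u1 [a [s1 d1 d2 e _]]] := shift_right hj i1 (leqnn m) (fun=> erefl) (fun=> erefl) di1.
have e1 : F u y' = (F u1 (b mu'), F (nseq (a + 1) i) (b mu'')).
  by rewrite /u -cats1 F_cat -e -ef.
set k := (a + 1)%N in d2 e1.
have hs j : rsum A u j = rsum A u1 j + k%:Z * A j i.
  have := wt_F j dy'; rewrite e1 [LHS]/= /twt [in LHS]/= !wt_F // /y' /= /twt /= !wt_b.
  by rewrite rsum_nseq; lia.
have he1 j : eps j (F u1 (b mu')) <= (lam j)%:Z.
  by apply: le_trans (he2 j); rewrite e1; apply: teps_ge.
pose x1 : tensor (B lam) (B mu') := (b lam, F u1 (b mu')).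
have hx1 j : (`|wt x1 j|%N)%:Z = wt x1 j.
  rewrite gez0_abs //; have := phi_ge0 j x1; have := he1 j.
  rewrite /= /teps /twt /= /phi eps_b wt_b; case: ifP => ?; lia.
pose tau j := `|wt x1 j|%N.
(* u1 lost at least that letter i, so it is shorter than u and the induction applies. *)
have h1 : sim n x1 (b tau).
  apply: IH => //; last by move=> j; rewrite /tau hx1.
  by move: hN; rewrite -/u su /m -s1; lia.
have wtau j : (tau j)%:Z = (lam j)%:Z + (mu' j)%:Z - rsum A u1 j.
  by rewrite /tau hx1 /x1 /= /twt /= wt_F // !wt_b addrA.
have wnu j : (nu j)%:Z = (lam j)%:Z + (mu j)%:Z - rsum A u j.
  by rewrite -hwt /= /twt /= wt_F // !wt_b addrA.
have h2 : sim n x0 ((b tau, F (nseq k i) (b mu'')) : tensor (B tau) (B mu'')).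
  apply: (sim_trans (sim_tail Adiag (eps_b xi))).
  apply: (sim_trans (sim_assoc Adiag n (b lam) (F u (b mu)) (b xi)).1).
  have -> : (F u (b mu), b xi) = F u y by rewrite ey.
  apply: (sim_trans (sim_right hF)); rewrite e1.
  apply: (sim_trans (sim_assoc Adiag n (b lam) (F u1 (b mu')) (F (nseq k i) (b mu''))).2).
  by apply: sim_left h1 => j; rewrite wt_b hx1.
have kz : (k <= mu'' i)%N.
  have := phi_ge0 i (F (nseq k i) (b mu'')); rewrite eps_nseq // wt_nseq // eps_b; lia.
(* The element [x0] has [eps i] equal to 0, and on the right of h2 this value is 0 only if k is at
   most [tau i]. *)
have kt : (k <= tau i)%N.
  have [_ /(_ i) + _] := h2 [::] [::] isT isT I I; rewrite /= /teps /= /phi !eps_b !wt_b.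
  rewrite eps_nseq // eps_b; have := he i; do 2 case: ifP => ?; lia.
have hj' j : j != i -> (2 * n < tau j)%N /\ mu'' j = 0%N.
  move=> ji; split; last by have [] := hj j ji.
  have := wt_F_ge Adiag Aoff j d1; rewrite wt_F // wt_b.
  have := wtau j; rewrite /mu' (negPf ji) /xi.
  by move: s1; rewrite -/m; move: (m.+1 * `|A j i|)%N => r; lia.
have h3 := shift_sim hj' kz (fun=> erefl) (fun=> erefl) kt.
apply: (sim_dominant _ hwt (sim_trans h2 (sim_trans h3 (b_sum n _ _)))) => j.
have := wnu j; have := wtau j; have := hs j; rewrite /mu' /mu''.
have [->|ji] := eqVneq j i; first by move: kz kt; rewrite /mu'' !eqxx Adiag; lia.
have : (k * `|A j i| <= m.+1 * `|A j i|)%N by rewrite leq_mul2r; apply/orP; right; lia.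
have : A j i = - (`|A j i|%N)%:Z by have := Aoff (elimN eqP ji); lia.
rewrite /xi; set q := `|A j i|%N => ->; rewrite mulrN; nia.
Qed.

Definition highest (X : crystal) (x : X) nu :=
  (forall j, wt x j = (nu j)%:Z) /\ forall n, sim n x (b nu).

Lemma highest_eps (X : crystal) (x : X) nu j : highest x nu -> eps j x = 0.
Proof. by move=> [_ /(_ 0%N [::] [::] isT isT I I)[_ -> _]]; rewrite eps_b. Qed.

Lemma eps_cons (X : crystal) (x : X) j v : dw (j :: v) x -> 0 < eps j (F (j :: v) x).
Proof. by move=> [_ h]; rewrite /= eps_f //; have := eps_ge0 j (F v x); lia. Qed.

(** If one word begins with j, then [eps j] is positive at the common element, so by [b_last] the
    other word may be rewritten to begin with j; [f_inj] cancels the letter. *)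
Lemma highest_disjoint (X : crystal) (x x' : X) nu nu' v v' : highest x nu -> highest x' nu' ->
  dw v x -> dw v' x' -> F v x = F v' x' -> x = x'.
Proof.
move=> hx hx'; elim: v v' => [|j v IH] v'.
  case: v' => // j v' _ /eps_cons; rewrite /= => + e; rewrite -[fc _ _]e (highest_eps j hx).
  by rewrite ltxx.
move=> dv dv' e; have he := eps_cons dv; rewrite e in he.
have [wx' /(_ (size v')) sx'] := hx'.
have [d0 e0 _] := sx' v' v' (leqnn _) (leqnn _) dv' dv'; rewrite e0 in he.
have [v'' [d2 e2 p2]] := b_last d0 he.
have sz : (size (j :: v'') <= size v')%N by rewrite (perm_size p2).
have wt' : wt x' =1 wt (b nu') by move=> c; rewrite wx' wt_b.
have d3 := sim_dw sx' wt' sz d2.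
have [_ _ c3] := sx' _ _ sz (leqnn _) d3 dv'.
have e3 := c3.2 e2; rewrite -e in e3.
have [d4 p4] := d3; have [d5 p5] := dv.
by apply: (IH v'') => //; apply: (f_inj p5 p4).
Qed.

End HighestWeight.

(** * Root operators on paths *)

Section RootOperators.
Variables (R : realType) (J V : Type) (A : J -> J -> int) (cv : J -> V) (rt : J -> V -> int).
Implicit Types (p y b : cpath R V) (i : J) (s t : R).

Local Notation H i p := (Hf cv i p).

Definition fg i p : cpath R V := fun t v => p t v - th (H i p) t * aR R rt i v.
Definition eg i p : cpath R V := fun t v => p t v + kap (H i p) t * aR R rt i v.

Definition based i p := [/\ nice (H i p), H i p 0 = 0 & H i p 1 \is a Num.int].

(** [mval] is an infimum over integral values only; the true minimum is attained and integral, so it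
    is one of them. *)
Lemma mval_mn i p : nice (H i p) -> mval cv i p = mn (H i p) 0 1.
Proof.
move=> [hl _ hi]; have [t0 ht0 e0] := mn_att hl ler01.
have lbm : lbound [set r : R | exists t, in01 t /\ H i p t = r /\ exists z : int, r = z%:~R] (mn (H i p) 0 1).
  by move=> r [t [ht [<- _]]]; apply: mn_le.
apply/eqP; rewrite eq_le; apply/andP; split.
  apply: ge_inf; first by exists (mn (H i p) 0 1).
  exists t0; split=> //; split=> //; exact/intrP.
apply: lb_le_inf => //; exists (mn (H i p) 0 1), t0; split=> //; split=> //; exact/intrP.
Qed.

Lemma sup_eq (E : set R) x : E x -> (forall t, E t -> t <= x) -> sup E = x.
Proof.
move=> Ex hx; apply/eqP; rewrite eq_le; apply/andP; split.
  by apply: ge_sup => //; exists x.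
by apply: ub_le_sup => //; exists x.
Qed.

Lemma inf_eq (E : set R) x : E x -> (forall t, E t -> x <= t) -> inf E = x.
Proof.
move=> Ex hx; apply/eqP; rewrite eq_le; apply/andP; split.
  by apply: ge_inf => //; exists x.
by apply: lb_le_inf => //; exists x.
Qed.

(** The points p0 and q0 of [th_shape] are the cut points [fplus] and [fminus], and f_i vanishes
    exactly when the minimum equals the endpoint value. *)
Lemma root_fE i p : based i p ->
  root_f cv rt i p = if mn (H i p) 0 1 + 1 <= H i p 1 then Some (fg i p) else None.
Proof.
move=> [hn h0 h1]; have [hl _ mi] := hn; rewrite /root_f.
have em := mval_mn hn; set m := mn _ _ _ in em mi *.
case: ifPn => hm.
  have e1 : H i p 1 = m.
    apply/eqP; rewrite eq_le; apply/andP; split; last by apply: mn_le; rewrite // ler01 lexx.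
    rewrite leNgt; apply/negP => hlt; have hs := int_between mi h1 hlt.
    have [p0 [q0 [[a1 a2 a3] [b1 b2 b3 b4 b5] _ _]]] := th_shape hn hs.
    have : fplus cv i p = p0.
      apply: sup_eq; first by split; [apply/andP; lra | rewrite em].
      move=> t [/andP[t0 t1]]; rewrite em => et; rewrite leNgt; apply/negP => lt.
      by have := b3 t; rewrite lt t1 -/m et ltxx => /(_ isT).
    by move=> e; move: hm; rewrite e => /eqP e'; move: a2 a3; rewrite e'; lra.
  by rewrite e1 gerDl ler10.
have hs : m + 1 <= H i p 1.
  apply: int_between => //; rewrite lt_neqAle; apply/andP; split; last first.
    by apply: mn_le; rewrite // ler01 lexx.
  apply: contraNneq hm => e; apply/eqP; apply: sup_eq; last by move=> t [/andP[]].
  by split; [rewrite /in01 ler01 lexx | rewrite em].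
rewrite hs; congr Some.
have [p0 [q0 [[a1 a2 a3] [b1 b2 b3 b4 b5] _ [c1 c2 c3]]]] := th_shape hn hs.
have ep : fplus cv i p = p0.
  apply: sup_eq; first by split; [apply/andP; lra | rewrite em].
  move=> t [/andP[t0 t1]]; rewrite em => et; rewrite leNgt; apply/negP => lt.
  by have := b3 t; rewrite lt t1 -/m et ltxx => /(_ isT).
have eq : fminus cv i p = q0.
  rewrite /fminus ep em; apply: inf_eq; first by split; [apply/andP; lra | exact: b2].
  move=> t [/andP[t0 t1]] et; rewrite leNgt; apply/negP => lt.
  by have := b4 t; rewrite lt t0 -/m et ltxx => /(_ isT).
apply/funext => t; apply/funext => v; rewrite ep eq em /fg.
case: ifPn => [tp|]; first by rewrite c1 // mul0r subr0.
rewrite -ltNge => tp; case: ifPn => [tq|]; first by rewrite c2 // ltW.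
by rewrite -ltNge => tq; rewrite c3 ?mul1r // ltW.
Qed.

Lemma root_e_reE i p : based i p ->
  root_e_re cv rt i p = if mn (H i p) 0 1 + 1 <= 0 then Some (eg i p) else None.
Proof.
move=> [hn h0 h1]; have [hl _ mi] := hn; rewrite /root_e_re.
have em := mval_mn hn; set m := mn _ _ _ in em mi *.
have m0 : m <= 0 by rewrite -h0; apply: mn_le; rewrite // lexx ler01.
have key : m + 1 <= 0 -> exists p0 q0 : R, [/\ 0 < q0, eplus_re cv i p = q0, eminus_re cv i p = p0 &
   [/\ (forall t, t <= p0 -> kap (H i p) t = 0),
        (forall t, p0 <= t <= q0 -> kap (H i p) t = 1 - (H i p t - m)) &
        (forall t, q0 <= t -> kap (H i p) t = 1)]].
  move=> hs; have hs' : m + 1 <= H i p 0 by rewrite h0.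
  have [p0 [q0 [[a1 a2 a3] [b1 b2 b3 b4 b5] _ cc]]] := kap_shape hn hs'.
  have eq : eplus_re cv i p = q0.
    apply: inf_eq; first by split; [apply/andP; lra | rewrite em].
    move=> t [/andP[t0 t1]]; rewrite em => et; rewrite leNgt; apply/negP => lt.
    by have := b3 t; rewrite lt t0 -/m et ltxx => /(_ isT).
  exists p0, q0; split=> //; first by lra.
  rewrite /eminus_re eq em; apply: sup_eq; first by split; [apply/andP; lra | exact: b1].
  move=> t [/andP[t0 t1]] et; rewrite leNgt; apply/negP => lt.
  by have := b4 t; rewrite lt t1 -/m et ltxx => /(_ isT).
case: ifPn => hm.
  case: ifP => // /key [p0 [q0 [q0p e _ _]]].
  by move: hm q0p; rewrite e => /eqP ->; rewrite ltxx.
have hs : m + 1 <= 0.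
  apply: (int_between mi (int_num0 R)).
  rewrite lt_neqAle m0 andbT; apply: contraNneq hm => e; apply/eqP; apply: inf_eq.
    by split; [rewrite /in01 ler01 lexx | rewrite em e].
  by move=> t [/andP[]].
rewrite hs; congr Some; have [p0 [q0 [q0p e1 e2 [c1 c2 c3]]]] := key hs.
apply/funext => t; apply/funext => v; rewrite e1 e2 em /eg.
case: ifPn => [tp|]; first by rewrite c1 // mul0r addr0.
rewrite -ltNge => tp; case: ifPn => [tq|].
  by rewrite c2 ?(ltW tp) //; congr (_ + _); rewrite -mulNr; congr (_ * _); ring.
by rewrite -ltNge => tq; rewrite c3 ?mul1r // ltW.
Qed.

Section RealIndex.
Variable i : J.
Hypothesis rti : rt i (cv i) = 2.

Lemma fgH p : H i (fg i p) = fun t => H i p t - 2 * th (H i p) t.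
Proof. by apply/funext => t; rewrite /Hf /fg /aR rti mulrC. Qed.

Lemma e_of_f y b : based i y -> based i b ->
  root_f cv rt i y = Some b -> root_e_re cv rt i b = Some y.
Proof.
move=> /[dup] by_ [hn h0 h1] bb; rewrite root_fE // root_e_reE //; case: ifP => // hm [e].
have hm0 : mn (H i y) 0 1 <= 0.
  by rewrite -[leRHS]h0; apply: mn_le; [case: hn | rewrite lexx ler01].
rewrite -e fgH (mn_theta hn hm).2 subrK hm0.
congr Some; apply/funext => t; apply/funext => v.
by rewrite /eg fgH (kap_theta t hn hm) /fg subrK.
Qed.

End RealIndex.

Section ImaginaryIndex.
Variable i : J.
Hypothesis rti : rt i (cv i) = A i i.
Hypothesis Ai : A i i <= 0.

(** The property that replaces integrality of minima for an imaginary index: subtracting a root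
    times a nondecreasing function cannot decrease this pairing, since the i-th coroot is
    nonpositive on all simple roots. *)
Definition incH p := forall s t, 0 <= s -> s <= t -> t <= 1 -> H i p s <= H i p t.

Lemma inc_mn p : based i p -> incH p -> mn (H i p) 0 1 = 0.
Proof.
move=> [[hl _ _] h0 _] hm; apply/eqP; rewrite eq_le; apply/andP; split.
  by rewrite -[leRHS]h0; apply: mn_le; rewrite // lexx ler01.
by apply: mn_ge => // t /andP[t0 t1]; rewrite -[leLHS]h0; apply: hm.
Qed.

Lemma aii_le0 : aii R A i <= 0. Proof. by rewrite /aii -[0]/((0 : int)%:~R) ler_int. Qed.

Lemma inc_fplus p : based i p -> incH p -> exists P, [/\ fplus cv i p = P, 0 <= P <= 1,
  H i p P = 0, (forall t, 0 <= t <= P -> H i p t = 0) & (forall t, P < t <= 1 -> 0 < H i p t)].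
Proof.
move=> bp hm; have [[hl _ _] h0 _] := bp; have m0 := inc_mn bp hm.
have em : mval cv i p = 0 by rewrite mval_mn //; case: bp.
have [h|h] := lerP (H i p 1) 0.
  have e1 t : 0 <= t <= 1 -> H i p t = 0.
    move=> /andP[t0 t1]; apply/eqP; rewrite eq_le; apply/andP; split.
      by apply: le_trans h; apply: hm.
    by rewrite -[leLHS]h0; apply: hm.
  exists 1; split; rewrite ?e1 ?ler01 ?lexx //.
    by apply: sup_eq => [|t [/andP[]]] //; split; [rewrite /in01 ler01 lexx | rewrite em e1 ?ler01 ?lexx].
  by move=> t /andP[t1 t2]; move: t1; rewrite ltNge t2.
have [P [hP eP aP]] := last_le hl ler01 (eq_ind_r (fun x => x <= 0) (lexx 0) h0) (ltW h).
exists P; split=> //.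
  apply: sup_eq; first by split=> //; rewrite em.
  move=> t [/andP[t0 t1]]; rewrite em => et; rewrite leNgt; apply/negP => lt.
  by have := aP t; rewrite lt t1 et ltxx => /(_ isT).
move=> t /andP[t0 tP]; apply/eqP; rewrite eq_le; apply/andP; split.
  by rewrite -eP; apply: hm => //; case/andP: hP.
by rewrite -[leLHS]h0; apply: hm => //; apply: le_trans tP _; case/andP: hP.
Qed.

(** Between the cut points f_i multiplies the pairing by 1 - a_ii, and afterwards the pairing is at
    least 1 - a_ii. This matches the divisor and the threshold in e_i and rules out both of its
    vanishing conditions. *)
Lemma e_im_of_f y b : based i y -> incH y -> based i b -> incH b ->
  root_f cv rt i y = Some b -> root_e_im A cv rt i b = Some y.
Proof.
move=> by_ iy bb ib; have a0 := aii_le0; have [hn h0 h1] := by_.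
rewrite root_fE //; case: ifP => // hs [eb].
have [p0 [q0 [[a1 a2 a3] [b1 b2 b3 b4 b5] _ [c1 c2 c3]]]] := th_shape hn hs.
have m0 := inc_mn by_ iy; rewrite m0 !add0r in b1 b2 b3 b4 b5 c2.
have eH t : H i b t = H i y t - th (H i y) t * aii R A i by rewrite -eb /Hf /fg /aR rti.
have em : mval cv i b = 0 by rewrite mval_mn ?(inc_mn bb ib) //; case: bb.
have H0 t : 0 <= t <= 1 -> 0 <= H i y t by move=> /andP[t0 t1]; rewrite -[leLHS]h0; apply: iy.
have eP : fplus cv i b = p0.
  apply: sup_eq; first by split; [apply/andP; lra | rewrite em eH b1 c1 // mul0r subr0].
  move=> t [/andP[t0 t1]]; rewrite em eH => et; rewrite leNgt; apply/negP => lt.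
  have := b3 t; rewrite lt t1 => /(_ isT).
  have : 0 <= th (H i y) t * - aii R A i by apply: mulr_ge0; [apply: th_ge0; case: hn | lra].
  rewrite mulrN; lra.
have mid t : p0 <= t <= q0 -> H i b t = (1 - aii R A i) * H i y t.
  by move=> ht; rewrite eH c2 // subr0; ring.
have aft t : q0 <= t <= 1 -> 1 - aii R A i <= H i b t.
  by move=> ht; rewrite eH c3 ?mul1r; [have := b5 t ht; lra | lra].
have eQ : eplus_im A cv i b = q0.
  rewrite /eplus_im eP em add0r; apply: inf_eq.
    by split; [apply/andP; lra | rewrite mid ?b2 ?mulr1 //; lra].
  move=> t [/andP[t0 t1]] et; rewrite leNgt; apply/negP => lt.
  have ht : p0 <= t < q0 by rewrite t0.
  have := b4 t ht; have := mid t; rewrite t0 ltW // => /(_ isT); rewrite et => e.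
  have : (1 - aii R A i) * (1 - H i y t) = 0 by rewrite mulrBr mulr1 -e subrr.
  move=> /eqP; rewrite mulf_eq0 => /orP[/eqP|/eqP]; lra.
rewrite /root_e_im eP eQ em add0r; case: ifPn => [/orP[/eqP|/asboolP hh]|_].
- by move=> e; exfalso; move: a2 a3; rewrite e; lra.
- exfalso; have hq : p0 <= q0 <= 1 by lra.
  by have := hh q0 hq; have := aft q0; rewrite lexx a3 => /(_ isT); lra.
case: ifPn => [/asboolP[s [hs1 hs2]]|_]; first by exfalso; have := aft s hs1; lra.
congr Some; apply/funext => t; apply/funext => v; rewrite subr0.
have ev : b t v = y t v - th (H i y) t * aR R rt i v by rewrite -eb.
case: ifPn => [tp|]; first by rewrite ev c1 // mul0r subr0.
rewrite -ltNge => tp; case: ifPn => [tq|].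
  have ht : p0 <= t <= q0 by rewrite tq ltW.
  rewrite mid // ev c2 // subr0 (mulrC (1 - _)) mulfK ?subrK //; apply: lt0r_neq0; lra.
by rewrite -ltNge => tq; rewrite ev c3 ?mul1r ?subrK // ltW.
Qed.

(** The properties of y are hypotheses here: the root operator alone may leave the set of admissible
    paths, and membership will supply them. *)
Lemma f_of_e_im y b : based i y -> incH y -> based i b -> incH b ->
  root_e_im A cv rt i b = Some y -> root_f cv rt i y = Some b.
Proof.
move=> by_ iy bb ib; have a0 := aii_le0; have [hn h0 h1] := by_; have [[hlb _ _] hb0 hb1] := bb.
have [P [eP hP HP zP pP]] := inc_fplus bb ib.
have em : mval cv i b = 0 by rewrite mval_mn ?(inc_mn bb ib) //; case: bb.
rewrite /root_e_im eP em add0r; case: ifPn => // /norP[/eqP P1 /asboolP hh].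
have PP : P < 1 by rewrite lt_neqAle; case/andP: hP => _ ->; rewrite andbT; apply/eqP.
have [t1 [ht1 ht1']] : exists t, P <= t <= 1 /\ 1 - aii R A i <= H i b t.
  move: hh => /existsNP[t /not_implyP[ht /negP]]; rewrite -leNgt => h.
  by exists t.
have [Q [hQ eQ bQ]] : exists q, [/\ P <= q <= t1, H i b q = 1 - aii R A i &
    forall t, P <= t < q -> H i b t < 1 - aii R A i].
  by apply: first_ge => //; [case/andP: ht1 | rewrite HP; lra].
have eQ' : eplus_im A cv i b = Q.
  rewrite /eplus_im eP em add0r; apply: inf_eq.
    by split=> //; apply/andP; split; [case/andP: hQ | apply: (@le_trans _ _ t1); [case/andP: hQ | case/andP: ht1]].
  move=> t [/andP[tP t1'] et]; rewrite leNgt; apply/negP => lt.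
  by have := bQ t; rewrite tP lt et ltxx => /(_ isT).
rewrite eQ'; case: ifPn => // _ [ey].
have PQ : P < Q.
  by rewrite lt_neqAle; case/andP: hQ => -> _; rewrite andbT; apply/eqP => e; move: eQ; rewrite -e HP; lra.
have Q1 : Q <= 1 by apply: (@le_trans _ _ t1); [case/andP: hQ | case/andP: ht1].
have d0 : 0 < 1 - aii R A i by lra.
have y1 t v : t <= P -> y t v = b t v by move=> tP; rewrite -ey tP.
have y2 t v : P < t -> t <= Q -> y t v = b t v + H i b t / (1 - aii R A i) * aR R rt i v.
  by move=> tP tQ; rewrite -ey leNgt tP /= tQ subr0.
have y3 t v : Q < t -> y t v = b t v + aR R rt i v.
  by move=> tQ; rewrite -ey !leNgt tQ (lt_trans PQ tQ).
have Hy1 t : t <= P -> H i y t = H i b t by move=> h; rewrite /Hf y1.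
have Hy2 t : P < t -> t <= Q -> H i y t = H i b t / (1 - aii R A i).
  move=> h h'; rewrite {1}/Hf y2 // /aR rti -/(aii R A i) -/(Hf cv i b t); field.
  by apply: lt0r_neq0.
have m0 := inc_mn by_ iy.
have P0 : 0 <= P by case/andP: hP.
have HQ : H i y Q = 1 by rewrite Hy2 // eQ mulfV // lt0r_neq0.
have ep : fplus cv i y = P.
  rewrite /fplus mval_mn ?m0; last by case: by_.
  apply: sup_eq; first by split; [rewrite /in01 P0 ltW | rewrite Hy1].
  move=> t [/andP[t0 tl]] et; rewrite leNgt; apply/negP => lt.
  have [tQ|tQ] := lerP t Q.
    move: et; rewrite Hy2 // => /eqP; rewrite mulf_eq0 invr_eq0 (gt_eqF d0) orbF => /eqP e.
    by have := pP t; rewrite lt tl e ltxx => /(_ isT).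
  have Q0 : 0 <= Q by lra.
  by have := iy Q t Q0 (ltW tQ) tl; rewrite HQ et; lra.
have eq : fminus cv i y = Q.
  rewrite /fminus ep mval_mn ?m0 ?add0r; last by case: by_.
  apply: inf_eq; first by split=> //; apply/andP; split=> //; apply: ltW.
  move=> t [/andP[tP tl]] et; rewrite leNgt; apply/negP => lt.
  have tP' : P < t by rewrite lt_neqAle tP andbT; apply/eqP => e; move: et; rewrite -e Hy1 // HP; lra.
  have := bQ t; rewrite tP lt => /(_ isT); move: et; rewrite Hy2 ?(ltW lt) // => e.
  by rewrite -[H i b t](divfK (lt0r_neq0 d0)) e mul1r ltxx.
rewrite /root_f ep eq mval_mn ?m0; last by case: by_.
case: eqP => [//|_]; congr Some; apply/funext => t; apply/funext => v; rewrite subr0.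
case: ifPn => [tp|]; first exact: y1.
rewrite -ltNge => tp; case: ifPn => [tq|]; first by rewrite Hy2 // y2 // addrK.
by rewrite -ltNge => tq; rewrite y3 // addrK.
Qed.

End ImaginaryIndex.
End RootOperators.

(** * Concatenation *)

Section Concatenation.
Variable R : realType.
Implicit Types (H G : R -> R) (s t a c : R).

Definition hcat H G : R -> R := fun t => if t <= 2^-1 then H (2 * t) else H 1 + G (2 * t - 1).

Definition endp H := [/\ nice H, H 0 = 0 & H 1 \is a Num.int].

Lemma half2 : 2 * 2^-1 = 1 :> R. Proof. lra. Qed.

Lemma hcatE H G : G 0 = 0 ->
  hcat H G = fun t => H (Num.min 1 (2 * t)) + G (Num.max 0 (2 * t - 1)).
Proof.
move=> g0; apply/funext => t; rewrite /hcat; case: ifPn => ht.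
  by rewrite min_r ?max_l ?g0 ?addr0 //; lra.
by rewrite -ltNge in ht; rewrite min_l ?max_r //; lra.
Qed.

Lemma lip_max H G : lip H -> lip G -> lip (fun t => Num.max (H t) (G t)).
Proof.
move=> /lip_opp h /lip_opp g; have := lip_opp (lip_min h g).
by under eq_fun do rewrite -oppr_max opprK.
Qed.

Lemma lip_hcat H G : lip H -> lip G -> G 0 = 0 -> lip (hcat H G).
Proof.
move=> lH lG g0; rewrite (hcatE H g0); apply: lipD.
  apply: (lip_comp (H := H) (f := fun t => Num.min 1 (2 * t))) => //.
  by apply: lip_min; [exact: lip_cst | exact/lipZ/lip_id].
apply: (lip_comp (H := G) (f := fun t => Num.max 0 (2 * t - 1))) => //.
apply: lip_max; first exact: lip_cst.
by apply: lipD; [exact/lipZ/lip_id | exact: lip_cst].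
Qed.

Lemma mn_scale H c d a b : lip H -> 0 < c -> a <= b ->
  mn (fun t => H (c * t + d)) a b = mn H (c * a + d) (c * b + d).
Proof.
move=> lH c0 ab.
have lH' : lip (fun t => H (c * t + d)).
  apply: (lip_comp (H := H) (f := fun t => c * t + d)) => //.
  by apply: lipD; [exact/lipZ/lip_id | exact: lip_cst].
have cab x y : x <= y -> c * x + d <= c * y + d by move=> h; rewrite lerD2r ler_pM2l.
apply/eqP; rewrite eq_le; apply/andP; split.
  apply: mn_ge => [|t /andP[ta tb]]; first exact: cab.
  have -> : t = c * ((t - d) / c) + d by rewrite mulrC divfK ?subrK // gt_eqF.
  apply: (mn_le (H := fun t => H (c * t + d))) => //.
  by rewrite ler_pdivlMr // ler_pdivrMr // lerBrDr lerBlDr ![_ * c]mulrC ta tb.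
apply: mn_ge => // t /andP[ta tb]; apply: mn_le => //; apply/andP; split; exact: cab.
Qed.

Lemma mn_ext H G a b : (forall t, a <= t <= b -> H t = G t) -> mn H a b = mn G a b.
Proof.
move=> h; rewrite /mn; congr inf; apply/seteqP; split=> r [t ht ->]; exists t => //; rewrite h //.
Qed.

Section Nice.
Variables H G : R -> R.
Hypotheses (eH : endp H) (eG : endp G).
Local Notation K := (hcat H G).
Local Notation hf := (2^-1 : R).

Local Lemma lH : lip H. Proof. by case: eH => [[]]. Qed.
Local Lemma lG : lip G. Proof. by case: eG => [[]]. Qed.
Local Lemma lK : lip K. Proof. by apply: lip_hcat; [exact: lH|exact: lG|case: eG]. Qed.

Local Hint Resolve lH lG lK : core.

Lemma mn_left a b : a <= b -> b <= hf -> mn K a b = mn H (2 * a) (2 * b).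
Proof.
move=> ab b2; have := mn_scale 0 lH (ltr0Sn R 1) ab; rewrite !addr0 => <-.
apply: mn_ext => t ht; rewrite /hcat addr0 ifT //; lra.
Qed.

Lemma mn_right a b : hf <= a -> a <= b -> mn K a b = mn G (2 * a - 1) (2 * b - 1) + H 1.
Proof.
move=> a2 ab; have l2 : lip (fun t => G (2 * t - 1)).
  apply: (lip_comp (H := G) (f := fun t => 2 * t - 1)); first exact: lG.
  by apply: lipD; [exact/lipZ/lip_id | exact: lip_cst].
rewrite -(mn_scale (- 1) lG (ltr0Sn R 1) ab) -mnDr //.
apply: mn_ext => t ht; rewrite /hcat; case: ifPn => th; last by rewrite addrC.
have -> : t = hf by apply/eqP; rewrite eq_le th; lra.
by rewrite half2 subrr; case: eG => _ -> _; rewrite add0r.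
Qed.

Lemma K0 : K 0 = 0. Proof. by rewrite /hcat ifT ?mulr0 //; [case: eH | lra]. Qed.
Lemma K1 : K 1 = H 1 + G 1.
Proof. by rewrite /hcat ifF; [rewrite mulr1 (_ : 2 - 1 = 1 :> R); last ring | apply/negP; lra]. Qed.
Lemma Khf : K hf = H 1. Proof. by rewrite /hcat lexx half2. Qed.

Lemma mn_K t : 0 <= t <= hf -> mn K t 1 = Num.min (mn H (2 * t) 1) (H 1 + mn G 0 1).
Proof.
move=> ht; rewrite (mn_split (c := hf)) //; last by lra.
have e1 : mn K t hf = mn H (2 * t) 1 by rewrite mn_left ?half2 //; lra.
have e2 : mn K hf 1 = H 1 + mn G 0 1.
  rewrite mn_right; [|lra|lra].
  have -> : 2 * hf - 1 = 0 by lra.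
  have -> : 2 * 1 - 1 = 1 :> R by lra.
  exact: addrC.
by rewrite e1 e2.
Qed.

Lemma mn_K01 : mn K 0 1 = Num.min (mn H 0 1) (H 1 + mn G 0 1).
Proof. by rewrite mn_K ?mulr0 //; apply/andP; split; lra. Qed.

Lemma hcat_endp : endp K.
Proof.
have [[_ LH mH] H0 H1] := eH; have [[_ LG mG] G0 G1] := eG.
split; [|exact: K0|by rewrite K1 rpredD].
split; [exact: lK| |by rewrite mn_K01; case: ltrP => // _; rewrite rpredD].
have LIl a b : 0 <= a -> a <= b -> b <= hf ->
    [\/ mn K a b \is a Num.int, mn K a b = K a | mn K a b = K b].
  have Ke x : x <= hf -> K x = H (2 * x) by rewrite /hcat => ->.
  move=> a0 ab b2; rewrite mn_left // !Ke //; last by lra.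
  by apply: LH; lra.
have LIr a b : hf <= a -> a <= b -> b <= 1 ->
    [\/ mn K a b \is a Num.int, mn K a b = K a | mn K a b = K b].
  move=> a2 ab b1; rewrite mn_right //.
  have Ke x : hf <= x -> K x = G (2 * x - 1) + H 1.
    rewrite le_eqVlt => /orP[/eqP <-|h]; first by rewrite Khf half2 subrr G0 add0r.
    by rewrite /hcat leNgt h /= addrC.
  rewrite !Ke //; last lra.
  have [|||h|->|->] := LG (2 * a - 1) (2 * b - 1); try lra.
  - by constructor 1; rewrite rpredD.
  - by constructor 2.
  - by constructor 3.
move=> a b a0 ab b1; have [b2|b2] := lerP b hf; first exact: LIl.
have [a2|a2] := lerP hf a; first exact: LIr.
rewrite (mn_split (c := hf)) //; last by lra.
have h1 : [\/ mn K a hf \is a Num.int, mn K a hf = K a | mn K a hf = K hf] by apply: LIl; lra.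
have h2 : [\/ mn K hf b \is a Num.int, mn K hf b = K hf | mn K hf b = K b] by apply: LIr; lra.
rewrite Khf in h1 h2.
case: ltrP => _; first by case: h1 => [?|?|->]; [constructor 1|constructor 2|constructor 1].
by case: h2 => [?|->|?]; [constructor 1|constructor 1|constructor 3].
Qed.

(** By integrality the second half stays at least one above the minimum, so the displacement is
    complete at time 1/2. *)
Lemma th_left t : - mn G 0 1 < H 1 - mn H 0 1 -> th K t = th H (2 * t).
Proof.
have [[_ _ mH] H0 H1] := eH; have [[_ _ mG] G0 G1] := eG.
move=> hlt; have hs : mn H 0 1 + 1 <= H 1 + mn G 0 1.
  by apply: int_between => //; [rewrite rpredD | lra].
have m0 : mn G 0 1 <= 0 by rewrite -[leRHS]G0; apply: mn_le; rewrite // lexx ler01.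
have e0 : mn K 0 1 = mn H 0 1 by rewrite mn_K01 min_l //; lra.
have [t0|t0] := lerP t 0; first by rewrite !th_le0 //; lra.
have [t1|t1] := lerP t hf; last first.
  rewrite [RHS]th_ge1 //; [|lra|lra]; rewrite /th e0; apply: min_l.
  suff : mn H 0 1 + 1 <= mn K (clamp t) 1 by lra.
  have hc : hf <= clamp t by rewrite /clamp le_max le_min (ltW t1); apply/orP; right; rewrite andbT; lra.
  have hc1 : clamp t <= 1 by have := clampP t; lra.
  rewrite mn_right //; apply: (le_trans hs); rewrite addrC lerD2r.
  by apply: mn_sub; rewrite //; lra.
have c1 : clamp t = t by apply: clamp_id; lra.
have c2 : clamp (2 * t) = 2 * t by apply: clamp_id; lra.
rewrite /th e0 c1 c2 mn_K; last by lra.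
by case: (ltrP (mn H (2 * t) 1) (H 1 + mn G 0 1)) => // h; rewrite !min_l //; lra.
Qed.

Lemma th_right t : H 1 - mn H 0 1 <= - mn G 0 1 -> th K t = th G (2 * t - 1).
Proof.
move=> hle; have e0 : mn K 0 1 = H 1 + mn G 0 1 by rewrite mn_K01 min_r //; lra.
have [t1|t1] := lerP t hf.
  rewrite [RHS]th_le0 //; last by lra.
  have [t0|t0] := lerP t 0; first by rewrite th_le0.
  have ms : mn H 0 1 <= mn H (2 * t) 1 by apply: mn_sub => //; lra.
  rewrite /th e0 clamp_id; last by lra.
  rewrite mn_K; last by lra.
  rewrite (_ : Num.min (mn H _ _) _ = H 1 + mn G 0 1); last by apply: min_r; lra.
  by rewrite subrr; apply: min_r.
have hc : hf <= clamp t by rewrite /clamp le_max le_min (ltW t1); apply/orP; right; rewrite andbT; lra.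
have hc1 : clamp t <= 1 by have := clampP t; lra.
rewrite /th e0 mn_right // mulr1 (_ : 2 - 1 = 1 :> R); last by ring.
have -> : clamp (2 * t - 1) = 2 * clamp t - 1.
  have [t2|t2] := lerP t 1; first by rewrite !clamp_id //; lra.
  by rewrite !clamp1; lra.
by congr (Num.min 1 _); ring.
Qed.

End Nice.

Section Paths.
Variables (J V : Type) (cv : J -> V) (rt : J -> V -> int).
Implicit Types (p q : cpath R V) (i : J).

Lemma Hf_concat i p q : Hf cv i (concat p q) = hcat (Hf cv i p) (Hf cv i q).
Proof. by []. Qed.

Lemma based_concat i p q : based cv i p -> based cv i q -> based cv i (concat p q).
Proof. by move=> hp hq; exact: (hcat_endp hp hq). Qed.

Lemma concat_1 p q v : concat p q 1 v = p 1 v + q 1 v.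
Proof. by rewrite /concat ifF; [rewrite mulr1 (_ : 2 - 1 = 1 :> R); last ring | apply/negP; lra]. Qed.

Lemma fg_concat i p q : based cv i p -> based cv i q ->
  - mn (Hf cv i q) 0 1 < Hf cv i p 1 - mn (Hf cv i p) 0 1 ->
  fg cv rt i (concat p q) = concat (fg cv rt i p) q.
Proof.
move=> bp bq h; apply/funext => t; apply/funext => v.
rewrite /fg Hf_concat th_left // /concat /=; case: ifPn => //; rewrite -ltNge => ht.
have [[lp _ mp] p0 p1] := bp; have [[lq _ mq] q0 q1] := bq.
have m0 : mn (Hf cv i q) 0 1 <= 0 by rewrite -[leRHS]q0; apply: mn_le; rewrite // lexx ler01.
have hs : mn (Hf cv i p) 0 1 + 1 <= Hf cv i p 1.
  by apply: int_between => //; lra.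
rewrite !th_ge1 //; [ring | lra].
Qed.

Lemma fg_concat' i p q : based cv i p -> based cv i q ->
  Hf cv i p 1 - mn (Hf cv i p) 0 1 <= - mn (Hf cv i q) 0 1 ->
  fg cv rt i (concat p q) = concat p (fg cv rt i q).
Proof.
move=> bp bq h; apply/funext => t; apply/funext => v.
rewrite /fg Hf_concat th_right // /concat /=; case: ifPn => ht; last by ring.
by rewrite th_le0 ?mul0r ?subr0 //; [case: bq => [[]] | lra].
Qed.

Lemma concat_inj p q p' q' : q 0 = (fun=> 0) -> q' 0 = (fun=> 0) -> concat p q = concat p' q' ->
  (forall t, t <= 1 -> p t = p' t) /\ (forall t, 0 <= t -> q t = q' t).
Proof.
move=> q0 q0' e.
have h1 t : t <= 1 -> p t = p' t.
  move=> t1.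
  have ht : t / 2 <= 2^-1 by lra.
  apply/funext => v; have := congr1 (fun f => f v) (congr1 (fun f : cpath R V => f (t / 2)) e).
  by rewrite /concat ht (_ : 2 * (t / 2) = t) //; lra.
split=> // t; rewrite le_eqVlt => /orP[/eqP <-|t0]; first by rewrite q0 q0'.
apply/funext => v; have := congr1 (fun f : cpath R V => f ((t + 1) / 2) v) e.
rewrite /concat ifF; last by apply/negP; lra.
rewrite ifF; last by apply/negP; lra.
by rewrite h1 // => /addrI; rewrite (_ : 2 * ((t + 1) / 2) - 1 = t) //; lra.
Qed.

End Paths.
End Concatenation.

(** * Kac-Moody path crystals *)

Section PathCrystal.
Variables (R : realType) (J : eqType) (A : J -> J -> int).
Implicit Types (w v : seq J) (i j : J) (s t : R) (nu xi : J -> nat).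
Hypothesis Adiag : forall i, A i i = 2.
Hypothesis Aoff : forall i j, i <> j -> A i j <= 0.
Hypothesis Azero : forall i j, A i j = 0 <-> A j i = 0.

Local Notation path := (R -> J + J -> R).
Local Notation fop := (@fop R J A).
Local Notation eop := (@eop R J A).
Local Notation mni i eta := (mn (fun t => eta t (inl i)) 0 1).
Local Notation ev := (@ev R J A).
Local Notation adm := (@adm R J A).

(** The root coordinates start at 0, so along generated paths they record minus the amount of each
    simple root subtracted. *)
Definition base nu : path := line (fun z => if z is inl j then (nu j)%:R else 0).

Lemma base_dom nu : domb (base nu).
Proof. by apply: line_dom => i; [exact: ler0n | exact: rpred_nat]. Qed.

Definition gen nu (p : path) : Prop := exists2 v, adm (fw v) (base nu) & p = ev (fw v) (base nu).

Definition pcar nu := {p : path | gen nu p}.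

Definition pval nu (x : pcar nu) : path := proj1_sig x.

Lemma pval_inj nu (x y : pcar nu) : pval x = pval y -> x = y.
Proof. by case: x y => [p hp] [q hq] /= e; subst q; congr exist; exact: Prop_irrelevance. Qed.

Lemma gen_based nu p j : gen nu p -> based (@inl J J) j p.
Proof.
move=> [v a ->]; split; first exact: (dom_nice Adiag Aoff Azero j (base_dom nu) a).
  exact: (ev0 _ (base_dom nu) a).
have [_ h] := dom_out (base_dom nu) a; rewrite /Hf h // rpredD ?intr_int //.
by have [_ _ _] := base_dom nu; apply.
Qed.

Lemma gen_f nu p j : gen nu p -> mni j p + 1 <= p 1 (inl j) -> gen nu (fop j p).
Proof. by move=> [v a ->] h; exists (j :: v). Qed.

Lemma car_gen nu (x : pcar nu) : gen nu (pval x).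
Proof. exact: proj2_sig x. Qed.

Lemma car_based nu (x : pcar nu) j : based (@inl J J) j (pval x).
Proof. exact: gen_based (car_gen x). Qed.

Definition pwt nu (x : pcar nu) j : int := Num.floor (pval x 1 (inl j)).
Definition peps nu j (x : pcar nu) : int := - Num.floor (mni j (pval x)).
Definition pf nu j (x : pcar nu) : pcar nu :=
  match pselect (mni j (pval x) + 1 <= pval x 1 (inl j)) with
  | left h => exist _ (fop j (pval x)) (gen_f (car_gen x) h)
  | right _ => x
  end.

Lemma pwtE nu (x : pcar nu) j : (pwt x j)%:~R = pval x 1 (inl j).
Proof. by rewrite /pwt floorK //; have [_ _] := car_based x j. Qed.

Lemma pepsE nu (x : pcar nu) j : (peps j x)%:~R = - mni j (pval x).
Proof. by rewrite /peps intrN floorK //; have [[_ _ h] _ _] := car_based x j. Qed.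

Lemma pphi nu (x : pcar nu) j : (0 < peps j x + pwt x j) = (mni j (pval x) + 1 <= pval x 1 (inl j)).
Proof.
rewrite gtz0_ge1 -(ler_int R) intrD pepsE pwtE.
by apply/idP/idP; lra.
Qed.

Lemma pfE nu (x : pcar nu) j : 0 < peps j x + pwt x j -> pval (pf j x) = fop j (pval x).
Proof. by rewrite pphi /pf => h; case: pselect. Qed.

Lemma pc_eps_ge0 nu j (x : pcar nu) : 0 <= peps j x.
Proof.
have [[hl _ _] h0 _] := car_based x j.
rewrite -(ler_int R) pepsE oppr_ge0 -[leRHS]h0.
by apply: (mn_le (H := Hf (@inl J J) j (pval x))) => //; rewrite lexx ler01.
Qed.

Lemma pc_phi_ge0 nu j (x : pcar nu) : 0 <= peps j x + pwt x j.
Proof.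
have [[hl _ _] h0 _] := car_based x j.
rewrite -(ler_int R) intrD pepsE pwtE addrC subr_ge0.
by apply: (mn_le (H := Hf (@inl J J) j (pval x))) => //; rewrite lexx ler01.
Qed.

Lemma pc_wt_f nu j (x : pcar nu) : 0 < peps j x + pwt x j ->
  forall k, pwt (pf j x) k = pwt x k - A k j.
Proof.
move=> hp k; apply: (@intr_inj R); rewrite intrB !pwtE pfE //.
have [[hl _ _] h0 _] := car_based x j.
by rewrite pphi in hp; rewrite /fop th_ge1 // mul1r.
Qed.

Lemma pc_eps_f nu j (x : pcar nu) : 0 < peps j x + pwt x j -> peps j (pf j x) = peps j x + 1.
Proof.
move=> hp; apply: (@intr_inj R); rewrite intrD !pepsE pfE // fopH //.
have [hn h0 _] := car_based x j.
by rewrite pphi in hp; rewrite (mn_theta hn hp).2; ring.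
Qed.

Lemma pc_f_inj nu j (x y : pcar nu) : 0 < peps j x + pwt x j -> 0 < peps j y + pwt y j ->
  pf j x = pf j y -> x = y.
Proof.
move=> hx hy /(congr1 (@pval nu)); rewrite !pfE // => e; apply: pval_inj.
have [hn h0 _] := car_based x j; have [hn' h0' _] := car_based y j.
rewrite pphi in hx; rewrite pphi in hy.
have ex := (ef_id (p := pval x) Adiag hn h0 hx).1; have ey := (ef_id (p := pval y) Adiag hn' h0' hy).1.
by rewrite -ex -ey e.
Qed.

Definition pcrys nu : crystal A := @Crystal J A (pcar nu) (@pwt nu) (@peps nu) (@pf nu)
  (@pc_eps_ge0 nu) (@pc_phi_ge0 nu) (@pc_wt_f nu) (@pc_eps_f nu) (@pc_f_inj nu).

Lemma gen_base nu : gen nu (base nu). Proof. by exists [::]. Qed.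

Definition pb nu : pcrys nu := exist _ (base nu) (gen_base nu).

Lemma pval_F nu w : dw w (pb nu) -> adm (fw w) (base nu) /\ pval (F w (pb nu)) = ev (fw w) (base nu).
Proof.
elim: w => //= j w IH [/IH[a e] hp]; rewrite pfE // e; split=> //; split=> //.
by move: hp; rewrite /phi pphi e.
Qed.

Lemma dw_adm nu w : adm (fw w) (base nu) -> dw w (pb nu).
Proof.
elim: w => //= j w IH [/IH d h]; split=> //; have [_ e] := pval_F d.
by rewrite /phi pphi e.
Qed.

Lemma pb_wt nu j : wt (pb nu) j = (nu j)%:Z.
Proof. by apply: (@intr_inj R); rewrite /= pwtE /= /base /line mul1r. Qed.

Lemma pb_eps nu j : eps j (pb nu) = 0.
Proof. by apply: (@intr_inj R); rewrite /= pepsE (dom_mni0 _ (base_dom nu)) oppr0. Qed.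

Lemma pb_last nu w j : dw w (pb nu) -> 0 < eps j (F w (pb nu)) ->
  exists w', [/\ dw (j :: w') (pb nu), F (j :: w') (pb nu) = F w (pb nu) & perm_eq (j :: w') w].
Proof.
move=> d; have [a e] := pval_F d; rewrite gtz0_ge1 -(ler_int R) /= pepsE e => h.
have [|w' [a' e' p]] := dom_last Adiag Aoff Azero (base_dom nu) a (i := j); first by lra.
have d' := dw_adm a'; exists w'; split=> //.
by apply: pval_inj; rewrite e -e'; have [_] := pval_F d'.
Qed.

Lemma gen_out nu p : gen nu p -> (forall t, t <= 0 -> p t = base nu t) /\
  forall t z, 1 <= t -> p t z = base nu t z - base nu 1 z + p 1 z.
Proof.
move=> [v a ->]; have [h0 h1] := dom_out (base_dom nu) a; split=> // t z t1.
by rewrite !h1 //; ring.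
Qed.

(** Paths are total functions of t; outside [[0, 1]] a generated path is a shift of its base, so
    Leibniz equality follows from equality on the interval. *)
Lemma gen_eq nu p q : gen nu p -> gen nu q -> (forall t, 0 <= t <= 1 -> p t = q t) -> p = q.
Proof.
move=> /gen_out[p0 p1] /gen_out[q0 q1] h; apply/funext => t.
have [t0|t0] := lerP t 0; first by rewrite p0 ?q0.
have [t1|t1] := lerP t 1; first by apply: h; lra.
by apply/funext => z; rewrite (p1 _ _ (ltW t1)) (q1 _ _ (ltW t1)) h // ler01 lexx.
Qed.

Local Notation tens := (tensor Adiag).

Lemma tens_eps nu xi (b : tens (pcrys nu) (pcrys xi)) j :
  (eps j b)%:~R = - mni j (concat (pval b.1) (pval b.2)).
Proof.
have e1 := car_based b.1 j; have e2 := car_based b.2 j.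
rewrite [X in - X](mn_K01 e1 e2) /= /teps /phi /= -(ltr_int R) intrD !pepsE pwtE.
case: ifPn => h; rewrite ?pepsE ?intrB ?pepsE ?pwtE.
  by congr (- _); apply/esym/min_l; move: h; rewrite /Hf; lra.
rewrite -leNgt in h; rewrite min_r; last by move: h; rewrite /Hf; lra.
by rewrite /Hf; ring.
Qed.

Lemma tens_phi nu xi (b : tens (pcrys nu) (pcrys xi)) j :
  (0 < phi j b) = (mni j (concat (pval b.1) (pval b.2)) + 1 <= concat (pval b.1) (pval b.2) 1 (inl j)).
Proof.
rewrite gtz0_ge1 -(ler_int R) intrD tens_eps [wt _ _]/(twt b j) /twt intrD concat_1 /= !pwtE.
by apply/idP/idP; lra.
Qed.

Lemma tens_f nu xi (b : tens (pcrys nu) (pcrys xi)) j : 0 < phi j b ->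
  concat (pval (fc j b).1) (pval (fc j b).2) = fop j (concat (pval b.1) (pval b.2)).
Proof.
have e1 := car_based b.1 j; have e2 := car_based b.2 j.
have p1 := pc_phi_ge0 j b.1; have p2 := pc_phi_ge0 j b.2.
have q1 := pc_eps_ge0 j b.1; have q2 := pc_eps_ge0 j b.2.
rewrite {1}/phi /= /teps /twt /tf /=; case: ifPn; rewrite /phi /= => h hp.
  rewrite pfE; last exact: (le_lt_trans q2 h).
  apply/esym; apply: (fg_concat (rootv A) e1 e2).
  by move: h; rewrite -(ltr_int R) intrD !pepsE pwtE /Hf; lra.
rewrite pfE; last by move: hp; rewrite addrA subrK.
apply/esym; apply: (fg_concat' (rootv A) e1 e2).
by move: h; rewrite -leNgt -(ler_int R) intrD !pepsE pwtE /Hf; lra.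
Qed.

Section Sum.
Variables nu xi : J -> nat.
Local Notation X := (concat (base nu) (base xi)).
Local Notation b0 := ((pb nu, pb xi) : tens (pcrys nu) (pcrys xi)).

Local Lemma X_dom : domb X.
Proof.
have [l1 z1 m1 i1] := base_dom nu; have [l2 z2 m2 i2] := base_dom xi; split.
- move=> z; apply: (lip_hcat (H := fun t => base nu t z) (G := fun t => base xi t z)) => //.
- move=> z; rewrite /concat ifT ?mulr0 //; lra.
- move=> i s t s0 st t1; rewrite /concat; case: ifPn => h1; case: ifPn => h2.
  + by apply: m1; lra.
  + apply: (@le_trans _ _ (base nu 1 (inl i))); first by apply: m1; lra.
    by rewrite lerDl -(z2 (inl i)); apply: m2; lra.
  + by exfalso; lra.
  + by rewrite lerD2l; apply: m2; lra.
- by move=> i; rewrite concat_1 rpredD.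
Qed.

Local Lemma X_val w : dw w b0 -> adm (fw w) X /\
  concat (pval (F w b0).1) (pval (F w b0).2) = ev (fw w) X.
Proof.
elim: w => //= j w IH [/IH[a e] hp]; split; first by split=> //; move: hp; rewrite tens_phi e.
by rewrite -e; apply: tens_f.
Qed.

(** The concatenation of two straight dominant lines is itself a dominant base with the endpoint
    pairings of the straight line for the sum, so [dom_iso] and [dom_coincide] compare the two. *)
Lemma pb_sum n : sim n b0 (pb (fun j => nu j + xi j)%N).
Proof.
set Y := base (fun j => nu j + xi j)%N.
have hY : domb Y by apply: base_dom.
have XY i : X 1 (inl i) = Y 1 (inl i) by rewrite concat_1 /Y /base /line !mul1r natrD.
have YX i : Y 1 (inl i) = X 1 (inl i) by rewrite XY.
move=> w w' _ _ /X_val[a e] /X_val[a' e'].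
have [aY mY] := dom_iso Adiag Aoff Azero X_dom hY XY a.
have [aY' mY'] := dom_iso Adiag Aoff Azero X_dom hY XY a'.
have dY := dw_adm aY; have dY' := dw_adm aY'.
have [_ eY] := pval_F dY; have [_ eY'] := pval_F dY'.
split=> // [j|].
  by apply: (@intr_inj R); rewrite tens_eps e [RHS]pepsE eY mY.
split=> h.
  apply: pval_inj; rewrite eY eY'.
  by apply: (dom_coincide Adiag Aoff Azero X_dom hY XY a a'); rewrite -e -e' h.
have := congr1 (@pval _) h; rewrite eY eY' => h1.
have := dom_coincide Adiag Aoff Azero hY X_dom YX aY aY' h1; rewrite -e -e' => h2.
have z0 mu (x : pcar mu) : pval x 0 = (fun=> 0).
  have [g0 _] := gen_out (car_gen x); rewrite g0 //.
  by apply/funext => z; rewrite /base /line mul0r.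
have [h3 h4] := concat_inj (z0 _ _) (z0 _ _) h2.
rewrite (surjective_pairing (F w b0)) (surjective_pairing (F w' b0)); congr pair.
  by apply: pval_inj; apply: gen_eq (car_gen _) (car_gen _) _ => t ht; apply: h3; lra.
by apply: pval_inj; apply: gen_eq (car_gen _) (car_gen _) _ => t ht; apply: h4; lra.
Qed.
End Sum.

End PathCrystal.

(** * Lifting to the Kac-Moody datum *)

Section Lifting.
Variables (R : realType) (J1 J2 : eqType) (A1 : J1 -> J1 -> int) (A2 : J2 -> J2 -> int).
Variables (V : Type) (cv : J1 -> V) (rt : J1 -> V -> int) (pr : J2 -> J1).
Implicit Types (i j : J1) (c d : J2) (W U : seq J2) (s t : R) (p : cpath R V).
Hypothesis A1BC : BC_matrix A1.
Hypothesis rtA : forall i j, rt j (cv i) = A1 i j.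
Hypothesis A2E : forall c d, A2 c d = if c == d then 2 else A1 (pr c) (pr d).
Hypothesis pr_real : forall c d, A1 (pr c) (pr c) = 2 -> pr c = pr d -> c = d.

Definition imag i := ~~ is_real_idx A1 i.

Lemma imagP i : imag i -> A1 i i <= 0.
Proof. by move=> /eqP h; case: (A1BC.1 i). Qed.

Lemma A1_imag i j : imag i -> A1 i j <= 0.
Proof.
have [_ [h _]] := A1BC => hi; have [<-|/eqP] := eqVneq i j; first exact: imagP.
exact: h.
Qed.

Lemma A2diag c : A2 c c = 2. Proof. by rewrite A2E eqxx. Qed.

Lemma A2off c d : c <> d -> A2 c d <= 0.
Proof.
move=> cd; rewrite A2E; case: eqP => // _; have [e|/eqP ne] := eqVneq (pr c) (pr d).
  rewrite e; case: (A1BC.1 (pr d)) => // h; case: cd; apply: pr_real => //.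
  by rewrite e.
by have [_ [h _]] := A1BC; apply: h.
Qed.

Lemma A2zero c d : A2 c d = 0 <-> A2 d c = 0.
Proof. by rewrite !A2E eq_sym; case: eqP => // _; have [_ [_ h]] := A1BC; apply: h. Qed.

Local Notation fop := (@fop R J2 A2).
Local Notation pcrys := (pcrys R A2diag A2off A2zero).
Local Notation pb := (pb R A2diag A2off A2zero).

Section Base.
Variables (ok : pred J2) (n : J2 -> nat) (nu : V -> R).
Hypothesis nu_n : forall c, ok c -> nu (cv (pr c)) = (n c)%:R.

(** Multiplicity free at imaginary labels, with all labels taken from [ok]; real letters may
    repeat. *)
Fixpoint mf W : bool :=
  if W is c :: W' then [&& ok c, ~~ imag (pr c) || (c \notin W') & mf W'] else true.

(** The pairings of p and of its lift agree only at real labels and labels not yet applied: once c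
    is applied, the entry 2 on one side and a_ii on the other drive them apart. *)
Definition Rel W p (x : R -> J2 + J2 -> R) :=
  (forall c, ok c -> ~~ imag (pr c) || (c \notin W) -> Hf cv (pr c) p = fun t => x t (inl c)) /\
  (forall c, ok c -> imag (pr c) -> incH cv (pr c) p).

Lemma rel_base : Rel [::] (Defs.pi_of nu) (@base R J2 n).
Proof.
split=> c hc; first by move=> _; apply/funext => t; rewrite /Hf /Defs.pi_of nu_n.
by move=> _ s t s0 st t1; rewrite /Hf /Defs.pi_of nu_n // ler_wpM2r.
Qed.

Lemma rel_f W p x c : ok c -> ~~ imag (pr c) || (c \notin W) -> lip (fun t => x t (inl c)) ->
  Rel W p x -> Rel (c :: W) (fg cv rt (pr c) p) (fop c x).
Proof.
move=> okc fc lx [h1 h2]; have e := h1 c okc fc.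
split=> d okd.
  rewrite inE negb_or => hd; have {}hd' : ~~ imag (pr d) || (d \notin W).
    by case/orP: hd => [->//|/andP[_ ->]]; rewrite orbT.
  apply/funext => t; rewrite {1}/Hf /fg e -/(Hf cv (pr d) p t) h1 //.
  rewrite /fop /rootR /= A2E /aR rtA; congr (_ - _ * _%:~R).
  case: eqP => [dc|//]; move: hd; rewrite dc eqxx /= orbF.
  by move=> /negPn/eqP.
move=> di s t s0 st t1; rewrite /Hf /fg -!/(Hf cv (pr d) p _) /aR rtA e.
have h := h2 d okd di s t s0 st t1.
have a0 : (A1 (pr d) (pr c))%:~R <= 0 :> R.
  by rewrite -[0]/((0 : int)%:~R) ler_int A1_imag.
have := th_mono lx st; nra.
Qed.

Lemma rel_based W p nn (x : pcar R A2 nn) c : ok c -> ~~ imag (pr c) || (c \notin W) ->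
  Rel W p (pval x) -> based cv (pr c) p.
Proof.
move=> okc fc [h _]; rewrite /based h //.
exact: (gen_based A2diag A2off A2zero c (proj2_sig x)).
Qed.

Lemma rel_root_f W p nn (x : pcrys nn) c : ok c -> ~~ imag (pr c) || (c \notin W) ->
  Rel W p (pval x) ->
  root_f cv rt (pr c) p = if 0 < phi c x then Some (fg cv rt (pr c) p) else None.
Proof.
move=> okc fc h; rewrite root_fE; last exact: rel_based fc h.
have [h1 _] := h; rewrite h1 //.
by rewrite /phi (pphi A2diag A2off A2zero).
Qed.

Lemma FwS i w p : Fw cv rt (i :: w) p = obind (root_f cv rt i) (Fw cv rt w p).
Proof. by []. Qed.

Lemma lift_dw W : mf W -> dw W (pb n) ->
  exists2 p, Fw cv rt (map pr W) (Defs.pi_of nu) = Some p & Rel W p (pval (F W (pb n))).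
Proof.
elim: W => [_ _|c W IH /and3P[okc fc mW] /= [dW hp]].
  by exists (Defs.pi_of nu) => //; exact: rel_base.
have [p e hR] := IH mW dW; exists (fg cv rt (pr c) p).
  by rewrite e /= (rel_root_f okc fc hR) hp.
rewrite [pval _](pfE A2diag A2off A2zero hp); apply: rel_f => //.
by have [[]] := gen_based A2diag A2off A2zero c (proj2_sig (F W (pb n))).
Qed.

Lemma lift_Fw W p : mf W -> Fw cv rt (map pr W) (Defs.pi_of nu) = Some p -> dw W (pb n).
Proof.
elim: W p => // c W IH p /and3P[okc fc mW]; rewrite map_cons FwS.
case e: (Fw _ _ _ _) => [q|//] hq; have dW := IH q mW e; split=> //.
have [q' e' hR] := lift_dw mW dW; move: e'; rewrite e => -[eq]; rewrite -eq in hR.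
by move: hq => /=; rewrite (rel_root_f okc fc hR); case: ifP.
Qed.

Lemma lift_rel W p : mf W -> Fw cv rt (map pr W) (Defs.pi_of nu) = Some p ->
  dw W (pb n) /\ Rel W p (pval (F W (pb n))).
Proof.
move=> mW e; have dW := lift_Fw mW e; split=> //.
by have [q e' h] := lift_dw mW dW; move: e'; rewrite e => -[->].
Qed.

Lemma big_pick (s : seq J2) c (a : J2 -> R) (k : R) : uniq s -> c \in s ->
  \sum_(d <- s) (if d == c then k else 0) * a d = k * a c.
Proof.
move=> us cs; rewrite (bigD1_seq c) //= eqxx big1 ?addr0 // => d /negPf ->.
by rewrite mul0r.
Qed.

(* The coordinates [inr c] of the Kac-Moody path record how much of each root was subtracted. *)
Lemma lift_expand W p (s : seq J2) : mf W -> Fw cv rt (map pr W) (Defs.pi_of nu) = Some p ->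
  uniq s -> {subset W <= s} -> let x := pval (F W (pb n)) in
  [/\ forall t v, p t v = t * nu v + \sum_(c <- s) x t (inr c) * (rt (pr c) v)%:~R,
      forall t d, x t (inl d) = t * (n d)%:R + \sum_(c <- s) x t (inr c) * (A2 d c)%:~R &
      forall t c, c \notin W -> x t (inr c) = 0].
Proof.
elim: W p => [|c W IH] p mW e us sub /=.
  case: e => <-; have b0 t c : base n t (inr c) = 0 :> R.
    by rewrite /base /line mulr0.
  by split=> [t v|t d|t c _] //; rewrite big1 ?addr0 // => c _; exact: (etrans (congr1 (fun y => y * _) (b0 t c)) (mul0r _)).
have [[_ hp] _] := lift_rel mW e.
have /and3P[okc fc mW'] := mW; move: e; rewrite map_cons FwS.
case e: (Fw _ _ _ _) => [q|//] /=; have [_ hR] := lift_rel mW' e.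
rewrite (rel_root_f okc fc hR) hp => -[<-].
have sub' : {subset W <= s} by move=> d hd; apply: sub; rewrite inE hd orbT.
have cs : c \in s by apply: sub; rewrite mem_head.
have [E1 E2 E3] := IH q mW' e us sub'.
rewrite [pval _](pfE A2diag A2off A2zero hp); set x := pval (F W (pb n)) in E1 E2 E3 hR *.
have hth : Hf cv (pr c) q = fun t => x t (inl c) by have [h _] := hR; apply: h.
have key t d : fop c x t (inr d) = x t (inr d) + (if d == c then - th (fun t => x t (inl c)) t else 0).
  by rewrite /fop /rootR /=; case: (d == c); rewrite ?mulr1 ?mulr0 ?oppr0.
have S t (k : J2 -> R) : \sum_(d <- s) fop c x t (inr d) * k d =
    \sum_(d <- s) x t (inr d) * k d - th (fun t => x t (inl c)) t * k c.
  under eq_bigr do rewrite key mulrDl.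
  by rewrite big_split big_pick //= mulNr.
split=> [t v|t d|t d].
- by rewrite /fg hth E1 S addrA.
- by rewrite S addrA -E2.
- by rewrite inE negb_or key => /andP[/negPf -> /E3 ->]; rewrite addr0.
Qed.

(** By [lift_expand] the path is a function of the root coordinates of its lift. *)
Lemma lift_proj W W' p p' : mf W -> mf W' -> Fw cv rt (map pr W) (Defs.pi_of nu) = Some p ->
  Fw cv rt (map pr W') (Defs.pi_of nu) = Some p' -> F W (pb n) = F W' (pb n) -> p = p'.
Proof.
move=> m m' e e' h; have us := undup_uniq (W ++ W').
have [|E1 _ _] := lift_expand m e us.
  by move=> c hc; rewrite mem_undup mem_cat hc.
have [|E1' _ _] := lift_expand m' e' us.
  by move=> c hc; rewrite mem_undup mem_cat hc orbT.
by apply/funext => t; apply/funext => v; rewrite E1 E1' h.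
Qed.

End Base.
End Lifting.

(** * Recovering slopes from truncated linear functions, and independence over the reals *)

Section Decoding.
Variable R : realType.
Implicit Types (s : seq R) (t n : R).

Definition ramps s t := \sum_(n <- s) Num.min 1 (n * t).

Lemma ramps_linear s t : {in s, forall n, n * t <= 1} -> ramps s t = (\sum_(n <- s) n) * t.
Proof.
move=> h; rewrite /ramps mulr_suml; apply: eq_big_seq => n ns.
by rewrite min_r // h.
Qed.

Lemma ramps_le s t : ramps s t <= (\sum_(n <- s) n) * t.
Proof. by rewrite /ramps mulr_suml; apply: ler_sum => n _; rewrite ge_min lexx orbT. Qed.

Lemma ramps1 s : {in s, forall n, 1 <= n} -> ramps s 1 = (size s)%:R.
Proof.
elim: s => [|a s IH] h; first by rewrite /ramps big_nil.
rewrite /ramps big_cons mulr1 min_l ?h ?mem_head //.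
by rewrite -/(ramps s 1) IH ?natrD ?nat1r // => n ns; apply: h; rewrite inE ns orbT.
Qed.

(** A sum of ramps is linear until the reciprocal of its largest slope. If b exceeded a, both sums
    would have the same total slope, yet at time 1/a the second would already lie strictly below the
    line. *)
Lemma ramps_head a b s s' : (forall n, n \in a :: s -> 1 <= n <= a) ->
  (forall n, n \in b :: s' -> 1 <= n <= b) ->
  (forall t, 0 <= t <= 1 -> ramps (a :: s) t = ramps (b :: s') t) -> b <= a.
Proof.
move=> ha hb h; rewrite leNgt; apply/negP => ab.
have a1 : 1 <= a by have := ha a (mem_head _ _); rewrite lexx andbT.
have b1 : 1 <= b by lra.
have inv (x : R) : 1 <= x -> [/\ 0 <= x^-1, x^-1 <= 1 & x * x^-1 = 1].
  move=> x1; have x0 : 0 < x by lra.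
  by split; [rewrite invr_ge0; lra | rewrite invf_le1 | rewrite mulfV // gt_eqF].
have [ia0 ia1 iaE] := inv a a1; have [ib0 ib1 ibE] := inv b b1.
have lt : b^-1 < a^-1 by rewrite ltf_pV2 // posrE; lra.
have L t : 0 <= t -> t <= a^-1 -> ramps (a :: s) t = (\sum_(n <- a :: s) n) * t.
  move=> t0 ta; apply: ramps_linear => // n /ha/andP[n1 na].
  apply: (@le_trans _ _ (a * a^-1)); last by rewrite iaE.
  by apply: ler_pM => //; lra.
have L' : ramps (b :: s') b^-1 = (\sum_(n <- b :: s') n) * b^-1.
  by apply: ramps_linear => // n /hb/andP[n1 nb]; rewrite -ibE ler_wpM2r.
have e1 : \sum_(n <- a :: s) n = \sum_(n <- b :: s') n.
  have bi : 0 < b^-1 by rewrite invr_gt0; lra.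
  apply: (mulIf (lt0r_neq0 bi)); rewrite -L' -h; last by rewrite ib0.
  by rewrite L //; lra.
have := h a^-1; rewrite ia0 ia1 => /(_ isT); rewrite L // e1.
rewrite /ramps !big_cons -/(ramps s' _) => e2.
have ba : 1 < b * a^-1 by rewrite -iaE ltr_pM2r // invr_gt0; lra.
have := ramps_le s' a^-1; move: e2; rewrite min_l; last lra.
rewrite mulrDl; lra.
Qed.

Lemma ramps_inj s s' : sorted >=%R s -> sorted >=%R s' ->
  {in s, forall n, 1 <= n} -> {in s', forall n, 1 <= n} ->
  (forall t, 0 <= t <= 1 -> ramps s t = ramps s' t) -> s = s'.
Proof.
have ge_tr : transitive (>=%R : rel R) by move=> x y z /= h1 h2; apply: le_trans h2 h1.
elim: s s' => [|a s IH] [|b s'] //= so so' h h' e.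
- by have := e 1; rewrite !ramps1 // ler01 lexx => /(_ isT) /eqP; rewrite eqr_nat.
- by have := e 1; rewrite !ramps1 // ler01 lexx => /(_ isT) /eqP; rewrite eqr_nat.
have hd x l : path >=%R x l -> {in x :: l, forall n, 1 <= n} -> forall n, n \in x :: l -> 1 <= n <= x.
  move=> pxl hx n nl; rewrite hx //=; move: nl; rewrite inE => /orP[/eqP -> //|nl].
  by have /allP/(_ n nl) := order_path_min ge_tr pxl.
have ab : a = b.
  apply/eqP; rewrite eq_le; apply/andP; split.
    by apply: (@ramps_head b a s' s); [exact: hd | exact: hd | move=> t ht; rewrite e].
  by apply: (@ramps_head a b s s'); [exact: hd | exact: hd | exact: e].
subst b; congr cons; apply: IH; rewrite ?(path_sorted so) ?(path_sorted so') //.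
- by move=> n ns; apply: h; rewrite inE ns orbT.
- by move=> n ns; apply: h'; rewrite inE ns orbT.
- by move=> t ht; have := e t ht; rewrite /ramps !big_cons => /addrI.
Qed.

(** Integral independence implies real independence by fraction-free elimination: [g] clears the
    value at v0 against the pivot [f k v0]. *)
Lemma indep_real (J V : eqType) (f : J -> V -> int) (s : seq J) : uniq s ->
  (forall c : J -> int, (forall v, \sum_(j <- s) c j * f j v = 0) -> forall j, j \in s -> c j = 0) ->
  forall c : J -> R, (forall v, \sum_(j <- s) c j * (f j v)%:~R = 0) ->
  forall j, j \in s -> c j = 0.
Proof.
elim: s f => // k s IH f /= /andP[ks us] hZ c hc.
have [v0 hv0] : exists v, f k v != 0.
  apply: contrapT => hn; have := hZ (fun j => (j == k)%:Z) _ k (mem_head _ _).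
  rewrite eqxx => h; suff : (1 : int) = 0 by [].
  apply: h => v; rewrite big_cons eqxx mul1r big1_seq ?addr0; last first.
    by move=> j /= js; rewrite (negPf (memPn ks j js)) mul0r.
  by apply/eqP/negPn/negP => hv; apply: hn; exists v.
pose g j v := f k v0 * f j v - f j v0 * f k v.
have hs : forall j, j \in s -> c j = 0.
  apply: (IH g us).
    move=> d hd j js.
    have := hZ (fun j => if j == k then - \sum_(j <- s) d j * f j v0 else f k v0 * d j) _ j.
    rewrite inE js orbT (negPf (memPn ks j js)) => h.
    have /eqP : f k v0 * d j = 0.
      apply: h => // v; rewrite big_cons eqxx -[RHS](hd v).
      rewrite [X in _ + X](eq_big_seq (fun j => f k v0 * d j * f j v)); last first.
        by move=> i si; rewrite (negPf (memPn ks i si)).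
      rewrite mulNr mulr_suml -sumrN -big_split /=; apply: eq_bigr => i _.
      by rewrite /g; ring.
    by rewrite mulf_eq0 (negPf hv0) /= => /eqP.
  move=> v; have e0 := hc v0; have e := hc v; rewrite !big_cons in e0 e.
  have -> : \sum_(j <- s) c j * (g j v)%:~R =
      (f k v0)%:~R * (\sum_(j <- s) c j * (f j v)%:~R) -
      (\sum_(j <- s) c j * (f j v0)%:~R) * (f k v)%:~R.
    rewrite mulr_sumr mulr_suml -sumrB; apply: eq_bigr => i _.
    by rewrite /g intrB !intrM; ring.
  move: e e0; set X := \sum_(j <- s) _; set Y := \sum_(j <- s) _ => e e0.
  have -> : X = - (c k * (f k v)%:~R) by apply/eqP; rewrite -addr_eq0 addrC e.
  have -> : Y = - (c k * (f k v0)%:~R) by apply/eqP; rewrite -addr_eq0 addrC e0.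
  by ring.
move=> j; rewrite inE => /orP[/eqP ->|]; last exact: hs.
have := hc v0; rewrite big_cons big1_seq ?addr0; last by move=> i /= si; rewrite hs ?mul0r.
by move=> /eqP; rewrite mulf_eq0 intr_eq0 (negPf hv0) orbF => /eqP.
Qed.

End Decoding.

(** * Standard labellings and injectivity of the lift *)

Section StandardLabels.
Variables (R : realType) (J1 J2 : eqType) (A1 : J1 -> J1 -> int) (A2 : J2 -> J2 -> int).
Variables (V : eqType) (cv : J1 -> V) (rt : J1 -> V -> int) (pr : J2 -> J1).
Implicit Types (i j : J1) (c d : J2) (w : seq J1) (s t : R) (p : cpath R V).
Hypothesis A1BC : BC_matrix A1.
Hypothesis rtA : forall i j, rt j (cv i) = A1 i j.
Hypothesis A2E : forall c d, A2 c d = if c == d then 2 else A1 (pr c) (pr d).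
Hypothesis pr_real : forall c d, A1 (pr c) (pr c) = 2 -> pr c = pr d -> c = d.
Variable dm : J2 -> nat.
Hypothesis dm_gt0 : forall c, (0 < dm c)%N.
Hypothesis dmA : forall c d, (dm c)%:Z * A2 c d = (dm d)%:Z * A2 d c.
Hypothesis rt_indep : forall (s : seq J1) (c : J1 -> int), uniq s ->
  (forall v, \sum_(j <- s) c j * rt j v = 0) -> forall j, j \in s -> c j = 0.
Variable lab : J1 -> nat -> J2.
Hypothesis pr_lab : forall i m, pr (lab i m) = i.
Hypothesis lab_inj : forall i m m', imag A1 i -> lab i m = lab i m' -> m = m'.

Local Notation imag := (imag A1).
Local Notation A2d := (A2diag A2E).
Local Notation A2o := (A2off A1BC A2E pr_real).
Local Notation A2z := (A2zero A1BC A2E).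
Local Notation fop := (@fop R J2 A2).
Local Notation pcrys := (pcrys R A2d A2o A2z).
Local Notation pb := (pb R A2d A2o A2z).

Variable o : J1 -> nat.

(** The labels available when the first [o i] labels over each imaginary i have been consumed, in
    practice by the right tensor factor. *)
Definition okl c : bool :=
  ~~ imag (pr c) || `[< exists2 m, (o (pr c) <= m)%N & c = lab (pr c) m >].

(* Labels the letters of a word; the last letter is applied first, and [o i] labels of [i]
   are skipped. *)
Fixpoint lw w : seq J2 :=
  if w is i :: w' then lab i (o i + count_mem i w')%N :: lw w' else [::].

Lemma lw_pr w : map pr (lw w) = w.
Proof. by elim: w => //= i w ->; rewrite pr_lab. Qed.

Lemma okl_lab i m : (o i <= m)%N -> okl (lab i m).
Proof. by move=> h; apply/orP; right; apply/asboolP; exists m; rewrite pr_lab. Qed.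

Lemma mem_lw w c : c \in lw w -> exists m,
  [/\ (o (pr c) <= m)%N, (m < o (pr c) + count_mem (pr c) w)%N & c = lab (pr c) m].
Proof.
elim: w => //= i w IH; rewrite inE => /orP[/eqP ->|/IH[m [h1 h2 h3]]].
  rewrite pr_lab; exists (o i + count_mem i w)%N; rewrite eqxx; split=> //; lia.
by exists m; split=> //; apply: leq_trans h2 _; rewrite leq_add2l leq_addl.
Qed.

Lemma lw_fresh w i : ~~ imag i || (lab i (o i + count_mem i w) \notin lw w).
Proof.
have [im|//] := boolP (imag i); rewrite /=; apply/negP => /mem_lw[m]; rewrite pr_lab.
by move=> [_ h e]; have := lab_inj im e; lia.
Qed.

Lemma lw_mf w : mf A1 pr okl (lw w).
Proof.
by elim: w => //= i w ->; rewrite pr_lab lw_fresh okl_lab // leq_addr.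
Qed.

Variables (n : J2 -> nat) (nu : V -> R).
Hypothesis nu_n : forall c, okl c -> nu (cv (pr c)) = (n c)%:R.

Lemma lab_real i m m' : ~~ imag i -> lab i m = lab i m'.
Proof. by rewrite negbK => /eqP h; apply: pr_real; rewrite !pr_lab. Qed.

(** [S i] is the total amount of the i-th root subtracted and [sl i] lists the slopes of the letters
    i, the most recent first. The last clause, a lower bound for pairings with fresh labels, makes
    each new slope at least the earlier ones and so keeps the list sorted. *)
Lemma lift_slopes w p u : uniq u -> {subset w <= u} -> Fw cv rt w (Defs.pi_of nu) = Some p ->
  let x := pval (F (lw w) (pb n)) in
  exists (S : J1 -> R -> R) (sl : J1 -> seq R),
  [/\ forall t v, p t v = t * nu v - \sum_(i <- u) S i t * (rt i v)%:~R,
      forall i t, ~~ imag i -> x t (inr (lab i 0)) = - S i t,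
      forall i, imag i -> [/\ forall t, 0 <= t <= 1 -> S i t = ramps (sl i) t,
        size (sl i) = count_mem i w, sorted >=%R (sl i) & {in sl i, forall y, 1 <= y}] &
      forall i, imag i ->
        (forall m t, (m < count_mem i w)%N -> 0 <= t <= 1 ->
          x t (inr (lab i (o i + m))) = - Num.min 1 (nth 0 (rev (sl i)) m * t)) /\
        (forall c y t, okl c -> pr c = i -> c \notin lw w -> y \in sl i -> 0 <= t <= 1 ->
          Num.min 1 (y * t) <= x t (inl c))].
Proof.
move=> uu; elim: w p => [|j w IH] p sub e x1.
  have b0 t c : base n t (inr c) = 0 :> R by rewrite /base /line mulr0.
  case: e => <-; exists (fun _ _ => 0), (fun _ => [::]); split=> //.
  - by move=> t v; rewrite big1 ?subr0 // => i _; rewrite mul0r.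
  - by move=> i t _; rewrite oppr0; exact: b0.
  - by move=> i _; split=> // t _; rewrite /ramps big_nil.
have sub' : {subset w <= u} by move=> i iw; apply: sub; rewrite inE iw orbT.
have ju : j \in u by apply: sub; rewrite mem_head.
have mW := lw_mf w; have mW' := lw_mf (j :: w).
have := e; rewrite -{1}(lw_pr (j :: w)) => e1.
have [[_ hp] _] := lift_rel A1BC rtA A2E pr_real nu_n mW' e1.
move: e; rewrite FwS; case e: (Fw _ _ _ _) => [q|//] /=.
have := e; rewrite -{1}(lw_pr w) => e2.
have [dW hR] := lift_rel A1BC rtA A2E pr_real nu_n mW e2.
have [S [sl [I1 I2 I3 I4]]] := IH q sub' e.
set c0 := lab j (o j + count_mem j w) in hp *.
have pc0 : pr c0 = j by rewrite /c0 pr_lab.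
have ok0 : okl c0 by apply: okl_lab; rewrite leq_addr.
have fr0 : ~~ imag (pr c0) || (c0 \notin lw w) by rewrite pc0 lw_fresh.
have rf := rel_root_f rt ok0 fr0 hR; rewrite pc0 hp in rf; rewrite rf => -[<-].
have -> : x1 = fop c0 (pval (F (lw w) (pb n))) by exact: (pfE A2d A2o A2z hp).
set x := pval _ in I2 I4 hR *.
pose th0 t := th (fun t => x t (inl c0)) t.
have hth : Hf cv j q = fun t => x t (inl c0) by rewrite -pc0; have [h _] := hR; apply: h.
have keyr t c : fop c0 x t (inr c) = x t (inr c) - (if c == c0 then th0 t else 0).
  by rewrite /fop /rootR /= -/(th0 t); case: (c == c0); rewrite ?mulr1 ?mulr0.
have keyl t c : fop c0 x t (inl c) = x t (inl c) - th0 t * (A2 c c0)%:~R by [].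
have [hn h0 _] := car_based A2d A2o A2z (F (lw w) (pb n)) c0; have [hl _ _] := hn.
have th00 t : 0 <= th0 t by apply: th_ge0.
pose S' i t := S i t + (if i == j then th0 t else 0).
have S1 t v : fg cv rt j q t v = t * nu v - \sum_(i <- u) S' i t * (rt i v)%:~R.
  rewrite /fg hth I1 /S'; under [X in _ = _ - X]eq_bigr => i _ do rewrite mulrDl.
  by rewrite big_split big_pick //= opprD addrA.
have S2 i t : ~~ imag i -> fop c0 x t (inr (lab i 0)) = - S' i t.
  move=> im; rewrite keyr I2 // /S' opprD; congr (_ - _).
  have [ij|ij] := eqVneq i j.
    by rewrite ij /c0 (lab_real 0 (o j + count_mem j w)) ?eqxx // -ij.
  by case: eqP => // /(congr1 pr); rewrite pc0 pr_lab => h; rewrite h eqxx in ij.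
have mono c t : okl c -> imag (pr c) -> c \notin lw (j :: w) -> x t (inl c) <= fop c0 x t (inl c).
  move=> okc ic; rewrite inE negb_or => /andP[/eqP cc _]; rewrite keyl lerDl -mulrN mulr_ge0 //.
  by rewrite oppr_ge0 -[0]/((0:int)%:~R) ler_int; apply: A2o.
have [jim|jre] := boolP (imag j); last first.
  have ne i : imag i -> (i == j) = false.
    by move=> im; apply/eqP => ij; move: jre; rewrite -ij im.
  exists S', sl; split=> // i im.
    by have [t1 t2 t3 t4] := I3 i im; rewrite eq_sym ne // add0n; split=> // t ht;
       rewrite /S' ne // addr0; apply: t1.
  have [k1 k2] := I4 i im; split.
    move=> m t; rewrite eq_sym ne // add0n => hm ht; rewrite keyr k1 // ifF ?subr0 //.
    by apply/eqP => /(congr1 pr); rewrite pc0 pr_lab => h; move: jre; rewrite -h im.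
  move=> c y t okc pc hc ys ht; apply: le_trans (mono c t okc _ hc); last by rewrite pc.
  by apply: k2 => //; move: hc; rewrite inE negb_or => /andP[].
have fr : c0 \notin lw w by move: fr0; rewrite pc0 jim.
have [aW eW] := pval_F dW.
pose n0 (z : J2 + J2) : R := if z is inl c then (n c)%:R else 0.
have [y0 y00 hy] := line_theta A2d A2o A2z dm_gt0 dmA (nu := n0) (fun c => ler0n R (n c))
  (fun c => rpred_nat _ (n c)) fr aW.
have hth0 t : 0 <= t <= 1 -> th0 t = Num.min 1 (y0 * t) by move=> ht; rewrite /th0 /x eW; apply: hy.
have H01 : mn (fun t => x t (inl c0)) 0 1 + 1 <= x 1 (inl c0).
  by rewrite -(pphi A2d A2o A2z).
have y01 : 1 <= y0.
  have : th0 1 = 1 by apply: th_ge1.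
  rewrite hth0 ?lexx ?ler01 // mulr1 => h.
  have := ge_min y0 1 y0; rewrite lexx orbT h //.
have [b0 b1] := I4 j jim.
have mn0 : mn (fun t => x t (inl c0)) 0 1 <= 0.
  by rewrite -[leRHS]h0; apply: (mn_le (H := fun t => x t (inl c0))) => //; rewrite lexx ler01.
(* At time 1/y the pairing with the fresh label is already at least 1, so the new displacement is
   complete by then. *)
have old y : y \in sl j -> y <= y0.
  move=> ys; have [_ _ _ /(_ y ys) y1] := I3 j jim.
  have y0' : 0 < y by lra.
  have hy1 : 0 <= y^-1 <= 1 by rewrite invr_ge0 ltW //= invf_le1.
  have : 1 <= th0 y^-1.
    have e3 : y * y^-1 = 1 by rewrite mulfV // gt_eqF.
    rewrite /th0 /th le_min lexx /= clamp_id //.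
    have : 1 <= mn (fun t => x t (inl c0)) y^-1 1.
      apply: mn_ge => [|t ht]; first by case/andP: hy1.
      have ht' : 0 <= t <= 1 by case/andP: hy1 => *; lra.
      apply: le_trans (b1 c0 y t ok0 pc0 fr ys ht'); rewrite le_min lexx /= -e3 ler_wpM2l ?(ltW y0') //.
      by case/andP: ht.
    lra.
  rewrite hth0 // le_min lexx /= => h.
  by move: h; rewrite -(ler_pM2r y0') mul1r -mulrA mulVf ?mulr1 // gt_eqF.
pose sl' i := if i == j then y0 :: sl i else sl i.
exists S', sl'; split=> // i im; rewrite /sl'; have [k1 k2] := I4 i im; have [t1 t2 t3 t4] := I3 i im.
  rewrite eq_sym; have [ij|ij] := eqVneq i j; last first.
    by rewrite add0n; split=> // t ht; rewrite /S' (negPf ij) addr0 t1.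
  subst i; split=> /=.
  - by move=> t ht; rewrite /S' eqxx /ramps big_cons -hth0 // addrC t1.
  - by rewrite t2.
  - by case: (sl j) t3 old => //= a l -> h; rewrite h ?mem_head.
  - by move=> y; rewrite inE => /orP[/eqP ->|/t4].
split.
  move=> m t; rewrite eq_sym keyr; have [ij|ij] := eqVneq i j; last first.
    rewrite add0n => hm ht; rewrite k1 // ifF ?subr0 //.
    by apply/eqP => /(congr1 pr); rewrite pc0 pr_lab => h; rewrite h eqxx in ij.
  subst i => hm ht; rewrite rev_cons nth_rcons size_rev t2.
  have [->|mk] := eqVneq m (count_mem j w).
    rewrite -/c0 eqxx ltnn hth0 //.
    have [_ _ E3] := lift_expand A1BC rtA A2E pr_real nu_n mW e2 (undup_uniq (lw w))
      (fun c hc => etrans (mem_undup _ _) hc).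
    by rewrite /x E3 // add0r.
  have hm' : (m < count_mem j w)%N by rewrite ltn_neqAle mk -ltnS.
  rewrite hm' k1 // ifF ?subr0 //; apply/eqP => h; have /addnI e' := lab_inj jim h; by rewrite e' eqxx in mk.
move=> c y t okc pc hc ys ht; apply: le_trans (mono c t okc _ hc); last by rewrite pc.
have hc' : c \notin lw w by move: hc; rewrite inE negb_or => /andP[].
move: ys; have [ij|ij] := eqVneq i j; last by move=> ys; apply: k2.
subst i; rewrite inE => /orP[/eqP ->|ys]; last by apply: k2.
(* All fresh labels over one index have the same pairing, so c inherits the bound from the label
   just applied. *)
have -> : x t (inl c) = x t (inl c0).
  have [h _] := hR; have := h c okc; rewrite hc' orbT => /(_ isT); rewrite ij hth => /(congr1 (fun f => f t)).
  by move=> ->.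
rewrite -hth0 // /th0 /th clamp_id // ge_min; apply/orP; right.
have imn0 : mn (fun t => x t (inl c0)) 0 1 = 0.
  have := hR.2 c0 ok0; rewrite pc0 => /(_ jim) hi.
  have bq := rel_based A1BC A2E pr_real ok0 fr0 hR; rewrite pc0 in bq.
  by have := inc_mn bq hi; rewrite hth.
rewrite imn0 subr0; apply: (mn_le (H := fun t => x t (inl c0))) => //.
by case/andP: ht => ? ?; rewrite lexx.
Qed.

(** Independence of the simple roots recovers every [S i] from p. Over an imaginary i, [ramps_inj]
    then recovers the slopes, hence every root coordinate of the lift; over a real i, [S i] is that
    coordinate up to sign. *)
Lemma lift_inj w w' p : Fw cv rt w (Defs.pi_of nu) = Some p -> Fw cv rt w' (Defs.pi_of nu) = Some p ->
  F (lw w) (pb n) = F (lw w') (pb n).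
Proof.
move=> e e'; have uu := undup_uniq (w ++ w'); set u := undup _ in uu.
have sw : {subset w <= u} by move=> i iw; rewrite mem_undup mem_cat iw.
have sw' : {subset w' <= u} by move=> i iw; rewrite mem_undup mem_cat iw orbT.
have [S [sl [a1 a2 a3 a4]]] := lift_slopes uu sw e.
have [S' [sl' [b1 b2 b3 b4]]] := lift_slopes uu sw' e'.
have := e; rewrite -{1}(lw_pr w) => e1; have := e'; rewrite -{1}(lw_pr w') => e1'.
set x := F (lw w) _ in a2 a4 *; set x' := F (lw w') _ in b2 b4 *.
have SS i t : i \in u -> S i t = S' i t.
  move=> iu; apply/eqP; rewrite -subr_eq0; apply/eqP.
  have h0 := @indep_real R J1 V rt u uu (fun k h => @rt_indep u k uu h) (fun i => S i t - S' i t).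
  apply: (h0 _ i iu) => v.
  have := a1 t v; rewrite b1 => /addrI/oppr_inj h.
  under eq_bigr do rewrite mulrBl.
  by rewrite sumrB h subrr.
have out i : i \notin u -> count_mem i w = 0%N /\ count_mem i w' = 0%N.
  move=> iu; split; apply/count_memPn; [apply: contra iu => /sw|apply: contra iu => /sw'] => //.
have slE i : imag i -> sl i = sl' i.
  move=> im; have [c1 c2 c3 c4] := a3 i im; have [d1 d2 d3 d4] := b3 i im.
  have [iu|iu] := boolP (i \in u).
    by apply: (@ramps_inj R) => // t ht; rewrite -c1 // -d1 // SS.
  by have [z z'] := out i iu; move: c2 d2; rewrite z z' => /size0nil -> /size0nil ->.
have cE i : imag i -> count_mem i w = count_mem i w'.
  by move=> im; have [_ <- _ _] := a3 i im; have [_ <- _ _] := b3 i im; rewrite slE.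
have us := undup_uniq (lw w ++ lw w'); set s := undup _ in us.
have ss : {subset lw w <= s} by move=> i iw; rewrite mem_undup mem_cat iw.
have ss' : {subset lw w' <= s} by move=> i iw; rewrite mem_undup mem_cat iw orbT.
have [_ E2 E3] := lift_expand A1BC rtA A2E pr_real nu_n (lw_mf w) e1 us ss.
have [_ E2' E3'] := lift_expand A1BC rtA A2E pr_real nu_n (lw_mf w') e1' us ss'.
have key t c : 0 <= t <= 1 -> pval x t (inr c) = pval x' t (inr c).
  move=> ht; have [ic|rc] := boolP (imag (pr c)); last first.
    have -> : c = lab (pr c) 0 by apply: pr_real; [move: rc; rewrite negbK => /eqP | rewrite pr_lab].
    rewrite a2 // b2 //; have [iu|iu] := boolP (pr c \in u); first by rewrite SS.
    have [z z'] := out _ iu; rewrite -a2 // -b2 // -/x -/x'.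
    by rewrite E3 ?E3' //; apply/negP => /mem_lw[m []]; rewrite pr_lab ?z ?z' addn0; lia.
  have [hc|hc] := boolP (c \in lw w); last first.
    rewrite E3 // E3' //; apply: contra hc => /mem_lw[m [h1 h2 h3]].
    have [a4' _] := a4 _ ic; have [b4' _] := b4 _ ic.
    have hm : (m - o (pr c) < count_mem (pr c) w)%N by rewrite cE //; lia.
    apply/negPn/negP => hc; have := a4' _ 1 hm; rewrite ler01 lexx => /(_ isT).
    rewrite subnKC // -h3 E3 // => /esym/eqP; rewrite oppr_eq0 mulr1 => /eqP h.
    have [_ sz _ c4] := a3 _ ic.
    have : 1 <= nth 0 (rev (sl (pr c))) (m - o (pr c)) by apply: c4; rewrite -mem_rev mem_nth // size_rev sz.
    by move=> h1'; move: h; rewrite min_l // => /eqP; rewrite oner_eq0.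
  have [m [h1 h2 h3]] := mem_lw hc.
  have [a4' _] := a4 _ ic; have [b4' _] := b4 _ ic.
  have hm : (m - o (pr c) < count_mem (pr c) w)%N by lia.
  have hm' : (m - o (pr c) < count_mem (pr c) w')%N by rewrite -cE.
  have := a4' _ t hm ht; have := b4' _ t hm' ht.
  by rewrite subnKC // -h3 slE // => -> ->.
apply: pval_inj; apply: gen_eq (car_gen _) (car_gen _) _ => t ht; apply/funext => -[d|c].
  rewrite E2 E2'; congr (_ + _); apply: eq_bigr => c _.
  by rewrite key.
exact: key.
Qed.

End StandardLabels.

(** * Words acting on a concatenation of two paths *)

Section Pairs.
Variables (R : realType) (J1 J2 : eqType) (A1 : J1 -> J1 -> int) (A2 : J2 -> J2 -> int).
Variables (V : eqType) (cv : J1 -> V) (rt : J1 -> V -> int) (pr : J2 -> J1).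
Implicit Types (i j : J1) (c d : J2) (w u : seq J1) (W U : seq J2) (s t : R) (p : cpath R V).
Hypothesis A1BC : BC_matrix A1.
Hypothesis rtA : forall i j, rt j (cv i) = A1 i j.
Hypothesis A2E : forall c d, A2 c d = if c == d then 2 else A1 (pr c) (pr d).
Hypothesis pr_real : forall c d, A1 (pr c) (pr c) = 2 -> pr c = pr d -> c = d.
Variable lab : J1 -> nat -> J2.
Hypothesis pr_lab : forall i m, pr (lab i m) = i.
Hypothesis lab_inj : forall i m m', imag A1 i -> lab i m = lab i m' -> m = m'.

Local Notation imag := (imag A1).
Local Notation A2d := (A2diag A2E).
Local Notation A2o := (A2off A1BC A2E pr_real).
Local Notation A2z := (A2zero A1BC A2E).
Local Notation pcrys := (pcrys R A2d A2o A2z).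
Local Notation pb := (pb R A2d A2o A2z).
Local Notation tens := (tensor A2d).
Local Notation lw := (lw lab).
Local Notation lw0 := (lw (fun=> 0%N)).
Local Notation cnt u := (fun i => count_mem i u).
Local Notation FW := (Fw cv rt).
Local Notation straight nu := (Defs.pi_of nu).
Local Notation mf := (mf A1 pr).
Local Notation Rel := (Rel A1 cv pr).
Local Notation fresh c W := (~~ imag (pr c) || (c \notin W)).

Lemma lw_ext o o' w : (forall i, i \in w -> imag i -> o i = o' i) -> lw o w = lw o' w.
Proof.
elim: w => //= i w IH h; congr cons; last by apply: IH => j jw; apply: h; rewrite inE jw orbT.
have [im|re] := boolP (imag i); first by rewrite h ?mem_head.
exact: (lab_real pr_real pr_lab _ _ re).
Qed.

Lemma mf_perm ok W W' : perm_eq W W' -> mf ok W = mf ok W'.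
Proof.
have h U : mf ok U = all ok U && uniq (filter (fun c => imag (pr c)) U).
  elim: U => //= c U ->; case im: (imag (pr c)); rewrite /= ?mem_filter ?im /=.
    by case: (ok c) => //=; case: (c \in U) => //=; case: (all _ _).
  by rewrite andbA.
move=> pW; rewrite !h (perm_all _ pW); congr andb; apply: perm_uniq.
exact: perm_filter.
Qed.

Section OneBase.
Variables (ok : pred J2) (n : J2 -> nat) (nu : V -> R).
Hypothesis nu_n : forall c, ok c -> nu (cv (pr c)) = (n c)%:R.

Lemma eps_fresh W c : dw W (pb n) -> c \notin W -> eps c (F W (pb n)) = 0.
Proof.
move=> dW cW; have := eps_ge0 c (F W (pb n)); rewrite le_eqVlt => /orP[/eqP //|h].
have [W' [_ _ /perm_mem/(_ c)]] := pb_last dW h.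
by rewrite mem_head (negPf cW).
Qed.

Lemma rel_wt W p c d : Rel ok W p (pval (F W (pb n))) -> ok c -> ok d -> fresh c W -> fresh d W ->
  pr c = pr d -> wt (F W (pb n)) c = wt (F W (pb n)) d.
Proof.
move=> [h _] oc od fc fd e; rewrite /= /pwt; congr Num.floor.
have := h c oc fc; rewrite e h // => /(congr1 (fun f => f 1)) /=.
by move=> ->.
Qed.

(** When a letter over [pr c] was applied, its own fresh label had vanishing [eps], so the weight
    there was positive; equal weights of fresh labels transfer this to c, and later letters only add
    to it. *)
Lemma wt_pos W p c : mf ok W -> FW (map pr W) (straight nu) = Some p -> ok c -> imag (pr c) ->
  c \notin W -> pr c \in map pr W -> 0 < wt (F W (pb n)) c.
Proof.
elim: W p => // d W IH p /and3P[okd fd mW]; rewrite map_cons FwS.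
case e: (Fw _ _ _ _) => [q|//] hq okc ic; rewrite !inE negb_or => /andP[/eqP cd cW] hc.
have [dW hR] := lift_rel A1BC rtA A2E pr_real nu_n mW e.
have hp : 0 < phi d (F W (pb n)).
  by move: hq => /=; rewrite (rel_root_f rt okd fd hR); case: ifP.
have -> : wt (F (d :: W) (pb n)) c = wt (F W (pb n)) c - A2 c d by apply: wt_f hp _.
have a0 := A2o cd.
suff h : 0 < wt (F W (pb n)) c by apply: ltr_wpDr => //; rewrite oppr_ge0.
move: hc => /orP[/eqP e'|hc]; last exact: IH mW e okc ic cW hc.
have fd' : d \notin W by move: fd; rewrite -e' ic.
rewrite (rel_wt hR okc okd) ?cW ?orbT //.
by move: hp; rewrite /phi eps_fresh // add0r.
Qed.

Lemma based_path W p i c : mf ok W -> FW (map pr W) (straight nu) = Some p -> ok c -> pr c = i ->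
  fresh c W -> based cv i p.
Proof.
move=> mW e okc <- fc; have [_ hR] := lift_rel A1BC rtA A2E pr_real nu_n mW e.
exact: rel_based fc hR.
Qed.

Lemma path_out W p : mf ok W -> FW (map pr W) (straight nu) = Some p ->
  (forall t v, t <= 0 -> p t v = t * nu v) /\ (forall t v, 1 <= t -> p t v = p 1 v + (t - 1) * nu v).
Proof.
move=> mW e; have us := undup_uniq W; have ss : {subset W <= undup W} by move=> c; rewrite mem_undup.
have [E _ _] := lift_expand A1BC rtA A2E pr_real nu_n mW e us ss.
have [g0 g1] := gen_out (car_gen (F W (pb n))).
split=> t v t0; rewrite !E.
  by rewrite big1 ?addr0 // => c _; rewrite g0 // /base /line mulr0 mul0r.
rewrite [in LHS](eq_bigr (fun c => pval (F W (pb n)) 1 (inr c) * (rt (pr c) v)%:~R)); first by ring.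
by move=> c _; rewrite g1 // /base /line !mulr0 subr0 add0r.
Qed.

Lemma path_eq W W' p p' : mf ok W -> mf ok W' -> FW (map pr W) (straight nu) = Some p ->
  FW (map pr W') (straight nu) = Some p' -> (forall t, 0 <= t <= 1 -> p t = p' t) -> p = p'.
Proof.
move=> m m' e e' h; have [h0 h1] := path_out m e; have [k0 k1] := path_out m' e'.
apply/funext => t; have [t0|t0] := lerP t 0; first by apply/funext => v; rewrite h0 ?k0.
have [t1|t1] := lerP t 1; first by apply: h; lra.
by apply/funext => v; rewrite (h1 _ _ (ltW t1)) (k1 _ _ (ltW t1)) h // ler01 lexx.
Qed.

End OneBase.

Variables (lamN muN : J2 -> nat) (lamV muV : V -> R).
Hypothesis lam_N : forall c, lamV (cv (pr c)) = (lamN c)%:R.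
Hypothesis mu_N : forall c, muV (cv (pr c)) = (muN c)%:R.

Lemma lam_ok ok c : ok c -> lamV (cv (pr c)) = (lamN c)%:R. Proof. by []. Qed.
Lemma mu_ok ok c : ok c -> muV (cv (pr c)) = (muN c)%:R. Proof. by []. Qed.

Lemma pair_step ok ok' W1 W2 p1 p2 (x1 : pcrys lamN) (x2 : pcrys muN) c :
  Rel ok W1 p1 (pval x1) -> Rel ok' W2 p2 (pval x2) -> ok c -> ok' c -> fresh c W1 -> fresh c W2 ->
  root_f cv rt (pr c) (concat p1 p2) =
  if 0 < phi c ((x1, x2) : tens (pcrys lamN) (pcrys muN)) then
    Some (if eps c x2 < phi c x1 then concat (fg cv rt (pr c) p1) p2
          else concat p1 (fg cv rt (pr c) p2)) else None.
Proof.
move=> h1 h2 okc okc' f1 f2.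
have b1 := rel_based A1BC A2E pr_real okc f1 h1; have b2 := rel_based A1BC A2E pr_real okc' f2 h2.
rewrite root_fE; last exact: based_concat.
have [k1 _] := h1; have [k2 _] := h2; have e1 := k1 c okc f1; have e2 := k2 c okc' f2.
have eH : Hf cv (pr c) (concat p1 p2) = fun t => concat (pval x1) (pval x2) t (inl c).
  by rewrite Hf_concat e1 e2.
rewrite eH tens_phi /=; case: ifP => // _; congr Some.
have hlr : (eps c x2 < phi c x1) =
    (- mn (Hf cv (pr c) p2) 0 1 < Hf cv (pr c) p1 1 - mn (Hf cv (pr c) p1) 0 1).
  rewrite e1 e2 /phi -(ltr_int R) intrD /= !(pepsE A2d A2o A2z) (pwtE A2d A2o A2z).
  by apply/idP/idP; lra.
case: ifPn; rewrite hlr => h; first exact: fg_concat.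
by rewrite -leNgt in h; apply: fg_concat'.
Qed.

(* Right imaginary letters come before left ones, so the labels of both factors stay standard. *)
Lemma pair_word u w p2 : FW u (straight muV) = Some p2 ->
  let x := (pb lamN, F (lw0 u) (pb muN)) : tens (pcrys lamN) (pcrys muN) in
  dw (lw (cnt u) w) x -> exists w1 w2 q1 q2,
  [/\ perm_eq (w1 ++ w2) (w ++ u), FW w1 (straight lamV) = Some q1, FW w2 (straight muV) = Some q2,
    FW w (concat (straight lamV) p2) = Some (concat q1 q2) &
    F (lw (cnt u) w) x = (F (lw (cnt w2) w1) (pb lamN), F (lw0 w2) (pb muN))].
Proof.
move=> e x; elim: w => [|i w IH] dW.
  by exists [::], u, (straight lamV), p2; split.
have [dW' hp] := dW; have [w1 [w2 [q1 [q2 [pe e1 e2 e3 e4]]]]] := IH dW'.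
have m1 := lw_mf pr_lab lab_inj (cnt w2) w1; have m2 := lw_mf pr_lab lab_inj (fun=> 0%N) w2.
have e1' := e1; rewrite -{1}(lw_pr pr_lab (cnt w2) w1) in e1'.
have e2' := e2; rewrite -{1}(lw_pr pr_lab (fun=> 0%N) w2) in e2'.
have [d1 R1] := lift_rel A1BC rtA A2E pr_real (lam_ok (ok := _)) m1 e1'.
have [d2 R2] := lift_rel A1BC rtA A2E pr_real (mu_ok (ok := _)) m2 e2'.
have ec : (count_mem i u + count_mem i w = count_mem i w2 + count_mem i w1)%N.
  by have /permP/(_ (pred1 i)) := pe; rewrite !count_cat; lia.
set c := lab i (count_mem i u + count_mem i w) in hp *.
have pc : pr c = i by rewrite /c pr_lab.
have f1 : fresh c (lw (cnt w2) w1) by rewrite pc /c ec; apply: (lw_fresh pr_lab lab_inj).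
have f2 : fresh c (lw0 w2).
  rewrite pc; have [im|//] := boolP (imag i); apply/negP => /(mem_lw pr_lab)[m [_]].
  rewrite pc /= => h; rewrite /c => /(lab_inj im); lia.
have ok1 : okl A1 pr lab (cnt w2) c by rewrite /c ec; apply: okl_lab => //; rewrite leq_addr.
have ok2 : okl A1 pr lab (fun=> 0%N) c by apply: okl_lab.
have st := pair_step R1 R2 ok1 ok2 f1 f2; rewrite pc in st.
move: hp; rewrite -/(lw (cnt u) w) e4 => hp; rewrite hp in st.
have eF : F (lw (cnt u) (i :: w)) x = tf c (F (lw (cnt w2) w1) (pb lamN), F (lw0 w2) (pb muN)).
  by rewrite -e4.
have [hl|hl] := boolP (eps c (F (lw0 w2) (pb muN)) < phi c (F (lw (cnt w2) w1) (pb lamN))).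
  rewrite hl in st; exists (i :: w1), w2, (fg cv rt i q1), q2; split=> //.
  - by rewrite /= perm_cons.
  - rewrite FwS e1 /= -pc (rel_root_f rt ok1 f1 R1) ifT //.
    by apply: le_lt_trans hl; apply: eps_ge0.
  - by rewrite FwS e3.
  - by rewrite eF /tf /= hl /= -ec.
rewrite (negPf hl) in st.
have hp2 : 0 < phi c (F (lw0 w2) (pb muN)).
  by move: hp; rewrite {1}/phi /= /teps /twt /= (negPf hl) addrA subrK.
(* Had i occurred on the left, a fresh label would have positive [phi] there by [wt_pos], and [eps]
   0 on the right, so the letter would act on the left. *)
have iw1 : imag i -> i \notin w1.
  move=> im; apply: contra hl => iw; rewrite eps_fresh //; last by move: f2; rewrite pc im.
  have cW : c \notin lw (cnt w2) w1 by move: f1; rewrite pc im.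
  have := wt_pos (lam_ok (ok := _)) m1 e1' ok1; rewrite pc im cW (lw_pr pr_lab) iw => /(_ isT isT isT).
  by move=> hw; apply: ltr_wpDl => //; apply: eps_ge0.
exists w1, (i :: w2), q1, (fg cv rt i q2); split=> //.
- rewrite -cat1s perm_catCA /= perm_cons; exact: pe.
- by rewrite FwS e2 /= -pc (rel_root_f rt ok2 f2 R2) hp2.
- by rewrite FwS e3.
- rewrite eF /tf /= (negPf hl); congr pair.
    apply: (congr1 (fun W => F W (pb lamN))); apply: lw_ext => j jw jm /=.
    by have [ij|//] := eqVneq i j; exfalso; move: (iw1); rewrite ij jw => /(_ jm).
  rewrite -[RHS]/(fc (lab i (0 + count_mem i w2)) (F (lw0 w2) (pb muN))) add0n.
  apply: (congr1 (fun c => fc c (F (lw0 w2) (pb muN)))).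
  have [im|re] := boolP (imag i); last exact: (lab_real pr_real pr_lab _ _ re).
  by rewrite /c ec (count_memPn (iw1 im)) addn0.
Qed.

Lemma pair_word_dw u w p2 q : FW u (straight muV) = Some p2 ->
  FW w (concat (straight lamV) p2) = Some q ->
  dw (lw (cnt u) w) ((pb lamN, F (lw0 u) (pb muN)) : tens (pcrys lamN) (pcrys muN)).
Proof.
move=> e; elim: w q => // i w IH q; rewrite FwS.
case e0: (Fw _ _ _ _) => [r|//] hq; have dW := IH r e0; split=> //.
have [w1 [w2 [q1 [q2 [pe e1 e2 e3 e4]]]]] := pair_word e dW.
have m1 := lw_mf pr_lab lab_inj (cnt w2) w1; have m2 := lw_mf pr_lab lab_inj (fun=> 0%N) w2.
have e1' := e1; rewrite -{1}(lw_pr pr_lab (cnt w2) w1) in e1'.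
have e2' := e2; rewrite -{1}(lw_pr pr_lab (fun=> 0%N) w2) in e2'.
have [d1 R1] := lift_rel A1BC rtA A2E pr_real (lam_ok (ok := _)) m1 e1'.
have [d2 R2] := lift_rel A1BC rtA A2E pr_real (mu_ok (ok := _)) m2 e2'.
have ec : (count_mem i u + count_mem i w = count_mem i w2 + count_mem i w1)%N.
  by have /permP/(_ (pred1 i)) := pe; rewrite !count_cat; lia.
set c := lab i (count_mem i u + count_mem i w).
have pc : pr c = i by rewrite /c pr_lab.
have f1 : fresh c (lw (cnt w2) w1) by rewrite pc /c ec; apply: (lw_fresh pr_lab lab_inj).
have f2 : fresh c (lw0 w2).
  rewrite pc; have [im|//] := boolP (imag i); apply/negP => /(mem_lw pr_lab)[m [_]].
  rewrite pc /= => h; rewrite /c => /(lab_inj im); lia.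
have ok1 : okl A1 pr lab (cnt w2) c by rewrite /c ec; apply: okl_lab => //; rewrite leq_addr.
have ok2 : okl A1 pr lab (fun=> 0%N) c by apply: okl_lab.
have st := pair_step R1 R2 ok1 ok2 f1 f2; rewrite pc in st.
have er : r = concat q1 q2 by have := e3; rewrite e0 => -[].
move: hq; rewrite /= er st; case: ifP => // h _.
by rewrite -/(lw (cnt u) w) e4.
Qed.

End Pairs.

(** * The decomposition *)

Section Decomposition.
Variables (R : realType) (J1 J2 : eqType) (A1 : J1 -> J1 -> int) (A2 : J2 -> J2 -> int).
Variables (V : eqType) (cv : J1 -> V) (rt : J1 -> V -> int) (pr : J2 -> J1).
Implicit Types (i j : J1) (c d : J2) (w u : seq J1) (W U : seq J2) (s t : R) (p b : cpath R V).
Hypothesis A1BC : BC_matrix A1.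
Hypothesis rtA : forall i j, rt j (cv i) = A1 i j.
Hypothesis A2E : forall c d, A2 c d = if c == d then 2 else A1 (pr c) (pr d).
Hypothesis pr_real : forall c d, A1 (pr c) (pr c) = 2 -> pr c = pr d -> c = d.
Variable dm : J2 -> nat.
Hypothesis dm_gt0 : forall c, (0 < dm c)%N.
Hypothesis dmA : forall c d, (dm c)%:Z * A2 c d = (dm d)%:Z * A2 d c.
Hypothesis rt_indep : forall (s : seq J1) (c : J1 -> int), uniq s ->
  (forall v, \sum_(j <- s) c j * rt j v = 0) -> forall j, j \in s -> c j = 0.
Variable lab : J1 -> nat -> J2.
Hypothesis pr_lab : forall i m, pr (lab i m) = i.
Hypothesis lab_inj : forall i m m', imag A1 i -> lab i m = lab i m' -> m = m'.
Variables (lamN muN : J2 -> nat) (lamV muV : V -> R).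
Hypothesis lam_N : forall c, lamV (cv (pr c)) = (lamN c)%:R.
Hypothesis mu_N : forall c, muV (cv (pr c)) = (muN c)%:R.

Local Notation imag := (imag A1).
Local Notation A2d := (A2diag A2E).
Local Notation A2o := (A2off A1BC A2E pr_real).
Local Notation A2z := (A2zero A1BC A2E).
Local Notation pcrys := (pcrys R A2d A2o A2z).
Local Notation pb := (pb R A2d A2o A2z).
Local Notation tens := (tensor A2d).
Local Notation lw := (lw lab).
Local Notation lw0 := (lw (fun=> 0%N)).
Local Notation cnt u := (fun i => count_mem i u).
Local Notation FW := (Fw cv rt).
Local Notation straight nu := (Defs.pi_of nu).
Local Notation mf := (mf A1 pr).
Local Notation Rel := (Rel A1 cv pr).
Local Notation fresh c W := (~~ imag (pr c) || (c \notin W)).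
Local Notation okl := (okl A1 pr lab).
Local Notation lr nu_n := (lift_rel A1BC rtA A2E pr_real nu_n).

(** The crystal form of dominance of the lifted path: the minima of its pairings are bounded below
    by minus the weight; see [tdominant_eps]. *)
Definition good u := dw (lw0 u) (pb muN) /\
  forall c, eps c (F (lw0 u) (pb muN)) <= (lamN c)%:Z.

Definition xel u : tens (pcrys lamN) (pcrys muN) := (pb lamN, F (lw0 u) (pb muN)).

(** The absolute value only serves to land in [nat]: for good u the weight is nonnegative because
    [eps] vanishes. *)
Definition thN u c := `|wt (xel u) c|%N.

Definition shV p : V -> R := fun v => lamV v + p 1 v.

Lemma xel_eps u c : good u -> eps c (xel u) = 0.
Proof.
move=> [_ /(_ c)]; rewrite /= /teps /phi /= [peps c (pb lamN)](pb_eps R A2d A2o A2z).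
rewrite [pwt (pb lamN) c](pb_wt R A2d A2o A2z) add0r => h; case: ifP => //.
by have := eps_ge0 c (F (lw0 u) (pb muN)); rewrite /=; lia.
Qed.

Lemma thNE u c : good u -> (thN u c)%:Z = wt (xel u) c.
Proof.
by move=> g; rewrite /thN gez0_abs //; have := phi_ge0 c (xel u); rewrite xel_eps // add0r.
Qed.

Lemma good_highest u : good u -> highest pb (xel u) (thN u).
Proof.
move=> g; have [dU he] := g; split=> [c|n]; first by rewrite thNE.
apply: (tensor_highest A2o (b := pb) (pb_wt R A2d A2o A2z) (pb_eps R A2d A2o A2z) _ _ dU he) => //.
- by move=> n' nu xi; apply: pb_sum.
- by move=> nu w j; apply: pb_last.
- by move=> c; rewrite thNE.
Qed.

Lemma okl_fresh u c : okl (cnt u) c -> fresh c (lw0 u).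
Proof.
move=> /orP[-> //|/asboolP[m hm e]]; have [im|//] := boolP (imag (pr c)).
apply/negP => /(mem_lw pr_lab)[m' [_ h e']].
by move: e; rewrite [in LHS]e' => /(lab_inj im) e; move: h; rewrite e /= add0n ltnNge hm.
Qed.

Section Total.
Variables (n : J2 -> nat) (nu : V -> R).
Hypothesis nu_n : forall c, nu (cv (pr c)) = (n c)%:R.

Lemma nu_T c : predT c -> nu (cv (pr c)) = (n c)%:R. Proof. by []. Qed.
Lemma nu_ok o c : okl o c -> nu (cv (pr c)) = (n c)%:R. Proof. by []. Qed.

Lemma mf_weak ok W : mf ok W -> mf predT W.
Proof. by elim: W => //= c W IH /and3P[_ -> /IH ->]. Qed.

Lemma mf_lw o w : mf predT (lw o w).
Proof. exact: mf_weak (lw_mf pr_lab lab_inj o w). Qed.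

Lemma lift0 o w q : FW w (straight nu) = Some q ->
  dw (lw o w) (pb n) /\ Rel predT (lw o w) q (pval (F (lw o w) (pb n))).
Proof. by move=> e; apply: (lr nu_T (mf_lw o w)); rewrite lw_pr. Qed.

Lemma lift0_proj W W' q q' : mf predT W -> mf predT W' -> FW (map pr W) (straight nu) = Some q ->
  FW (map pr W') (straight nu) = Some q' -> F W (pb n) = F W' (pb n) -> q = q'.
Proof. exact: (lift_proj rtA nu_T). Qed.

Lemma lift0_eq o o' w w' q q' : FW w (straight nu) = Some q -> FW w' (straight nu) = Some q' ->
  F (lw o w) (pb n) = F (lw o' w') (pb n) -> q = q'.
Proof. by move=> e e'; apply: lift0_proj; rewrite ?mf_lw ?lw_pr. Qed.

Lemma lift0_inj o w w' q : FW w (straight nu) = Some q -> FW w' (straight nu) = Some q ->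
  F (lw o w) (pb n) = F (lw o w') (pb n).
Proof. exact: (lift_inj A1BC rtA A2E pr_real dm_gt0 dmA rt_indep pr_lab lab_inj (@nu_ok o)). Qed.

Lemma out0 w q : FW w (straight nu) = Some q ->
  (forall t v, t <= 0 -> q t v = t * nu v) /\ (forall t v, 1 <= t -> q t v = q 1 v + (t - 1) * nu v).
Proof.
move=> e; apply: (path_out A1BC rtA A2E pr_real nu_T (mf_lw (fun=> 0%N) w)).
by rewrite lw_pr.
Qed.

Lemma eq0 w w' q q' : FW w (straight nu) = Some q -> FW w' (straight nu) = Some q' ->
  (forall t, 0 <= t <= 1 -> q t = q' t) -> q = q'.
Proof.
move=> e e'; apply: (path_eq A1BC rtA A2E pr_real nu_T (mf_lw (fun=> 0%N) w) (mf_lw (fun=> 0%N) w'));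
by rewrite lw_pr.
Qed.

End Total.

Lemma F_perm n W W' : dw W (pb n) -> dw W' (pb n) -> F W (pb n) = F W' (pb n) -> perm_eq W W'.
Proof.
move=> d d' e; rewrite /perm_eq; apply/allP => c _; apply/eqP.
have [a h] := pval_F d; have [a' h'] := pval_F d'.
have [_ o1] := dom_out (base_dom R n) a; have [_ o2] := dom_out (base_dom R n) a'.
have := o1 1 (inr c) (lexx 1); rewrite -h e h' o2 // => /addrI /eqP.
by rewrite eqr_int !wsh_fw eqr_opp => /eqP[].
Qed.

Lemma lw_perm o w w' : perm_eq (lw o w) (lw o w') -> perm_eq w w'.
Proof. by move=> /(perm_map pr); rewrite !lw_pr. Qed.

Lemma shift_base u p : good u -> FW u (straight muV) = Some p ->
  forall c, okl (cnt u) c -> shV p (cv (pr c)) = (thN u c)%:R.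
Proof.
move=> g e c okc; have fc := okl_fresh okc.
have [d [hR _]] := lift0 mu_N (fun=> 0%N) e.
have := hR c isT fc => /(congr1 (fun f => f 1)) h.
rewrite /shV -[p 1 _]/(Hf cv (pr c) p 1) h lam_N.
rewrite -[(thN u c)%:R]/(((thN u c)%:Z)%:~R) thNE // /= /twt intrD /=.
by rewrite !(pwtE A2d A2o A2z) /= /base /line mul1r.
Qed.

Local Notation gb g e := (shift_base g e).

Lemma transfer u p w : good u -> FW u (straight muV) = Some p ->
  (exists q, FW w (concat (straight lamV) p) = Some q) <->
  (exists q, FW w (straight (shV p)) = Some q).
Proof.
move=> g e; have [hw hs] := good_highest g.
have mW := lw_mf pr_lab lab_inj (cnt u) w.
have sz := leqnn (size (lw (cnt u) w)); have hs' := hs (size (lw (cnt u) w)).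
have ew : wt (xel u) =1 wt (pb (thN u)) by move=> c; rewrite hw pb_wt.
split=> -[q eq].
  have d := pair_word_dw A1BC rtA A2E pr_real pr_lab lab_inj lam_N mu_N e eq.
  have [d' _ _] := hs' _ _ sz sz d d.
  have [q' e' _] := lift_dw rtA (gb g e) mW d'; exists q'.
  by rewrite lw_pr in e'.
have d : dw (lw (cnt u) w) (pb (thN u)).
  by apply: (lift_Fw A1BC rtA A2E pr_real (gb g e) mW (p := q)); rewrite lw_pr.
have d2 := sim_dw hs' ew sz d.
have [w1 [w2 [q1 [q2 [_ _ _ e3 _]]]]] :=
  pair_word rtA pr_lab lab_inj lam_N mu_N e d2.
by exists (concat q1 q2).
Qed.

Lemma pieces w1 w2 w1' w2' q1 q2 q1' q2' :
  FW w1 (straight lamV) = Some q1 -> FW w2 (straight muV) = Some q2 ->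
  FW w1' (straight lamV) = Some q1' -> FW w2' (straight muV) = Some q2' ->
  concat q1 q2 = concat q1' q2' ->
  q1 = q1' /\ q2 = q2'.
Proof.
move=> e1 e2 e1' e2' /concat_inj h.
have [z2 _] := out0 mu_N e2; have [z2' _] := out0 mu_N e2'.
have [|| h1 h2] := h.
- by apply/funext => v; rewrite z2 // mul0r.
- by apply/funext => v; rewrite z2' // mul0r.
split; first by apply: (eq0 lam_N e1 e1') => t ht; apply: h1; lra.
by apply: (eq0 mu_N e2 e2') => t ht; apply: h2; lra.
Qed.

Lemma cnt_eq n (nu : V -> R) w w' q : (forall c, nu (cv (pr c)) = (n c)%:R) ->
  FW w (straight nu) = Some q -> FW w' (straight nu) = Some q -> cnt w = cnt w' /\
  F (lw0 w) (pb n) = F (lw0 w') (pb n).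
Proof.
move=> nu_n e e'; have h := lift0_inj nu_n (fun=> 0%N) e e'; split=> //.
have [d _] := lift0 nu_n (fun=> 0%N) e; have [d' _] := lift0 nu_n (fun=> 0%N) e'.
by have /permP pw := lw_perm (F_perm d d' h); apply/funext => i; rewrite pw.
Qed.

(** The isomorphism as a relation, since the words u and w are not determined by b; it is shown to
    be single valued, injective and total. *)
Definition theta b (q : cpath R V * cpath R V) := exists u w,
  [/\ good u, FW u (straight muV) = Some q.1, FW w (concat (straight lamV) q.1) = Some b &
      FW w (straight (shV q.1)) = Some q.2].

(* Both derivations lift to the same element of the Kac-Moody tensor product, whose component
   has a unique highest element. *)
Lemma theta_fun b q q' : theta b q -> theta b q' -> q = q'.
Proof.
case: q q' => [p r] [p' r'] [u [w [/= g e eb er]]] [u' [w' [/= g' e' eb' er']]].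
have d := pair_word_dw A1BC rtA A2E pr_real pr_lab lab_inj lam_N mu_N e eb.
have d' := pair_word_dw A1BC rtA A2E pr_real pr_lab lab_inj lam_N mu_N e' eb'.
have [w1 [w2 [q1 [q2 [_ e1 e2 e3 e4]]]]] :=
  pair_word rtA pr_lab lab_inj lam_N mu_N e d.
have [w1' [w2' [q1' [q2' [_ e1' e2' e3' e4']]]]] :=
  pair_word rtA pr_lab lab_inj lam_N mu_N e' d'.
have ec : concat q1 q2 = concat q1' q2'.
  by have : Some (concat q1 q2) = Some (concat q1' q2') by [rewrite -e3 -e3' eb eb']; case.
have [E1 E2] := pieces e1 e2 e1' e2' ec; rewrite -{}E1 in e1'; rewrite -{}E2 in e2'.
have [cc E2] := cnt_eq mu_N e2 e2'; have E1 := lift0_inj lam_N (cnt w2) e1 e1'.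
have E : F (lw (cnt u) w) (xel u) = F (lw (cnt u') w') (xel u').
  by rewrite /xel e4 e4' E1 E2 cc.
have hx := highest_disjoint (pb_wt R A2d A2o A2z) (pb_eps R A2d A2o A2z) (@pb_last _ _ _ A2d A2o A2z)
  (good_highest g) (good_highest g') d d' E.
have hU := congr1 (fun z : pcrys lamN * pcrys muN => z.2) hx.
have ep : p = p' by apply: (lift0_eq mu_N e e' hU).
subst p'; have [cu _] := cnt_eq mu_N e e'; congr pair.
rewrite -/(xel u') -hx -cu in d'; rewrite -/(xel u) in d; rewrite -hx -cu in E.
have [_ /(_ (maxn (size (lw (cnt u) w)) (size (lw (cnt u) w')))) hs] := good_highest g.
have [_ _ hc] := hs _ _ (leq_maxl _ _) (leq_maxr _ _) d d'.
have er1 : FW (map pr (lw (cnt u) w)) (straight (shV p)) = Some r by rewrite lw_pr.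
have er1' : FW (map pr (lw (cnt u) w')) (straight (shV p)) = Some r' by rewrite lw_pr.
exact: (lift_proj rtA (gb g e) (lw_mf pr_lab lab_inj (cnt u) w)
  (lw_mf pr_lab lab_inj (cnt u) w') er1 er1' (hc.1 E)).
Qed.

(** Here [lift_inj] over the shifted base equates the lifts of the two words, and the highest
    element carries this equality back to the tensor product. *)
Lemma theta_inj b b' q : theta b q -> theta b' q -> b = b'.
Proof.
case: q => [p r] [u [w [/= g e eb er]]] [u' [w' [/= g' e' eb' er']]].
have d := pair_word_dw A1BC rtA A2E pr_real pr_lab lab_inj lam_N mu_N e eb.
have d' := pair_word_dw A1BC rtA A2E pr_real pr_lab lab_inj lam_N mu_N e' eb'.
have [w1 [w2 [q1 [q2 [_ e1 e2 e3 e4]]]]] :=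
  pair_word rtA pr_lab lab_inj lam_N mu_N e d.
have [w1' [w2' [q1' [q2' [_ e1' e2' e3' e4']]]]] :=
  pair_word rtA pr_lab lab_inj lam_N mu_N e' d'.
have [cu hU] := cnt_eq mu_N e e'.
have hx : xel u = xel u' by rewrite /xel hU.
have E := lift_inj A1BC rtA A2E pr_real dm_gt0 dmA rt_indep pr_lab lab_inj (gb g e) er er'.
have [_ /(_ (maxn (size (lw (cnt u) w)) (size (lw (cnt u) w')))) hs] := good_highest g.
rewrite -/(xel u) in d e4; rewrite -/(xel u') -hx -cu in d' e4'.
have [_ _ hc] := hs _ _ (leq_maxl _ _) (leq_maxr _ _) d d'.
have := hc.2 E; rewrite e4 e4' => -[F1 F2].
have E1 := lift0_eq lam_N e1 e1' F1; have E2 := lift0_eq mu_N e2 e2' F2.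
have : Some b = Some b' by rewrite -eb -eb' e3 e3' E1 E2.
by case.
Qed.

Lemma lw_okl o w c : c \in lw o w -> okl o c.
Proof. by move=> /(mem_lw pr_lab)[m [h _ ->]]; apply: okl_lab. Qed.

Lemma lw_disjoint u w c : c \in lw0 u -> fresh c (lw (cnt u) w).
Proof.
move=> cu; have [im|//] := boolP (imag (pr c)); apply/negP => /lw_okl/okl_fresh.
by rewrite im cu.
Qed.

(** One e-step for paths: [pb_last] rewrites the word so that c acts last. Permuting letters keeps
    the word multiplicity free, so it still projects to q. *)
Lemma pred1 (ok : pred J2) n (nu : V -> R) W (q : cpath R V) c : (forall c, ok c -> nu (cv (pr c)) = (n c)%:R) -> mf ok W ->
  FW (map pr W) (straight nu) = Some q -> 0 < eps c (F W (pb n)) ->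
  exists W' q', [/\ mf ok (c :: W'), perm_eq (c :: W') W, dw (c :: W') (pb n),
    F (c :: W') (pb n) = F W (pb n) & FW (map pr W') (straight nu) = Some q' /\
    q = fg cv rt (pr c) q'].
Proof.
move=> nu_n mW e h; have [d _] := lr nu_n mW e.
have [W' [d' e' p']] := pb_last d h; have m' : mf ok (c :: W') by rewrite (mf_perm _ _ _ p').
have [q'' eq'' _] := lift_dw rtA nu_n m' d'.
have eq : q = q'' := lift_proj rtA nu_n mW m' e eq'' (esym e').
have /and3P[okc fc mW'] := m'.
move: eq''; rewrite map_cons FwS; case e0: (Fw _ _ _ _) => [q'|//].
have [_ hR] := lr nu_n mW' e0; have [_ hp] := d'.
rewrite /= (rel_root_f rt okc fc hR) hp => -[eg]; exists W', q'; split=> //; split=> //.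
by rewrite eq eg.
Qed.

(** The tensor rule for e: undo c on the left if [phi] there is at least [eps] on the right, else on
    the right. After the step the rule for f selects the same factor. *)
Lemma tensor_pred w u p1 p2 c : FW w (straight lamV) = Some p1 -> FW u (straight muV) = Some p2 ->
  0 < eps c ((F (lw (cnt u) w) (pb lamN), F (lw0 u) (pb muN)) : tens (pcrys lamN) (pcrys muN)) ->
  exists w' u' q1 q2, [/\ FW w' (straight lamV) = Some q1, FW u' (straight muV) = Some q2,
    (size w' + size u' < size w + size u)%N &
    root_f cv rt (pr c) (concat q1 q2) = Some (concat p1 p2)].
Proof.
move=> e1 e2; have m1 := mf_lw (cnt u) w; have m2 := mf_lw (fun=> 0%N) u.
have [d1 R1] := lift0 lam_N (cnt u) e1; have [d2 R2] := lift0 mu_N (fun=> 0%N) e2.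
have e1' := e1; rewrite -{1}(lw_pr pr_lab (cnt u) w) in e1'.
have e2' := e2; rewrite -{1}(lw_pr pr_lab (fun=> 0%N) u) in e2'.
set x1 := F (lw (cnt u) w) _ in R1 *; set x2 := F (lw0 u) _ in R2 *.
have [hle|hlt] := lerP (eps c x2) (phi c x1) => h.
  have h1 : 0 < eps c x1.
    move: h; rewrite [eps c _]/(teps c (x1, x2)) /teps /=; case: ifP => // hn.
    move: hle; rewrite /phi; move: hn; rewrite /phi /=; lia.
  have [W' [q' [m' pm dc ec [eq' eg]]]] := pred1 (nu_T lam_N) m1 e1' h1.
  have /and3P[_ fc mW'] := m'; have [_ R1'] := lr (nu_T lam_N) mW' eq'.
  have [_ hp] := dc.
  have cin : c \in lw (cnt u) w by rewrite -(perm_mem pm) mem_head.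
  have fc2 : fresh c (lw0 u) by apply: okl_fresh; apply: lw_okl cin.
  have st := pair_step rt R1' R2 (isT : predT c) (isT : predT c) fc fc2.
  have E1 : eps c x1 = eps c (F W' (pb lamN)) + 1 by rewrite /x1 -ec; apply: (eps_f hp).
  have E2 : wt x1 c = wt (F W' (pb lamN)) c - 2.
    by rewrite /x1 -ec -[2](A2d c); apply: (wt_f hp).
  have hl : eps c x2 < phi c (F W' (pb lamN)).
    have aux (e k n : int) : n <= e + 1 + (k - 2) -> n < e + k by clear; lia.
    by move: hle; rewrite /phi E1 E2; apply: aux.
  have hq : 0 < phi c ((F W' (pb lamN), x2) : tens (pcrys lamN) (pcrys muN)).
    rewrite /phi [eps c _]/(teps c (F W' (pb lamN), x2)) /teps /= /twt /= hl.
    have aux (n m e k : int) : n < e + k -> 0 <= n + m -> 0 < e + (k + m) by clear; lia.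
    exact: aux hl (phi_ge0 c x2).
  exists (map pr W'), u, q', p2; split=> //.
    rewrite size_map ltn_add2r; have := perm_size pm; rewrite /= => ->.
    by rewrite -(size_map pr) lw_pr.
  by rewrite st hq hl -eg.
have h2 : 0 < eps c x2 by apply: le_lt_trans hlt; apply: phi_ge0.
have [W' [q' [m' pm dc ec [eq' eg]]]] := pred1 (nu_T mu_N) m2 e2' h2.
have /and3P[_ fc mW'] := m'; have [_ R2'] := lr (nu_T mu_N) mW' eq'.
have [_ hp] := dc.
have cin : c \in lw0 u by rewrite -(perm_mem pm) mem_head.
have fc1 : fresh c (lw (cnt u) w) by apply: lw_disjoint.
have st := pair_step rt R1 R2' (isT : predT c) (isT : predT c) fc1 fc.
have E1 : eps c x2 = eps c (F W' (pb muN)) + 1 by rewrite /x2 -ec; apply: (eps_f hp).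
have hl : (eps c (F W' (pb muN)) < phi c x1) = false.
  by apply/negP/negP; rewrite -leNgt; move: hlt; rewrite E1 ltzD1.
have hq : 0 < phi c ((x1, F W' (pb muN)) : tens (pcrys lamN) (pcrys muN)).
  rewrite /phi [eps c _]/(teps c (x1, F W' (pb muN))) /teps /= /twt /= hl.
  by rewrite addrA subrK; exact: hp.
exists w, (map pr W'), p1, q'; split=> //.
  rewrite size_map ltn_add2l; have := perm_size pm; rewrite /= => ->.
  by rewrite -(size_map pr) lw_pr.
by rewrite st hq hl -eg.
Qed.

Lemma theta_f b q i b' : theta b q -> root_f cv rt i b = Some b' ->
  exists2 r, root_f cv rt i q.2 = Some r & theta b' (q.1, r).
Proof.
move=> [u [w [g e eb er]]] hb.
have eb' : FW (i :: w) (concat (straight lamV) q.1) = Some b' by rewrite FwS eb.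
have [|r er'] := (transfer (i :: w) g e).1; first by exists b'.
exists r; first by move: er'; rewrite FwS er.
by exists u, (i :: w).
Qed.

Lemma theta_f_None b q i : theta b q -> root_f cv rt i b = None -> root_f cv rt i q.2 = None.
Proof.
move=> [u [w [g e eb er]]] hb; case er' : (root_f _ _ _ _) => [r|//].
have [|b' eb'] := (transfer (i :: w) g e).2.
  by exists r; rewrite FwS er.
by move: eb'; rewrite FwS eb /= hb.
Qed.

(** Induction on the number of letters, undoing one letter while some [eps] is positive. At a
    highest pair the left word is empty, since its last letter would give a positive [eps], and the
    right word is good. *)
Lemma theta_total w u p1 p2 : FW w (straight lamV) = Some p1 -> FW u (straight muV) = Some p2 ->
  exists q, theta (concat p1 p2) q.
Proof.
have [N] := ubnP (size w + size u); elim: N w u p1 p2 => // N IH w u p1 p2 hN e1 e2.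
have [d1 _] := lift0 lam_N (cnt u) e1; have [d2 _] := lift0 mu_N (fun=> 0%N) e2.
pose x : tens (pcrys lamN) (pcrys muN) := (F (lw (cnt u) w) (pb lamN), F (lw0 u) (pb muN)).
have [[c hc]|hn] := pselect (exists c, 0 < eps c x).
  have [w' [u' [q1 [q2 [f1 f2 sz hf]]]]] := tensor_pred e1 e2 hc.
  have [|q hq] := IH w' u' q1 q2 _ f1 f2; first by lia.
  by have [r _ hr] := theta_f hq hf; exists (q.1, r).
have hx c : eps c x = 0.
  have := eps_ge0 c x; rewrite le_eqVlt => /orP[/eqP //|h]; by case: hn; exists c.
have w0 : w = [::].
  move: hx d1; rewrite /x; case: (w) => // i w' hx d1; exfalso.
  have t := teps_ge A2d (lab i (count_mem i u + count_mem i w')) (F (lw (cnt u) (i :: w')) (pb lamN))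
    (F (lw0 u) (pb muN)).
  by have := lt_le_trans (eps_cons d1) t; rewrite hx ltxx.
subst w; case: e1 => e1; subst p1.
have g : good u.
  split=> // c; have := hx c; rewrite /x [eps c _]/(teps c (pb lamN, F (lw0 u) (pb muN))) /teps /phi /=.
  rewrite [peps c (pb lamN)](pb_eps R A2d A2o A2z) [pwt (pb lamN) c](pb_wt R A2d A2o A2z) add0r.
  by case: ifP; lia.
by exists (p2, straight (shV p2)), u, [::].
Qed.

Lemma theta_surj u w p r : good u -> FW u (straight muV) = Some p ->
  FW w (straight (shV p)) = Some r -> exists2 b, theta b (p, r) & tensor_set cv rt lamV muV b.
Proof.
move=> g e er; have [|b eb] := (transfer w g e).2; first by exists r.
have d := pair_word_dw A1BC rtA A2E pr_real pr_lab lab_inj lam_N mu_N e eb.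
have [w1 [w2 [q1 [q2 [_ e1 e2 e3 _]]]]] := pair_word rtA pr_lab lab_inj lam_N mu_N e d.
exists b; first by exists u, w.
exists q1, q2; split; first by exists w1.
by split; [exists w2 | have : Some b = Some (concat q1 q2) by [rewrite -eb -e3]; case].
Qed.

Section BaseFacts.
Variables (o : J1 -> nat) (n : J2 -> nat) (nu : V -> R).
Hypothesis nu_n : forall c, okl o c -> nu (cv (pr c)) = (n c)%:R.

Lemma Bset_facts q i : Bset cv rt nu q -> based cv i q /\ (imag i -> incH cv i q).
Proof.
move=> [w e]; have e' := e; rewrite -{1}(lw_pr pr_lab o w) in e'.
have mW := lw_mf pr_lab lab_inj o w; have [_ hR] := lr nu_n mW e'.
have okc : okl o (lab i (o i + count_mem i w)) by apply: okl_lab => //; rewrite leq_addr.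
have fc := lw_fresh pr_lab lab_inj o w i.
split.
  by apply: (based_path A1BC rtA A2E pr_real nu_n mW e' okc); rewrite pr_lab.
by move=> im; have [_ /(_ _ okc)] := hR; rewrite pr_lab; apply.
Qed.

Lemma Bset_pred q i : is_real_idx A1 i -> Bset cv rt nu q -> mn (Hf cv i q) 0 1 + 1 <= 0 ->
  exists2 q', Bset cv rt nu q' & root_f cv rt i q' = Some q.
Proof.
move=> ri [w e] h; have e' := e; rewrite -{1}(lw_pr pr_lab o w) in e'.
have mW := lw_mf pr_lab lab_inj o w; have [d [hR _]] := lr nu_n mW e'.
pose c := lab i 0; have pc : pr c = i by rewrite /c pr_lab.
have re : ~~ imag i by rewrite negbK.
have okc : okl o c by apply/orP; left; rewrite pc re.
have hc : 0 < eps c (F (lw o w) (pb n)).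
  rewrite -(ltr_int R) /= (pepsE A2d A2o A2z).
  have := hR c okc; rewrite pc re => /(_ isT) E; move: h; rewrite E; lra.
have [W' [q' [m' pm dc ec [eq' eg]]]] := pred1 nu_n mW e' hc.
exists q'; first by exists (map pr W').
have /and3P[_ fc mW'] := m'; have [_ R'] := lr nu_n mW' eq'; have [_ hp] := dc.
by have := rel_root_f rt okc fc R'; rewrite hp pc eg pc.
Qed.

End BaseFacts.

Lemma tensor_facts b i : tensor_set cv rt lamV muV b -> based cv i b /\ (imag i -> incH cv i b).
Proof.
move=> [p1 [p2 [h1 [h2 ->]]]].
have [b1 i1] := Bset_facts (o := fun=> 0%N) (nu_ok lam_N (o := _)) i h1.
have [b2 i2] := Bset_facts (o := fun=> 0%N) (nu_ok mu_N (o := _)) i h2.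
split; first exact: based_concat.
move=> im s t s0 st t1; have {}i1 := i1 im; have {}i2 := i2 im.
rewrite Hf_concat /hcat; have [_ z2 _] := b2.
case: ifPn => hs; case: ifPn => ht.
- by apply: i1; lra.
- apply: (@le_trans _ _ (Hf cv i p1 1)); first by apply: i1; lra.
  by rewrite lerDl -[leLHS]z2; apply: i2; lra.
- by exfalso; lra.
- by rewrite lerD2l; apply: i2; lra.
Qed.

Lemma tensor_set_pred b i : is_real_idx A1 i -> tensor_set cv rt lamV muV b ->
  mn (Hf cv i b) 0 1 + 1 <= 0 ->
  exists2 b', tensor_set cv rt lamV muV b' & root_f cv rt i b' = Some b.
Proof.
move=> ri [p1 [p2 [[w e1] [[u e2] eb]]]] h.
have [d1 [R1 _]] := lift0 lam_N (cnt u) e1; have [d2 [R2 _]] := lift0 mu_N (fun=> 0%N) e2.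
pose c := lab i 0; have pc : pr c = i by rewrite /c pr_lab.
have re : ~~ imag i by rewrite negbK.
have E1 := R1 c isT; have E2 := R2 c isT; rewrite pc re in E1 E2.
have hc : 0 < eps c ((F (lw (cnt u) w) (pb lamN), F (lw0 u) (pb muN)) : tens (pcrys lamN) (pcrys muN)).
  rewrite -(ltr_int R) tens_eps.
  rewrite (_ : (fun t => _) = Hf cv i b); first by lra.
  by rewrite eb Hf_concat (E1 isT) (E2 isT).
have [w' [u' [q1 [q2 [f1 f2 _ hf]]]]] := tensor_pred e1 e2 hc.
exists (concat q1 q2); last by rewrite eb -hf pc.
by exists q1, q2; split; [exists w' | split; [exists u' | ]].
Qed.

Lemma tensor_set_f b i b' : tensor_set cv rt lamV muV b -> root_f cv rt i b = Some b' ->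
  tensor_set cv rt lamV muV b'.
Proof.
move=> [p1 [p2 [[w e1] [[u e2] ->]]]] hb'.
have [q [u0 [w0 [g e eb _]]]] := theta_total e1 e2.
have eb' : FW (i :: w0) (concat (straight lamV) q.1) = Some b' by rewrite FwS eb.
have d := pair_word_dw A1BC rtA A2E pr_real pr_lab lab_inj lam_N mu_N e eb'.
have [w1 [w2 [q1 [q2 [_ f1 f2 f3 _]]]]] := pair_word rtA pr_lab lab_inj lam_N mu_N e d.
exists q1, q2; split; first by exists w1.
by split; [exists w2 | have : Some b' = Some (concat q1 q2) by [rewrite -eb' -f3]; case].
Qed.

Lemma theta_Bset b q : theta b q -> Bset cv rt (shV q.1) q.2.
Proof. by move=> [u [w [_ _ _ er]]]; exists w. Qed.

Lemma theta_facts b q i : theta b q -> based cv i q.2 /\ (imag i -> incH cv i q.2).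
Proof. by move=> [u [w [g e _ er]]]; apply: (Bset_facts (shift_base g e)); exists w. Qed.

Lemma theta_wt b q : theta b q -> b 1 = q.2 1.
Proof.
move=> [u [w [g e eb er]]]; elim: w b q.2 eb er => [|i w IH] b r.
  by move=> [<-] [<-]; apply/funext => v; rewrite concat_1 /Defs.pi_of !mul1r.
rewrite !FwS; case eb: (Fw _ _ _ _) => [b0|//]; case er: (Fw _ _ _ _) => [r0|//] /= hb hr.
have th0 : theta b0 (q.1, r0) by exists u, w.
have [br _] := theta_facts i th0; have e1 := IH b0 r0 eb er.
have d := pair_word_dw A1BC rtA A2E pr_real pr_lab lab_inj lam_N mu_N e eb.
have [w1 [w2 [q1 [q2 [_ f1 f2 f3 _]]]]] := pair_word rtA pr_lab lab_inj lam_N mu_N e d.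
have [bb _] : based cv i b0 /\ (imag i -> incH cv i b0).
  apply: tensor_facts; exists q1, q2; split; first by exists w1.
  by split; [exists w2 | have : Some b0 = Some (concat q1 q2) by [rewrite -eb -f3]; case].
move: hb hr; rewrite (root_fE rt bb) (root_fE rt br).
case: ifP => // h1 [<-]; case: ifP => // h2 [<-]; apply/funext => v.
have [[lb _ _] _ _] := bb; have [[lr0 _ _] _ _] := br.
by rewrite /fg !th_ge1 // e1.
Qed.

Lemma theta_mn b q i : is_real_idx A1 i -> theta b q ->
  mn (Hf cv i b) 0 1 = mn (Hf cv i q.2) 0 1.
Proof.
move=> ri [u [w [g e eb er]]].
have d := pair_word_dw A1BC rtA A2E pr_real pr_lab lab_inj lam_N mu_N e eb.
have [w1 [w2 [q1 [q2 [_ f1 f2 f3 f4]]]]] := pair_word rtA pr_lab lab_inj lam_N mu_N e d.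
have ebq : b = concat q1 q2 by have : Some b = Some (concat q1 q2) by [rewrite -eb -f3]; case.
have [d1 [R1 _]] := lift0 lam_N (cnt w2) f1; have [d2 [R2 _]] := lift0 mu_N (fun=> 0%N) f2.
pose c := lab i 0; have pc : pr c = i by rewrite /c pr_lab.
have re : ~~ imag i by rewrite negbK.
have E1 := R1 c isT; have E2 := R2 c isT; rewrite pc re in E1 E2.
have er' := er; rewrite -{1}(lw_pr pr_lab (cnt u) w) in er'.
have [d' [R' _]] := lr (shift_base g e) (lw_mf pr_lab lab_inj (cnt u) w) er'.
have okc : okl (cnt u) c by apply/orP; left; rewrite pc re.
have E3 := R' c okc; rewrite pc re in E3.
have [_ /(_ (size (lw (cnt u) w))) hs] := good_highest g.
have [_ he _] := hs _ _ (leqnn _) (leqnn _) d d.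
have := congr1 (fun z : int => z%:~R : R) (he c); rewrite /xel f4 tens_eps /= (pepsE A2d A2o A2z).
move=> /oppr_inj h; rewrite (E3 isT) -h; congr mn.
by rewrite ebq Hf_concat (E1 isT) (E2 isT).
Qed.

End Decomposition.

(** * The operators e_i as partial inverses of f_i *)

Section CrystalE.
Variables (R : realType) (J V : Type) (A : J -> J -> int) (cv : J -> V) (rt : J -> V -> int).
Implicit Types (i : J) (b y : cpath R V) (S : set (cpath R V)).

(** A description uniform in i: compatibility with e_i then follows from compatibility with f_i. For
    real i it needs a predecessor inside S; for imaginary i membership is part of the definition of
    e_i. *)
Lemma ce_iff S i b y : (A i i = 2 \/ A i i <= 0) -> rt i (cv i) = A i i ->
  (forall x, S x -> based cv i x /\ (~~ is_real_idx A i -> incH cv i x)) ->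
  (is_real_idx A i -> forall x, S x -> mn (Hf cv i x) 0 1 + 1 <= 0 ->
     exists2 x', S x' & root_f cv rt i x' = Some x) ->
  S b -> ce A cv rt S i b = Some y <-> S y /\ root_f cv rt i y = Some b.
Proof.
move=> Ai rti hS hp Sb; have [bb ib] := hS b Sb; rewrite /ce.
have [re|im] := boolP (is_real_idx A i).
  have r2 : rt i (cv i) = 2 by rewrite rti; apply/eqP.
  split=> [|[Sy hy]]; last first.
    by have [by_ _] := hS y Sy; apply: (e_of_f r2 by_ bb hy).
  move=> he; have := he; rewrite root_e_reE //; case: ifP => // hm _.
  have [x Sx hx] := hp re b Sb hm; have [bx _] := hS x Sx.
  by have := e_of_f r2 bx bb hx; rewrite he => -[->].
have a0 : A i i <= 0 by case: Ai => // h; move: im; rewrite /is_real_idx h eqxx.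
split=> [|[Sy hy]].
  case e: (root_e_im _ _ _ _ _) => [q|//] /=; case: ifP => // /asboolP Sq [qy]; subst q.
  have [by_ iy] := hS y Sq; split=> //.
  by apply: (f_of_e_im rti a0 by_ (iy im) bb (ib im) e).
have [by_ iy] := hS y Sy.
by rewrite (e_im_of_f rti a0 by_ (iy im) bb (ib im) hy) /= ifT //; apply/asboolP.
Qed.

End CrystalE.

(** * The Cartan matrix of the associated Kac-Moody datum *)

Section TildeMatrix.
Variables (I : eqType) (a : I -> I -> int).
Implicit Types c d : tI a.

Lemma tA_E c d : tA c d = if c == d then 2 else a (val c).1 (val d).1.
Proof. by rewrite /tA val_eqE. Qed.

Lemma tI_real c d : a (val c).1 (val c).1 = 2 -> (val c).1 = (val d).1 -> c = d.
Proof.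
case: c d => [[i m] hm] [[j k] hk] /= ai ij; subst j; apply: val_inj => /=; congr pair.
by move: hm hk; rewrite /tI_pred /= ai eqxx => /eqP -> /eqP ->.
Qed.

Lemma tidx_inj i m m' : imag a i -> tidx_of a i m = tidx_of a i m' -> m = m'.
Proof.
move=> /negPf; rewrite /is_real_idx => h /(congr1 val) /=; rewrite h => -[].
by [].
Qed.

Lemma lift_word_lw w : lift_word a w = lw (tidx_of a) (fun=> 0%N) w.
Proof. by elim: w => //= i w ->; rewrite add0n. Qed.

Hypothesis HA : BC_matrix a.

Lemma tA_BC : BC_matrix (@tA _ a).
Proof.
split; first by move=> c; left; apply: A2diag tA_E c.
split; first by apply: A2off HA tA_E tI_real.
exact: A2zero HA tA_E.
Qed.

End TildeMatrix.

(** * Assembly of the isomorphism *)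

Section Isomorphism.
Variables (R : realType) (I : countType) (a : I -> I -> int).
Hypotheses (HA : BC_matrix a) (Hsym : symmetrizable a).
Variables (Pv : zmodType) (cv : I -> Pv) (rt : I -> Pv -> int).
Hypothesis Hdat : realization a cv rt.
Variables (Pvt : zmodType) (cvt : tI a -> Pvt) (rtt : tI a -> Pvt -> int).
Hypothesis Hdatt : realization (@tA _ a) cvt rtt.
Variables (lam mu : Pv -> int) (lamt mut : Pvt -> int).
Hypotheses (Hlam_dom : forall i, 0 <= lam (cv i)) (Hmu_dom : forall i, 0 <= mu (cv i)).
Hypothesis Hlamt_c : forall p : tI a, lamt (cvt p) = lam (cv (val p).1).
Hypothesis Hmut_c : forall p : tI a, mut (cvt p) = mu (cv (val p).1).

Let pr (c : tI a) : I := (val c).1.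
Let lab := tidx_of a.
Let lamN (c : tI a) : nat := `|lam (cv (pr c))|%N.
Let muN (c : tI a) : nat := `|mu (cv (pr c))|%N.
Let lamV : Pv -> R := toR R lam.
Let muV : Pv -> R := toR R mu.

Local Lemma rtA i j : rt j (cv i) = a i j. Proof. by case: Hdat. Qed.

Local Lemma rt_indep (s : seq I) (c : I -> int) : uniq s ->
  (forall v, \sum_(j <- s) c j * rt j v = 0) -> forall j, j \in s -> c j = 0.
Proof. by case: Hdat => _ _ _ _; apply. Qed.

Local Lemma pr_lab i m : pr (lab i m) = i. Proof. by []. Qed.

Local Lemma lam_N c : lamV (cv (pr c)) = (lamN c)%:R.
Proof. by rewrite /lamV /toR /lamN -[(`|_|%N)%:R]/((`|_|%N)%:Z%:~R) gez0_abs. Qed.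

Local Lemma mu_N c : muV (cv (pr c)) = (muN c)%:R.
Proof. by rewrite /muV /toR /muN -[(`|_|%N)%:R]/((`|_|%N)%:Z%:~R) gez0_abs. Qed.

Local Notation good u := (good R HA (@tA_E _ a) (@tI_real _ a) lab lamN muN u).
Local Notation theta := (theta cv rt HA (@tA_E _ a) (@tI_real _ a) lab lamN muN lamV muV).

Local Notation pbm := (pb R (A2diag (@tA_E _ a)) (A2off HA (@tA_E _ a) (@tI_real _ a))
  (A2zero HA (@tA_E _ a)) muN).

Section Tilde.

(** The Kac-Moody datum is regarded as a lift of itself along the identity, with all indices real,
    so the lifting results also compute the paths for the Kac-Moody realization. *)
Local Lemma tA_E' (c d : tI a) : tA c d = if c == d then 2 else tA (id c) (id d).
Proof. by case: eqP => // ->; rewrite tA_E eqxx. Qed.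

Local Lemma id_inj (c d : tI a) : tA (id c) (id c) = 2 -> id c = id d -> c = d.
Proof. by []. Qed.

Local Lemma rtAt (c d : tI a) : rtt d (cvt c) = tA c d. Proof. by case: Hdatt. Qed.

Local Lemma mut_N (c : tI a) : predT c -> toR R mut (cvt (id c)) = (muN c)%:R.
Proof. by move=> _; rewrite /toR Hmut_c -mu_N. Qed.

Local Lemma mf_id (W : seq (tI a)) : mf (@tA _ a) id predT W.
Proof. by elim: W => //= c W ->; rewrite /imag negbK /is_real_idx /tA eqxx. Qed.

Local Notation pbt := (pb R (A2diag tA_E') (A2off (tA_BC HA) tA_E' id_inj)
  (A2zero (tA_BC HA) tA_E') muN).

(** The two crystals differ only in the proofs of the matrix axioms they carry; their underlying
    paths coincide. *)
Local Lemma pbt_pbm W : dw W pbt -> dw W pbm /\ pval (F W pbm) = pval (F W pbt).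
Proof.
move=> /pval_F[ad ->]; have d := dw_adm (A2diag (@tA_E _ a))
  (A2off HA (@tA_E _ a) (@tI_real _ a)) (A2zero HA (@tA_E _ a)) ad.
by split.
Qed.

Local Lemma tdominant_eps (W : seq (tI a)) pt : Fw cvt rtt W (Defs.pi_of (toR R mut)) = Some pt ->
  dw W pbm /\ (tdominant cvt lamt pt <-> forall c, eps c (F W pbm) <= (lamN c)%:Z).
Proof.
rewrite -{1}(map_id W) => e.
have [d [hR _]] := lift_rel (tA_BC HA) rtAt tA_E' id_inj mut_N (mf_id W) e.
have [dm0 em] := pbt_pbm d; split=> //; rewrite -em in hR.
have hH c : Hf cvt c pt = fun t => pval (F W pbm) t (inl c).
  by apply: hR => //; rewrite negbK /is_real_idx /tA eqxx.
have hl c : lip (Hf cvt c pt).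
  rewrite hH; have [[]] // := car_based (A2diag (@tA_E _ a))
    (A2off HA (@tA_E _ a) (@tI_real _ a)) (A2zero HA (@tA_E _ a)) (F W pbm) c.
have he c : (eps c (F W pbm) <= (lamN c)%:Z) = (- mn (Hf cvt c pt) 0 1 <= (lamN c)%:R).
  rewrite -(ler_int R) /= (pepsE (A2diag (@tA_E _ a))
    (A2off HA (@tA_E _ a) (@tI_real _ a)) (A2zero HA (@tA_E _ a))).
  by rewrite hH.
have hN c : (lamt (cvt c))%:~R = (lamN c)%:R :> R by rewrite Hlamt_c -lam_N.
split=> [h c|h c t ht].
  rewrite he lerNl; apply: mn_ge => // t ht.
  by have := h c t ht; rewrite hN -/(Hf cvt c pt t); lra.
have := h c; rewrite he hN -/(Hf cvt c pt t).
by have := mn_le (hl c) ht; lra.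
Qed.

Local Lemma Fw_tilde (W : seq (tI a)) : dw W pbm ->
  exists pt, Fw cvt rtt W (Defs.pi_of (toR R mut)) = Some pt.
Proof.
move=> /pval_F[ad _]; have d := dw_adm (A2diag tA_E') (A2off (tA_BC HA) tA_E' id_inj)
  (A2zero (tA_BC HA) tA_E') ad.
have [pt e _] := lift_dw rtAt mut_N (mf_id W) d; exists pt.
by rewrite map_id in e.
Qed.

End Tilde.

Local Lemma good_piP p : good_pi cv rt cvt rtt mu lamt mut p <->
  exists2 u, good u & Fw cv rt u (Defs.pi_of muV) = Some p.
Proof.
split=> [[w [e [pt [ept dpt]]]]|[w [dW he] e]].
  exists w => //; move: ept; rewrite lift_word_lw => /tdominant_eps[d h].
  by split=> //; apply/h.
exists w; split=> //; have [pt ept] := Fw_tilde dW; exists pt.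
by rewrite lift_word_lw; split=> //; have [_ h] := tdominant_eps ept; apply/h.
Qed.

Local Notation T := (tensor_set cv rt lamV muV).
Local Notation U := (union_set cv rt cvt rtt lam mu lamt mut).

Local Lemma lab_inj i m m' : imag a i -> lab i m = lab i m' -> m = m'.
Proof. exact: tidx_inj. Qed.

Local Lemma theta_ex b : T b -> exists q, theta b q.
Proof.
move=> [p1 [p2 [[w e1] [[u e2] ->]]]].
exact: (theta_total HA rtA (@tA_E _ a) (@tI_real _ a) pr_lab lab_inj lam_N mu_N e1 e2).
Qed.

Local Lemma theta_U b q : theta b q -> U q.
Proof.
move=> th; split; last exact: theta_Bset th.
by apply/good_piP; have [u [w [g e _ _]]] := th; exists u.
Qed.

Local Lemma U_theta q : U q -> exists2 b, theta b q & T b.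
Proof.
case: q => [p r] [/good_piP[u g e] [w er]].
exact: (theta_surj rtA pr_lab lab_inj lam_N mu_N g e er).
Qed.

Lemma tensor_isomorphism :
  exists Psi : cpath R Pv -> cpath R Pv * cpath R Pv,
    [/\ (forall b, T b -> U (Psi b)),
        (forall b b', T b -> T b' -> Psi b = Psi b' -> b = b'),
        (forall q, U q -> exists2 b, T b & Psi b = q) &
        (forall b, T b ->
           [/\ cwt (Psi b).2 = cwt b,
               (forall i, ceps a cv i (Psi b).2 = ceps a cv i b),
               (forall i, cphi a cv i (Psi b).2 = cphi a cv i b),
               (forall i, union_f cv rt i (Psi b) = omap Psi (cf cv rt i b)) &
               (forall i, union_e a cv rt lam i (Psi b) = omap Psi (ce a cv rt T i b))])].
Proof.
have [d [d_gt0 dA]] := Hsym.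
have dm_gt0 (c : tI a) : (0 < d (pr c))%N by [].
have dmA (c c' : tI a) : (d (pr c))%:Z * tA c c' = (d (pr c'))%:Z * tA c' c.
  by rewrite !tA_E eq_sym; case: eqP => [->|].
have tfun := @theta_fun _ _ _ _ _ _ cv rt pr HA rtA (@tA_E _ a) (@tI_real _ a) _ dm_gt0 dmA
  rt_indep lab pr_lab lab_inj _ _ _ _ lam_N mu_N.
have tinj := @theta_inj _ _ _ _ _ _ cv rt pr HA rtA (@tA_E _ a) (@tI_real _ a) _ dm_gt0 dmA
  rt_indep lab pr_lab lab_inj _ _ _ _ lam_N mu_N.
(* Outside the tensor product the value is arbitrary, and [(b, b)] has the right type. *)
have /choice[Psi hPsi] : forall b, exists q, T b -> theta b q.
  move=> b; have [/theta_ex[q hq]|nT] := pselect (T b); first by exists q.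
  by exists (b, b).
have PsiE b q : T b -> theta b q -> Psi b = q by move=> Tb; apply: tfun; apply: hPsi.
have facts b i (Tb : T b) := tensor_facts HA rtA (@tA_E _ a) (@tI_real _ a) pr_lab lab_inj lam_N mu_N i Tb.
have Tf b i b' (Tb : T b) := @tensor_set_f _ _ _ _ _ _ cv rt pr HA rtA (@tA_E _ a) (@tI_real _ a)
  lab pr_lab lab_inj _ _ _ _ lam_N mu_N b i b' Tb.
have Psi_f b i : T b -> union_f cv rt i (Psi b) = omap Psi (cf cv rt i b).
  move=> Tb; have th := hPsi b Tb; rewrite /union_f /cf.
  case e: (root_f cv rt i b) => [b'|] /=; last first.
    by rewrite (theta_f_None rtA pr_lab lab_inj lam_N mu_N th e).
  have [r -> thr] := theta_f rtA pr_lab lab_inj lam_N mu_N th e.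
  by rewrite /= (PsiE _ _ (Tf _ _ _ Tb e) thr).
have Psi_inj b b' : T b -> T b' -> Psi b = Psi b' -> b = b'.
  by move=> Tb Tb' e; apply: (tinj b b' (Psi b)); [exact: hPsi | rewrite e; exact: hPsi].
exists Psi; split=> //.
- by move=> b Tb; apply: theta_U (hPsi b Tb).
- by move=> q /U_theta[b th Tb]; exists b => //; apply: PsiE.
move=> b Tb; have th := hPsi b Tb.
have wtE : (Psi b).2 1 = b 1 by rewrite (theta_wt rtA pr_lab lab_inj lam_N mu_N th).
have mE i : is_real_idx a i -> mval cv i (Psi b).2 = mval cv i b.
  move=> re; have [[bn _ _] _] := facts b i Tb.
  have [[qn _ _] _] := theta_facts rtA pr_lab lab_inj lam_N mu_N i th.
  by rewrite !mval_mn // (theta_mn rtA pr_lab lab_inj lam_N mu_N re th).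
have HE i : Hf cv i (Psi b).2 1 = Hf cv i b 1 by rewrite /Hf wtE.
split=> // [i|i|i|i].
- by rewrite /ceps; case: ifP => // re; rewrite mE.
- by rewrite /cphi HE; case: ifP => // re; rewrite mE.
- exact: Psi_f.
have [u [w [g e eb er]]] := th.
have nu_n := shift_base rtA pr_lab lab_inj lam_N mu_N g e.
pose S : set (cpath R Pv) := Bset cv rt (fun v => toR R lam v + (Psi b).1 1 v).
have SB : S = Bset cv rt (shV lamV (Psi b).1) by [].
have Sf x : S x -> based cv i x /\ (~~ is_real_idx a i -> incH cv i x).
  exact: (Bset_facts HA rtA (@tA_E _ a) (@tI_real _ a) pr_lab lab_inj nu_n i).
have S2 : S (Psi b).2 by exact: theta_Bset th.
have ceS y := ce_iff (b := (Psi b).2) y (HA.1 i) (rtA i i) Sf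
  (fun re x Sx => Bset_pred HA rtA (@tA_E _ a) (@tI_real _ a) pr_lab lab_inj nu_n re Sx) S2.
have ceT y := ce_iff (b := b) y (HA.1 i) (rtA i i) (fun x Tx => facts x i Tx)
  (fun re x Tx => tensor_set_pred HA rtA (@tA_E _ a) (@tI_real _ a) pr_lab lab_inj lam_N mu_N re Tx) Tb.
(* Both e-operators are rewritten through [ce_iff], so it suffices to transport the equation f_i y =
   b along [Psi]. *)
rewrite /union_e -/S; case ey: (ce a cv rt T i b) => [y|] /=.
  have [Ty fy] := (ceT y).1 ey.
  have := Psi_f y i Ty; rewrite /union_f /cf fy /=.
  case ez: (root_f cv rt i (Psi y).2) => [z|//] /= [eq].
  have ezb : z = (Psi b).2 by rewrite -eq.
  have e1 : (Psi y).1 = (Psi b).1 by rewrite -eq.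
  have -> : ce a cv rt S i (Psi b).2 = Some (Psi y).2.
    apply/(ceS (Psi y).2); split; last by rewrite ez ezb.
    by rewrite SB -e1; apply: theta_Bset (hPsi y Ty).
  by rewrite /= -e1 -surjective_pairing.
case ez: (ce a cv rt S i (Psi b).2) => [z|//]; exfalso.
have [Sz fz] := (ceS z).1 ez.
(* A predecessor z in the component comes from some y in the tensor product, and f_i y = b by
   injectivity of [Psi], contradicting the vanishing of e_i at b. *)
have [y thy Ty] : exists2 y, theta y ((Psi b).1, z) & T y.
  have [wz ewz] : S z by [].
  exact: (theta_surj rtA pr_lab lab_inj lam_N mu_N g e ewz).
have Py := PsiE y _ Ty thy; have := Psi_f y i Ty; rewrite Py /union_f /cf /= fz /=.
case fy: (root_f cv rt i y) => [b'|//] /= [eq].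
have bb : b = b'.
  apply: Psi_inj => //; first exact: (Tf y i).
  by rewrite -eq -surjective_pairing.
have := (ceT y).2; rewrite ey bb fy => h.
by have := h (conj Ty erefl).
Qed.

End Isomorphism.

Theorem theorem7p1p3
  (R : realType) (I : countType) (a : I -> I -> int)
  (HA : BC_matrix a) (Hsym : symmetrizable a) (Hev : even_matrix a)
  (Pv : zmodType) (cv : I -> Pv) (rt : I -> Pv -> int)
  (Hdat : realization a cv rt)
  (Pvt : zmodType) (cvt : tI a -> Pvt) (rtt : tI a -> Pvt -> int)
  (Hdatt : realization (@tA _ a) cvt rtt)
  (lam mu : Pv -> int) (Hlam : in_P lam) (Hmu : in_P mu)
  (Hlam_dom : forall i, 0 <= lam (cv i)) (Hmu_dom : forall i, 0 <= mu (cv i))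
  (lamt mut : Pvt -> int) (Hlamt : in_P lamt) (Hmut : in_P mut)
  (Hlamt_c : forall p : tI a, lamt (cvt p) = lam (cv (val p).1))
  (Hmut_c : forall p : tI a, mut (cvt p) = mu (cv (val p).1)) :
  let T := tensor_set cv rt (toR R lam) (toR R mu) in
  let U : set (cpath R Pv * cpath R Pv) := union_set cv rt cvt rtt lam mu lamt mut in
  exists Psi : cpath R Pv -> cpath R Pv * cpath R Pv,
    [/\ (forall b, T b -> U (Psi b)),
        (forall b b', T b -> T b' -> Psi b = Psi b' -> b = b'),
        (forall q, U q -> exists2 b, T b & Psi b = q) &
        (forall b, T b ->
           [/\ cwt (Psi b).2 = cwt b,
               (forall i, ceps a cv i (Psi b).2 = ceps a cv i b),
               (forall i, cphi a cv i (Psi b).2 = cphi a cv i b),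
               (forall i, union_f cv rt i (Psi b) = omap Psi (cf cv rt i b)) &
               (forall i, union_e a cv rt lam i (Psi b) = omap Psi (ce a cv rt T i b))])].
Proof. exact: tensor_isomorphism. Qed.
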